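(* Let $(M^n,h)$ and $(L^k,g)$ be oriented Riemannian manifolds with $n\ge k\ge2$ and $M$ compact. Let $\alpha\in\Omega^{n-k}(M)$ be a closed calibration and let $u\colon(M,h)\to(L,g)$ be a Smith submersion with respect to $\alpha$. Then $u$ is $k$-harmonic in the sense that it is a critical point of the $k$-energy $E_k$.
   Context: A form $\alpha\in\Omega^{m}(M)$ is a calibration if $|\alpha(e_1,\dots,e_m)|\le1$ for all orthonormal $e_1,\dots,e_m\in T_xM$, $x\in M$; it is a closed calibration if also $d\alpha=0$. $|du|^2=\operatorname{tr}_h(u^*g)$. A smooth surjection $u\colon(M^n,h)\to(L^k,g)$ is a Smith submersion with respect to $\alpha\in\Omega^{n-k}(M)$ if $\alpha\wedge u^*\mathrm{vol}_L=\frac{1}{(\sqrt k)^k}|du|^k\,\mathrm{vol}_M$ at all points of $M$; this automatically implies that at each point where $du\ne0$, $du$ has rank $k$ and $u^*g=\frac1k|du|^2h^{(0,2)}$, where $h^{(0,2)}$ is the restriction of $h$ to $(\ker du)^\perp$ extended by zero on $\ker du$ ($du$ may vanish at some points). For a smooth map $u$ with compact domain $M$, $E_k(u)=\frac{1}{(\sqrt k)^k}\int_M|du|^k\,\mathrm{vol}_M$; $u$ is a critical point of $E_k$ if $\frac{d}{dt}\big|_{t=0}E_k(u_t)=0$ for every smooth one-parameter family of maps $u_t\colon M\to L$ with $u_0=u$. *)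

(* Defs.v *)
From HB Require Import structures.
From mathcomp Require Import all_boot all_order all_algebra fingroup perm.
From mathcomp Require Import all_classical all_reals all_analysis.
From mathcomp Require Import measurable_realfun.

Set Implicit Arguments.
Unset Strict Implicit.
Unset Printing Implicit Defensive.

Import Order.TTheory GRing.Theory Num.Theory.
Import numFieldNormedType.Exports.

Local Open Scope classical_set_scope.
Local Open Scope ring_scope.

(* [Ck_on r U f] is meant for open [U]. *)
Fixpoint Ck_on (R : realType) (V W : normedModType R) (r : nat) (U : set V)
    (f : V -> W) : Prop :=
  match r with
  | 0 => forall x, U x -> {for x, continuous f}
  | r'.+1 => (forall x, U x -> differentiable f x) /\
             (forall v, Ck_on r' U (fun x => 'D_v f x))
  end.

Definition smooth_on (R : realType) (V W : normedModType R) (U : set V)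
  (f : V -> W) : Prop := forall r, Ck_on r U f.

Record chart (R : realType) (n : nat) (T : topologicalType) := Chart {
  chart_dom : set T;
  chart_coord : T -> 'rV[R]_n;
  chart_inv : 'rV[R]_n -> T;
  open_chart_dom : open chart_dom;
  open_chart_codom : open (chart_coord @` chart_dom);
  chart_coordK : forall p, chart_dom p -> chart_inv (chart_coord p) = p;
  chart_coord_continuous : {within chart_dom, continuous chart_coord};
  chart_inv_continuous : {within chart_coord @` chart_dom, continuous chart_inv}
}.

Definition chart_codom (R : realType) n (T : topologicalType)
  (c : chart R n T) : set 'rV[R]_n := chart_coord c @` chart_dom c.

(* Smooth oriented manifolds without boundary, given by an oriented atlas
   (not necessarily maximal); [chart_at] is a choice of chart around each
   point. Manifolds are nonempty, as the library's measurable types carry a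
   base point. *)
Record oriented_manifold (R : realType) (n : nat) := OrientedManifold {
  carrier :> ptopologicalType;
  chart_idx : Type;
  atlas : chart_idx -> chart R n carrier;
  chart_at : carrier -> chart_idx;
  mem_chart_at : forall p, chart_dom (atlas (chart_at p)) p;
  transition_smooth : forall i j,
    smooth_on
      (chart_coord (atlas i) @`
         (chart_dom (atlas i) `&` chart_dom (atlas j)))
      (chart_coord (atlas j) \o chart_inv (atlas i));
  transition_oriented : forall i j y,
    (chart_coord (atlas i) @`
       (chart_dom (atlas i) `&` chart_dom (atlas j))) y ->
    0 < \det ('J (chart_coord (atlas j) \o chart_inv (atlas i)) y);
  manifold_hausdorff : hausdorff_space carrier;
  manifold_second_countable : @second_countable carrier
}.

Section Geometry.
Context {R : realType}.

(* Coordinate expression of the map [f] in the charts [i] and [j], and the set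
   on which it is meaningful. *)
Definition local_rep n k (M : oriented_manifold R n) (L : oriented_manifold R k)
  (f : M -> L) (i : chart_idx M) (j : chart_idx L) : 'rV[R]_n -> 'rV[R]_k :=
  chart_coord (atlas j) \o f \o chart_inv (atlas i).

Definition local_dom n k (M : oriented_manifold R n) (L : oriented_manifold R k)
  (f : M -> L) (i : chart_idx M) (j : chart_idx L) : set 'rV[R]_n :=
  chart_coord (atlas i) @`
    (chart_dom (atlas i) `&` f @^-1` chart_dom (atlas j)).

Definition smooth_map n k (M : oriented_manifold R n)
    (L : oriented_manifold R k) (f : M -> L) : Prop :=
  continuous f /\ forall i j, smooth_on (local_dom f i j) (local_rep f i j).

(* A covariant [m]-tensor is given in each chart [i], at the point with
   coordinates [y], as a function of [m] tangent vectors, which are the rows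
   of a matrix in the coordinate basis of that chart. A tangent vector is a
   row [v], and the differential of [f] maps [v] to [v *m 'J f y]. *)
Definition cotensor n (M : oriented_manifold R n) (m : nat) : Type :=
  chart_idx M -> 'rV[R]_n -> 'M[R]_(m, n) -> R.

Record diff_form n (M : oriented_manifold R n) (m : nat) := DiffForm {
  form_val :> cotensor M m;
  form_multilinear : forall i y (A B C : 'M[R]_(m, n)) (a : 'I_m) (b c : R),
    chart_codom (atlas i) y ->
    row a A = b *: row a B + c *: row a C ->
    row' a B = row' a A -> row' a C = row' a A ->
    form_val i y A = b * form_val i y B + c * form_val i y C;
  form_alternating : forall i y (A : 'M[R]_(m, n)) (a b : 'I_m),
    chart_codom (atlas i) y -> a != b -> row a A = row b A ->
    form_val i y A = 0;
  form_smooth : forall i (A : 'M[R]_(m, n)),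
    smooth_on (chart_codom (atlas i)) (fun y => form_val i y A : R^o);
  form_compat : forall i j y (A : 'M[R]_(m, n)),
    local_dom (id : M -> M) i j y ->
    form_val i y A = form_val j (local_rep (id : M -> M) i j y)
                       (A *m 'J (local_rep (id : M -> M) i j) y)
}.

(* [metric_val i y] is the Gram matrix of the coordinate vector fields. *)
Record riem_metric n (M : oriented_manifold R n) := RiemMetric {
  metric_val :> chart_idx M -> 'rV[R]_n -> 'M[R]_n;
  metric_sym : forall i y, chart_codom (atlas i) y ->
    (metric_val i y)^T = metric_val i y;
  metric_posdef : forall i y (v : 'rV[R]_n),
    chart_codom (atlas i) y -> v != 0 ->
    0 < (v *m metric_val i y *m v^T) 0 0;
  metric_smooth : forall i, smooth_on (chart_codom (atlas i)) (metric_val i);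
  metric_compat : forall i j y, local_dom (id : M -> M) i j y ->
    let J := 'J (local_rep (id : M -> M) i j) y in
    metric_val i y
      = J *m metric_val j (local_rep (id : M -> M) i j y) *m J^T
}.

Definition ext_deriv n (M : oriented_manifold R n) m (w : cotensor M m) :
  cotensor M m.+1 := fun i y v =>
  \sum_(a < m.+1)
     (-1) ^+ a * 'D_(row a v) (fun z => w i z (row' a v) : R^o) y.

(* Normalised so that dx_1 /\ ... /\ dx_n is the determinant. *)
Definition wedge_form n (M : oriented_manifold R n) p q (a : cotensor M p)
  (b : cotensor M q) : cotensor M (p + q) := fun i y v =>
  ((p`! * q`!)%N%:R)^-1 *
  \sum_(s : 'S_(p + q))
     (-1) ^+ s * a i y (usubmx (row_perm s v)) * b i y (dsubmx (row_perm s v)).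

Definition pullback_form n k (M : oriented_manifold R n)
  (L : oriented_manifold R k) m (f : M -> L) (w : cotensor L m) :
  cotensor M m := fun i y v =>
  let q := f (chart_inv (atlas i) y) in
  let j := chart_at q in
  w j (chart_coord (atlas j) q) (v *m 'J (local_rep f i j) y).

Definition vol_form n (M : oriented_manifold R n) (h : riem_metric M) :
  cotensor M n := fun i y v => Num.sqrt (\det (h i y)) * \det v.

Definition closed_form n (M : oriented_manifold R n) m
    (w : diff_form M m) : Prop :=
  forall i y v, chart_codom (atlas i) y -> ext_deriv w i y v = 0.

Definition orthonormal n (M : oriented_manifold R n) (h : riem_metric M)
  (i : chart_idx M) (y : 'rV[R]_n) m (e : 'M[R]_(m, n)) : Prop :=
  e *m h i y *m e^T = 1%:M.

Definition calibration n (M : oriented_manifold R n) (h : riem_metric M) m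
    (w : diff_form M m) : Prop :=
  forall i y (e : 'M[R]_(m, n)),
    chart_codom (atlas i) y -> orthonormal h i y e -> `|form_val w i y e| <= 1.

Definition closed_calibration n (M : oriented_manifold R n)
  (h : riem_metric M) m (w : diff_form M m) : Prop :=
  calibration h w /\ closed_form w.

Definition pullback_metric n k (M : oriented_manifold R n)
  (L : oriented_manifold R k) (f : M -> L) (g : riem_metric L) :
  chart_idx M -> 'rV[R]_n -> 'M[R]_n := fun i y =>
  let q := f (chart_inv (atlas i) y) in
  let j := chart_at q in
  let J := 'J (local_rep f i j) y in
  J *m g j (chart_coord (atlas j) q) *m J^T.

Definition norm_d n k (M : oriented_manifold R n) (L : oriented_manifold R k)
  (h : riem_metric M) (g : riem_metric L) (f : M -> L) (p : M) : R :=
  let i := chart_at p in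
  let y := chart_coord (atlas i) p in
  Num.sqrt (\tr (invmx (h i y) *m pullback_metric f g i y)).

(* [castmx] only identifies (n - k) + k with n. *)
Definition smith_submersion n k (hkn : (k <= n)%N)
    (M : oriented_manifold R n) (L : oriented_manifold R k)
    (h : riem_metric M) (g : riem_metric L) (w : diff_form M (n - k))
    (u : M -> L) : Prop :=
  [/\ smooth_map u,
      (forall q : L, exists p : M, u p = q) &
      forall i y (v : 'M[R]_n), chart_codom (atlas i) y ->
        wedge_form w (pullback_form u (vol_form g)) i y
          (castmx (esym (subnK hkn), erefl) v)
        = (Num.sqrt k%:R ^+ k)^-1 * norm_d h g u (chart_inv (atlas i) y) ^+ k
          * vol_form h i y v].

(* Lebesgue integral over R^n of a nonnegative Borel function, computed one
   coordinate at a time (Tonelli). *)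
Fixpoint integral_rV n : ('rV[R]_n -> \bar R) -> \bar R :=
  match n with
  | 0 => fun f => f 0
  | n'.+1 => fun f => (\int[lebesgue_measure]_(x in [set: R])
      integral_rV (fun y : 'rV[R]_n' => f (row_mx (x%:M : 'rV[R]_1) y)))%E
  end.

Definition borel_space n (M : oriented_manifold R n) :
    measurableType (sigma_display (@open (carrier M))) :=
  g_sigma_algebraType (@open (carrier M)).

(* The Riemannian volume measure is the unique Borel measure that is
   sqrt (det h) dx_1 ... dx_n in each chart. *)
Definition is_vol_measure n (M : oriented_manifold R n) (h : riem_metric M)
    (mu : {measure set (borel_space M) -> \bar R}) : Prop :=
  forall (i : chart_idx M) (f : borel_space M -> \bar R),
    measurable_fun [set: borel_space M] f -> (forall p, 0 <= f p)%E ->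
    (forall p, ~ chart_dom (atlas i) p -> f p = 0%E) ->
    (\int[mu]_(p in setT) f p)%E =
    integral_rV ((fun y => f (chart_inv (atlas i) y)
                   * (Num.sqrt (\det (h i y)))%:E)%E
                 \_ (chart_codom (atlas i))).

(* [mzero] is a junk value, used only if no such measure exists, which never
   happens. *)
Definition vol_measure n (M : oriented_manifold R n) (h : riem_metric M) :
  {measure set (borel_space M) -> \bar R} :=
  if pselect (exists mu, is_vol_measure h mu) is left hmu
  then sval (cid hmu) else mzero.

Definition k_energy n k (M : oriented_manifold R n) (L : oriented_manifold R k)
  (h : riem_metric M) (g : riem_metric L) (u : M -> L) : R :=
  (Num.sqrt k%:R ^+ k)^-1 *
  \int[vol_measure h]_(p in setT) (norm_d h g u p ^+ k).

(* Joint smoothness of (t, p) |-> u_ t p on ]-e, e[ * M. *)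
Definition smooth_family n k (M : oriented_manifold R n)
    (L : oriented_manifold R k) (e : R) (u_ : R -> M -> L) : Prop :=
  (forall (t : R) (p : M), `|t| < e ->
     {for (t, p), continuous (fun z : R * M => u_ z.1 z.2)}) /\
  forall i j,
    smooth_on
      [set z : R^o * 'rV[R]_n | `|z.1| < e /\ local_dom (u_ z.1) i j z.2]
      (fun z => local_rep (u_ z.1) i j z.2).

Definition critical_point n k (M : oriented_manifold R n)
    (L : oriented_manifold R k) (h : riem_metric M) (g : riem_metric L)
    (u : M -> L) : Prop :=
  forall (e : R) (u_ : R -> M -> L), 0 < e -> smooth_family e u_ ->
    u_ 0 =1 u -> is_derive (0 : R^o) (1 : R^o)
                   (fun t : R^o => k_energy h g (u_ t) : R^o) 0.

End Geometry.

(* Main.v *)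
(* For any map v, the calibration inequality
   alpha ^ v^* vol_L <= k^(-k/2) |dv|^k vol_M holds pointwise, with equality
   at v = u.  Along a family u_t the two sides therefore have the same
   derivative at t = 0, and that of the left-hand side is exact because alpha
   and vol_L are closed.  A partition of unity psi_q reduces the integral of
   this derivative to charts: in place of cutting off forms, u_t is replaced by
   the maps p |-> u_(t psi_q(p))(p), whose first variation at p is linear in
   psi_q and vanishes off its support.  In a chart it is the divergence of an
   explicit vector field with compact support, whose integral vanishes by
   translation invariance of the Lebesgue measure. *)

Require Import Defs.
From HB Require Import structures.
From mathcomp Require Import all_boot all_order all_algebra fingroup perm.
From mathcomp Require Import ring lra.

Set Implicit Arguments.
Unset Strict Implicit.
Unset Printing Implicit Defensive.

Import Order.TTheory GRing.Theory Num.Theory.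

Local Open Scope ring_scope.

(** * Alternating multilinear algebra *)

Section Multilinear.
Variable R : comNzRingType.

(** Comparing derivatives at t = 0 requires |dv|^k to be differentiable also where du vanishes.
    There the assumption k >= 2 makes the derivative exist; its value is then read off from the
    calibrated side. For that, the coefficient of alpha ^ v^* vol_L is written as a sum over index
    maps f of an antisymmetric coefficient of alpha times a product of Jacobian entries, and
    closedness of alpha becomes the statement that these coefficients are divergence free. The
    volume measure is accessible only through [is_vol_measure], that is, for nonnegative functions
    supported in one chart, and additivity of [integral_rV] would require measurability of all
    partial integrals. Sums and limits are therefore taken on M against the measure, and
    [integral_rV] serves only for translation invariance and for the volume of a box. *)

Definition row_multilinear m n (F : 'M[R]_(m, n) -> R) :=
  forall (A B C : 'M[R]_(m, n)) (a : 'I_m) (b c : R),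
    row a A = b *: row a B + c *: row a C ->
    row' a B = row' a A -> row' a C = row' a A -> F A = b * F B + c * F C.

Lemma row_multilinear_sum m n (F : 'M[R]_(m, n) -> R) (a : 'I_m) I (r : seq I)
    (x : I -> R) (A : 'M[R]_(m, n)) (B : I -> 'M[R]_(m, n)) :
  row_multilinear F ->
  row a A = \sum_(i <- r) x i *: row a (B i) ->
  (forall i, row' a (B i) = row' a A) -> F A = \sum_(i <- r) x i * F (B i).
Proof.
move=> Fl; elim: r A => [|i r IH] A.
  rewrite !big_nil => rA _.
  (* With both coefficients zero, [A] can play all three roles. *)
  by rewrite (Fl A A A a 0 0) ?rA ?scaler0 ?addr0// !mul0r addr0.
rewrite !big_cons => rA rB.
pose C := \matrix_(p, q) if p == a then (\sum_(i <- r) x i *: row a (B i)) 0 q else A p q.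
have rC : row a C = \sum_(i <- r) x i *: row a (B i).
  by apply/rowP => q; rewrite !mxE eqxx.
have rC' : row' a C = row' a A.
  by apply/matrixP => p q; rewrite !mxE eq_sym (negPf (neq_lift _ _)).
rewrite (Fl A (B i) C a (x i) 1) ?rB//; last by rewrite rA scale1r rC.
by rewrite mul1r (IH C)// => j; rewrite rB rC'.
Qed.

Lemma bigA_ord_recl (n : nat) (T : finType) (X : {ffun 'I_n.+1 -> T} -> R) :
  \sum_f X f = \sum_(c : T) \sum_(g : {ffun 'I_n -> T})
     X [ffun a => if unlift ord0 a is Some a' then g a' else c].
Proof.
rewrite pair_big /=.
pose h (p : T * {ffun 'I_n -> T}) : {ffun 'I_n.+1 -> T} :=
  [ffun a => if unlift ord0 a is Some a' then p.2 a' else p.1].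
rewrite (reindex h) //=.
exists (fun f : {ffun 'I_n.+1 -> T} => (f ord0, [ffun a => f (lift ord0 a)])).
  move=> [c g] _; rewrite /h /= ffunE unlift_none; congr (_, _).
  by apply/ffunP => a; rewrite !ffunE liftK.
move=> f _; apply/ffunP => a; rewrite /h ffunE /=.
by case: unliftP => [b|] ->; rewrite ?ffunE.
Qed.


(** Expand the first row in the standard basis; for each basis vector the value is multilinear in
    the remaining rows, to which induction applies. *)
Lemma row_multilinear_expand m n (F : 'M[R]_(m, n) -> R) (A : 'M[R]_(m, n)) :
  row_multilinear F ->
  F A = \sum_(g : {ffun 'I_m -> 'I_n}) (\prod_a A a (g a)) * F (rowsub g 1%:M).
Proof.
elim: m F A => [|m IH] F A Fl.
  have f0 : {ffun 'I_0 -> 'I_n} by apply: finfun; case.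
  rewrite (big_pred1 f0) => [|g]; last by apply/esym/eqP/ffunP; case.
  by rewrite big_ord0 mul1r [rowsub _ _]flatmx0 [A]flatmx0.
rewrite bigA_ord_recl.
pose cm (u : 'rV[R]_n) (B : 'M[R]_(m, n)) : 'M[R]_(m.+1, n) :=
  \matrix_(p, q) if unlift ord0 p is Some p' then B p' q else u 0 q.
have rcm0 u B : row ord0 (cm u B) = u.
  by apply/rowP => q; rewrite !mxE unlift_none.
have rcm0' u B : row' ord0 (cm u B) = B.
  by apply/matrixP => p q; rewrite !mxE liftK.
have rcmS u B a : row (lift ord0 a) (cm u B) = row a B.
  by apply/rowP => q; rewrite !mxE liftK.
rewrite (@row_multilinear_sum _ _ _ ord0 _ (index_enum 'I_n) (fun c => A ord0 c) A
  (fun c => cm (delta_mx 0 c) (row' ord0 A)) Fl); last first.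
- by move=> c; rewrite rcm0'.
- by rewrite [LHS]row_sum_delta; apply: eq_bigr => c _; rewrite rcm0 mxE.
apply: eq_bigr => c _.
rewrite (IH (fun B => F (cm (delta_mx 0 c) B))).
  rewrite big_distrr /=; apply: eq_bigr => g _.
  rewrite mulrA; congr (_ * F _).
    rewrite big_ord_recl ffunE unlift_none; congr (_ * _).
    by apply: eq_bigr => a _; rewrite ffunE liftK !mxE.
  apply/matrixP => p q; rewrite !mxE ffunE; case: unliftP => [p'|] _.
    by rewrite !mxE.
  by rewrite eqxx eq_sym.
move=> A' B C a x y rA rB rC.
apply: (Fl _ _ _ (lift ord0 a)); rewrite ?rcmS //.
- apply/matrixP => p q; rewrite !mxE; case: unliftP => [p'|//] Ep.
  case: (unliftP a p') Ep => [p''|] -> Ep; last by move: (neq_lift (lift ord0 a) p); rewrite Ep eqxx.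
  by move/matrixP/(_ p'' q): rB; rewrite !mxE.
- apply/matrixP => p q; rewrite !mxE; case: unliftP => [p'|//] Ep.
  case: (unliftP a p') Ep => [p''|] -> Ep; last by move: (neq_lift (lift ord0 a) p); rewrite Ep eqxx.
  by move/matrixP/(_ p'' q): rC; rewrite !mxE.
Qed.

Lemma row_multilinear_det_mul n k (J : 'M[R]_(n, k)) :
  row_multilinear (fun X : 'M[R]_(k, n) => \det (X *m J)).
Proof.
move=> A B C a b c rA rB rC.
apply: (@determinant_multilinear _ _ _ _ _ a).
- by rewrite !row_mul rA mulmxDl -!scalemxAl.
- by rewrite !row'Esub -!mul_rowsub_mx -!row'Esub rB.
- by rewrite !row'Esub -!mul_rowsub_mx -!row'Esub rC.
Qed.

(** Reindexing by [s] shows that the sum equals its opposite. The hypothesis on [R] replaces a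
    characteristic different from two. *)
Lemma sum_antisym k (T : finType) (X : {ffun 'I_k -> T} -> R) (s : 'S_k) :
  (forall x : R, x = - x -> x = 0) ->
  (forall f : {ffun 'I_k -> T}, X [ffun a => f (s a)] = - X f) -> \sum_f X f = 0.
Proof.
move=> R2 Xs; apply: R2.
rewrite [LHS](reindex (fun f : {ffun 'I_k -> T} => [ffun a => f (s a)] : {ffun 'I_k -> T})) /=.
  by rewrite -sumrN; apply: eq_bigr => f _; rewrite Xs.
exists (fun f : {ffun 'I_k -> T} => [ffun a => f ((s^-1)%g a)] : {ffun 'I_k -> T}) => f _;
  by apply/ffunP => a; rewrite !ffunE ?permK ?permKV.
Qed.

(* Transpositions generate the symmetric group, so antisymmetry under the
   transpositions of the positions [P x] extends to all permutations of them. *)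
Lemma sum_perm_positions m n (P : 'I_m -> 'I_n) (Z : 'S_n -> R)
    (F : {ffun 'I_m -> 'I_n} -> R) (t : 'S_m) :
  injective P -> (forall x y s, Z (tperm (P x) (P y) * s)%g = Z s) ->
  \sum_(s : 'S_n) (-1) ^+ s * Z s * F [ffun x => s (P (t x))]
  = (-1) ^+ t * \sum_(s : 'S_n) (-1) ^+ s * Z s * F [ffun x => s (P x)].
Proof.
move=> Pinj ZP.
have [ts -> _] := prod_tpermP t.
elim/last_ind: ts => [|ts [a b] IH].
  rewrite big_nil odd_perm1 mul1r; apply: eq_bigr => s _.
  by congr (_ * F _); apply/ffunP => x; rewrite !ffunE perm1.
rewrite -cats1 big_cat big_seq1 /=; set t' := (\prod_(j <- ts) _)%g in IH *.
rewrite (reindex_inj (mulgI (tperm (P a) (P b)))) /=.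
have -> : (-1) ^+ (t' * tperm a b)%g = (-1) ^+ (a != b) * (-1) ^+ t' :> R.
  by rewrite odd_permM odd_tperm signr_addb mulrC.
rewrite -mulrA -IH big_distrr /=; apply: eq_bigr => s _.
rewrite ZP odd_permM odd_tperm (inj_eq Pinj) signr_addb -!mulrA.
congr (_ * (_ * (_ * F _))); apply/ffunP => x; rewrite !ffunE !permM.
congr (s _); case: (tpermP a b (t' x)) => [->|->|/eqP na /eqP nb].
- by rewrite tpermR.
- by rewrite tpermL.
- by rewrite tpermD // (inj_eq Pinj) eq_sym.
Qed.

End Multilinear.

Section Wedge.
Variables (R : fieldType) (m k : nat).
Local Notation n := (m + k)%N.
Implicit Types (F : 'M[R]_(m, n) -> R) (f : {ffun 'I_k -> 'I_n}).

(** [wedge_form] in top degree, at a fixed point of a fixed chart. *)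
Definition wedge_top F (G : 'M[R]_(k, n) -> R) (v : 'M[R]_n) : R :=
  ((m`! * k`!)%N%:R)^-1 * \sum_(s : 'S_n)
    (-1) ^+ s * F (usubmx (row_perm s v)) * G (dsubmx (row_perm s v)).

(* Coefficients of the k-vector field dual to [F]: the value on the standard
   basis of the wedge of [F] with dx_(f 0), ..., dx_(f (k - 1)). *)
Definition dual_coef F f : R :=
  ((m`! * k`!)%N%:R)^-1 * \sum_(s : 'S_n)
    (-1) ^+ s * F (usubmx (row_perm s 1%:M))
    * \det (colsub f (dsubmx (row_perm s 1%:M))).

(** Forms of top degree are determined by one value. Concretely, after both factors are expanded in
    the standard basis, the sum over permutations is the Leibniz formula for a determinant with left
    factor [v]. *)
Lemma wedge_top_det F (J : 'M[R]_(n, k)) (v : 'M[R]_n) : row_multilinear F ->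
  wedge_top F (fun X => \det (X *m J)) v
  = \det v * wedge_top F (fun X => \det (X *m J)) 1%:M.
Proof.
move=> Fl.
have expand w : wedge_top F (fun X => \det (X *m J)) w
    = ((m`! * k`!)%N%:R)^-1 * \sum_(g : {ffun 'I_m -> 'I_n}) \sum_(f : {ffun 'I_k -> 'I_n})
      F (rowsub g 1%:M) * \det (rowsub f 1%:M *m J)
      * \det (w *m colsub (fun x => match split x with inl a => g a | inr b => f b end) 1%:M).
  rewrite /wedge_top; congr (_ * _).
  under eq_bigr => s _.
    rewrite (row_multilinear_expand _ Fl).
    rewrite (row_multilinear_expand _ (@row_multilinear_det_mul _ _ _ J)).
    rewrite -mulrA big_distrlr /= big_distrr /=.
    under eq_bigr do rewrite big_distrr /=.
    over.
  rewrite exchange_big /=; apply: eq_bigr => g _.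
  rewrite exchange_big /=; apply: eq_bigr => f _.
  set W := w *m _.
  have WE p q : W p q = w p (match split q with inl a => g a | inr b => f b end).
    by rewrite /W mulmx_colsub mulmx1 !mxE.
  (* The Leibniz product is split at position [m]: the first part belongs to the expansion of [F],
     the second to that of the determinant. *)
  have -> : \det W = \sum_(s : 'S_n) (-1) ^+ s *
      ((\prod_(a < m) usubmx (row_perm s w) a (g a))
       * \prod_(b < k) dsubmx (row_perm s w) b (f b)).
    rewrite -det_tr; apply: eq_bigr => s _; rewrite big_split_ord /=.
    congr (_ * (_ * _)); apply: eq_bigr => a _; rewrite [LHS]mxE WE !mxE.
      by case: split_ordP => b; [move/lshift_inj ->|move/eqP; rewrite eq_lrshift].
    by case: split_ordP => b; [move/eqP; rewrite eq_rlshift|move/rshift_inj ->].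
  rewrite [RHS]big_distrr /=; apply: eq_bigr => s _.
  have aux (e x p y q : R) : e * (x * p * (y * q)) = p * q * (e * (x * y)) by ring.
  exact: aux.
rewrite !expand mulrCA; congr (_ * _); rewrite big_distrr /=.
apply: eq_bigr => g _; rewrite big_distrr /=; apply: eq_bigr => f _.
by rewrite det_mulmx mul1mx mulrCA.
Qed.

(** A Cauchy-Binet expansion over all index maps. It separates [F] from [J], so that along a family
    of maps at a fixed point only the entries of [J] vary. *)
Lemma wedge_top_dual F (J : 'M[R]_(n, k)) :
  wedge_top F (fun X => \det (X *m J)) 1%:M
  = \sum_(f : {ffun 'I_k -> 'I_n}) dual_coef F f * \prod_b J (f b) b.
Proof.
rewrite /wedge_top /dual_coef.
under [RHS]eq_bigr do rewrite -mulrA big_distrl /=.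
rewrite -big_distrr /= exchange_big /=; congr (_ * _); apply: eq_bigr => s _.
set D := dsubmx _.
have -> : \det (D *m J) = \sum_(f : {ffun 'I_k -> 'I_n}) (\prod_b J (f b) b) * \det (colsub f D).
  rewrite -det_tr trmx_mul (row_multilinear_expand _ (@row_multilinear_det_mul _ _ _ D^T)).
  apply: eq_bigr => f _; congr (_ * _); first by apply: eq_bigr => b _; rewrite mxE.
  by rewrite mul_rowsub_mx mul1mx -det_tr trmx_mxsub trmxK.
rewrite big_distrr /=; apply: eq_bigr => f _.
by rewrite -!mulrA; congr (_ * (_ * _)); rewrite mulrC.
Qed.

Lemma dual_coef_tperm F f a b : a != b ->
  dual_coef F [ffun c => f (tperm a b c)] = - dual_coef F f.
Proof.
move=> ab; rewrite /dual_coef -mulrN -sumrN; congr (_ * _); apply: eq_bigr => s _.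
rewrite -mulrN; congr (_ * _).
have -> : colsub [ffun c => f (tperm a b c)] (dsubmx (row_perm s 1%:M))
   = xcol a b (colsub f (dsubmx (row_perm s 1%:M))) :> 'M[R]_k.
  by apply/matrixP => i j; rewrite !mxE ffunE.
by rewrite xcolE det_mulmx det_perm odd_tperm ab mulrN1.
Qed.

(** With [T c] the derivative of the form in direction [c], closedness says that the dual k-vector
    field is divergence free. In each term the index [f a] and the [m] arguments of the form occupy
    [m.+1] positions of a permutation. As [Z] ignores [f a], antisymmetrising over these positions
    leaves [Z] alone and produces the exterior derivative. *)
Lemma dual_coef_div (T : 'I_n -> 'M[R]_(m, n) -> R) (Z : {ffun 'I_k -> 'I_n} -> R) (a : 'I_k) :
  (m.+1%:R : R) != 0 ->
  (forall v : 'I_m.+1 -> 'I_n,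
     \sum_(i < m.+1) (-1) ^+ i * T (v i) (rowsub (fun x => v (lift i x)) 1%:M) = 0) ->
  (forall f g : {ffun 'I_k -> 'I_n}, (forall b, b != a -> f b = g b) -> Z f = Z g) ->
  \sum_(f : {ffun 'I_k -> 'I_n}) dual_coef (T (f a)) f * Z f = 0.
Proof.
move=> m0 closed Zind.
(* The entries are 0 or 1, so each term of the Leibniz formula survives only when [f] is prescribed
   by [s] and [t]; this removes the sum over [f]. *)
have detE (s : 'S_n) f : \det (colsub f (dsubmx (row_perm s (1%:M : 'M[R]_n))))
    = \sum_(t : 'S_k) (-1) ^+ t * (f == [ffun b => s (rshift m (t b))])%:R.
  rewrite -det_tr; apply: eq_bigr => t _; congr (_ * _).
  case: eqP => [->|fne].
    by rewrite big1 // => b _; rewrite !mxE ffunE eqxx.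
  have [b fb] : exists b, f b != s (rshift m (t b)).
    apply/existsP; apply: contraPT fne; rewrite negb_exists => /forallP fE.
    by apply; apply/ffunP => b; rewrite ffunE; apply/eqP/negPn/fE.
  by rewrite (bigD1 b) //= !mxE eq_sym (negPf fb) mul0r.
under eq_bigr => f _.
  rewrite /dual_coef -mulrA big_distrl /=.
  under eq_bigr => s _ do rewrite detE big_distrr /= big_distrl /=.
  over.
rewrite -big_distrr /= exchange_big /=.
under eq_bigr do rewrite exchange_big /=.
rewrite exchange_big /= big1 ?mulr0 // => t _.
have E1 (s : 'S_n) : \sum_(f : {ffun 'I_k -> 'I_n}) (-1) ^+ s * T (f a) (usubmx (row_perm s 1%:M)) *
     ((-1) ^+ t * (f == [ffun b => s (rshift m (t b))])%:R) * Z f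
   = (-1) ^+ t * ((-1) ^+ s * Z [ffun b => s (rshift m (t b))]
       * T (s (rshift m (t a))) (usubmx (row_perm s 1%:M))).
  rewrite (bigD1 [ffun b => s (rshift m (t b))]) //= big1 ?addr0 => [|f /negPf ->].
    rewrite eqxx !ffunE /= mulr1.
    have aux (e x p y : R) : e * x * p * y = p * (e * y * x) by ring.
    exact: aux.
  by rewrite mulr0 mulr0 mul0r.
under eq_bigr do rewrite E1.
rewrite -big_distrr /=.
(* The positions to antisymmetrise: first the one giving [f a], then those of the arguments of the
   form. *)
pose P (x : 'I_m.+1) : 'I_n := if unlift ord0 x is Some y then lshift k y else rshift m (t a).
have P0 : P ord0 = rshift m (t a) by rewrite /P unlift_none.
have PS x : P (lift ord0 x) = lshift k x by rewrite /P liftK.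
have Pinj : injective P.
  move=> x y; rewrite /P; case: unliftP => [x'|] ->; case: unliftP => [y'|] -> //.
  - by move/lshift_inj ->.
  - by move/eqP; rewrite eq_lrshift.
  - by move/eqP; rewrite eq_rlshift.
pose G (g : {ffun 'I_m.+1 -> 'I_n}) := T (g ord0) (rowsub (fun x => g (lift ord0 x)) 1%:M).
pose ZS (s : 'S_n) := Z [ffun b => s (rshift m (t b))].
have ZP x y s : ZS (tperm (P x) (P y) * s)%g = ZS s.
  apply: Zind => b ba; rewrite !ffunE permM.
  have Pn z : P z != rshift m (t b).
    rewrite /P; case: unliftP => [z'|] _; first by rewrite eq_lrshift.
    by rewrite (inj_eq (@rshift_inj _ _)) (inj_eq perm_inj) eq_sym.
  by rewrite tpermD.
(* [lift_perm ord0 i 1] moves position [i] to the front and keeps the order of the others; its sign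
   is that of the i-th term of the exterior derivative. *)
have key (i : 'I_m.+1) : \sum_(s : 'S_n) (-1) ^+ s * ZS s * G [ffun x => s (P x)]
   = (-1) ^+ i * \sum_(s : 'S_n) (-1) ^+ s * ZS s * G [ffun x => s (P (lift_perm ord0 i 1%g x))].
  rewrite (sum_perm_positions _ _ Pinj ZP) odd_lift_perm odd_perm1 addbF /= mulrA.
  by rewrite signr_odd -exprD addnn -mul2n exprM sqrrN expr1n expr1n mul1r.
(* One copy of the sum for each term of the exterior derivative; [m0] permits the division at the
   end. *)
suff : m.+1%:R * \sum_(s : 'S_n) (-1) ^+ s * ZS s * G [ffun x => s (P x)] = 0.
  move/eqP; rewrite mulf_eq0 (negPf m0) /= => /eqP S0.
  rewrite -[RHS](mulr0 ((-1) ^+ t)) -[in RHS]S0; congr (_ * _).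
  apply: eq_bigr => s _; congr (_ * _).
  rewrite /G !ffunE P0; congr (T _ _); apply/matrixP => x y.
  by rewrite !mxE ffunE PS.
have -> : m.+1%:R * \sum_(s : 'S_n) (-1) ^+ s * ZS s * G [ffun x => s (P x)]
  = \sum_(i < m.+1) \sum_(s : 'S_n) (-1) ^+ s * ZS s * G [ffun x => s (P x)].
  by rewrite sumr_const card_ord mulr_natl.
under eq_bigr => i _ do rewrite (key i) big_distrr /=.
rewrite exchange_big /= big1 // => s _.
under eq_bigr => i _ do rewrite mulrCA.
rewrite -big_distrr /= -[RHS](mulr0 ((-1) ^+ s * ZS s)); congr (_ * _).
rewrite -[RHS](closed (fun x => s (P x))); apply: eq_bigr => i _.
rewrite /G ffunE lift_perm_id; congr (_ * T _ _); apply/matrixP => x y.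
by rewrite !mxE ffunE lift_perm_lift perm1.
Qed.

End Wedge.

(** * The pointwise calibration inequality *)

Section Calibration.
Variable R : rcfType.

Definition posdef n (S : 'M[R]_n) :=
  S^T = S /\ forall v : 'rV_n, v != 0 -> 0 < (v *m S *m v^T) 0 0.

(** Induction through the Schur complement of the first diagonal entry. The inverse factor [L] is
    returned as well: it performs Gram-Schmidt, and being triangular it preserves the span of the
    first vectors. *)
Lemma cholesky n (S : 'M[R]_n) : posdef S -> exists L M : 'M[R]_n,
  [/\ is_trig_mx L, is_trig_mx M, L *m M = 1%:M & S = M *m M^T].
Proof.
elim: n S => [|n IH] S [Ssym Spos].
  exists 1%:M, 1%:M; split; rewrite ?mulmx1 ?trmx1 ?scalar_mx_is_trig //.
  by rewrite [LHS]flatmx0 [RHS]flatmx0.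
pose b : 'cV[R]_n := @dlsubmx _ 1 n 1 n S.
pose S' : 'M[R]_n := @drsubmx _ 1 n 1 n S.
pose a := S 0 0.
have SE : S = @block_mx _ 1 n 1 n a%:M b^T b S'.
  rewrite -[LHS](@submxK _ 1 n 1 n); congr (@block_mx _ 1 n 1 n _ _ _ _).
    by rewrite [LHS]mx11_scalar !mxE /a; congr (S _ _)%:M; apply: val_inj.
  by rewrite /b trmx_dlsub Ssym.
have S'sym : S'^T = S' by rewrite /S' trmx_drsub Ssym.
have quad (x : 'M[R]_1) (v : 'rV[R]_n) :
    (row_mx x v *m @block_mx _ 1 n 1 n a%:M b^T b S' *m (row_mx x v)^T) =
    (x *m a%:M + v *m b) *m x^T + (x *m b^T + v *m S') *m v^T.
  by rewrite mul_row_block tr_row_mx mul_row_col.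
have a0 : 0 < a.
  have := Spos (@row_mx _ 1 1 n 1%:M 0) _.
  rewrite {1}SE quad !mul0mx mul1mx trmx0 mulmx0 !addr0 trmx1 mulmx1 mxE eqxx.
  apply; apply/eqP => /(congr1 (@lsubmx _ 1 1 n)); rewrite row_mxKl => /matrixP/(_ 0 0).
  by rewrite !mxE eqxx => /eqP; rewrite oner_eq0.
have a_ne0 : a != 0 by rewrite gt_eqF.
have [|L [M [Lt Mt LM MM]]] := IH (S' - a^-1 *: (b *m b^T)).
  split; first by rewrite linearB linearZ /= trmx_mul trmxK S'sym.
  move=> v v0.
  (* This first coordinate minimises the quadratic form for given [v]; the minimum is the value of
     the Schur complement at [v]. *)
  have := Spos (@row_mx _ 1 1 n (- a^-1 *: (v *m b)) v) _.
  rewrite {1}SE quad mul_mx_scalar scalerA mulrN divff // scaleN1r addNr mul0mx add0r.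
  rewrite mulmxBr -scalemxAr mulmxA !mulmxDl -!scalemxAl !mulNmx scaleNr addrC.
  rewrite scaleNr [_ *: _ *m v^T](esym (scalemxAl _ _ _)).
  apply; apply: contra v0 => /eqP /(congr1 (@rsubmx _ 1 1 n)).
  by rewrite row_mxKr => ->; apply/eqP/matrixP => i j; rewrite !mxE.
pose r := Num.sqrt a.
have r0 : r != 0 by rewrite gt_eqF // sqrtr_gt0.
have rr : r * r = a by rewrite -expr2 sqr_sqrtr // ltW.
exists (@block_mx _ 1 n 1 n r^-1%:M 0 (- a^-1 *: (L *m b)) L).
exists (@block_mx _ 1 n 1 n r%:M 0 (r^-1 *: b) M).
split.
- by rewrite [is_trig_mx _](@is_trig_block_mx _ 1 n 1 n) // eqxx Lt scalar_mx_is_trig.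
- by rewrite [is_trig_mx _](@is_trig_block_mx _ 1 n 1 n) // eqxx Mt scalar_mx_is_trig.
- rewrite (@mulmx_block _ 1 n 1 n 1 n) !mul0mx !mulmx0 !addr0 !add0r LM -scalar_mxM mulVf //.
  rewrite mul_mx_scalar scalerA mulrN -scalemxAr -scalerDl -rr invfM mulrCA divff // mulr1.
  by rewrite addNr scale0r -scalar_mx_block.
rewrite (@tr_block_mx _ 1 n 1 n) (@mulmx_block _ 1 n 1 n 1 n) SE !tr_scalar_mx !trmx0 !mul0mx !mulmx0 !addr0.
rewrite -scalar_mxM rr -MM; congr (@block_mx _ 1 n 1 n _ _ _ _).
- by rewrite linearZ /= mul_scalar_mx scalerA divff // scale1r.
- by rewrite mul_mx_scalar scalerA divff // scale1r.
- rewrite linearZ /= -scalemxAr -scalemxAl scalerA -invfM rr.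
  by rewrite addrC subrK.
Qed.

Lemma posdef_det_gt0 n (S : 'M[R]_n) : posdef S -> 0 < \det S.
Proof.
move=> /cholesky[L [M [_ _ LM ->]]]; rewrite det_mulmx det_tr -expr2 exprn_even_gt0 //=.
apply/eqP => M0; have /eqP := congr1 determinant LM.
by rewrite det_mulmx M0 mulr0 det1 eq_sym oner_eq0.
Qed.

(** Hadamard's inequality, read off from the Cholesky factor, followed by the inequality of
    arithmetic and geometric means. *)
Lemma posdef_det_le n (S : 'M[R]_n) : posdef S -> \det S <= (\tr S / n%:R) ^+ n.
Proof.
move=> /cholesky[L [M [_ Mt _ ->]]].
have diag i : M i i ^+ 2 <= (M *m M^T) i i.
  rewrite mxE (bigD1 i) //= mxE -expr2 lerDl sumr_ge0 // => j _.
  by rewrite mxE -expr2 sqr_ge0.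
rewrite det_mulmx det_tr det_trig // -expr2 -prodrXl.
apply: (@le_trans _ _ (\prod_i (M *m M^T) i i)).
  by apply: ler_prod => i _; rewrite sqr_ge0 diag.
have := @leif_AGM _ _ 'I_n (fun i => (M *m M^T) i i) _.
rewrite card_ord; case=> // i _.
exact: le_trans (sqr_ge0 _) (diag i).
Qed.

Lemma posdef_congr n (h E : 'M[R]_n) : posdef h -> E \in unitmx ->
  posdef (E *m h *m E^T).
Proof.
move=> [hs hp] Eu; split; first by rewrite !trmx_mul trmxK hs mulmxA.
move=> v v0; rewrite !mulmxA -[_ *m E^T *m v^T]mulmxA -trmx_mul.
apply: hp; apply: contra v0 => /eqP vE.
by rewrite -(mulmxK Eu v) vE mul0mx.
Qed.

(** The rank of [J] is at most [k], so its kernel has dimension at least [m]. A basis starting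
    inside the kernel is orthonormalised by a triangular matrix, which keeps the first [m] vectors
    in the kernel. *)
Lemma adapted_frame m k (h : 'M[R]_(m + k)) (J : 'M_(m + k, k)) : posdef h ->
  exists2 E : 'M_(m + k), E *m h *m E^T = 1%:M & usubmx E *m J = 0.
Proof.
move=> hp; pose K := row_ebase (kermx J).
have KJ : usubmx K *m J = 0.
  have rk : (m <= \rank (kermx J))%N.
    by rewrite mxrank_ker leq_subRL ?rank_leq_row // addnC leq_add2l rank_leq_col.
  have: ((pid_mx (\rank (kermx J)) : 'M_(m + k)) *m K) *m J = 0.
    have -> : pid_mx (\rank (kermx J)) *m K = invmx (col_ebase (kermx J)) *m kermx J.
      by rewrite -[X in _ = _ *m X]mulmx_ebase -mulmxA mulKmx ?col_ebase_unit.
    by rewrite -mulmxA mulmx_ker mulmx0.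
  move/(congr1 usubmx); rewrite linear0 -mul_usub_mx => /= <-; congr (_ *m _).
  rewrite -mul_usub_mx; apply/matrixP => i j.
  rewrite [RHS]mxE (bigD1 (lshift k i)) //= big1 ?addr0 => [|l]; rewrite !mxE.
    by rewrite eqxx /= (leq_trans _ rk) // mul1r.
  by rewrite eq_sym => /negPf; rewrite -val_eqE /= => ->; rewrite mul0r.
have [L [M [Lt Mt LM KhK]]] := cholesky (posdef_congr hp (row_ebase_unit (kermx J))).
exists (L *m K).
  rewrite trmx_mul !mulmxA -2![L *m _ *m _]mulmxA KhK mulmxA LM mul1mx.
  by rewrite -trmx_mul LM trmx1.
rewrite -[L]submxK -[K]vsubmxK mul_block_col.
have -> : ursubmx L = 0.
  apply/matrixP => i j; rewrite !mxE; move/is_trig_mxP: Lt; apply => /=.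
  by rewrite (leq_trans (ltn_ord i)) // leq_addr.
by rewrite mul0mx addr0 col_mxKu -mulmxA KJ mulmx0.
Qed.

(** This count cancels the factorials in [wedge_top]. Such a permutation preserves both blocks and
    is determined by its two restrictions. *)
Lemma card_block_perm m k :
  (#|[set s : 'S_(m + k) | [forall b : 'I_k, (m <= s (rshift m b))%N]]| <= m`! * k`!)%N.
Proof.
set A := [set s : 'S_(m + k) | _].
(* The defaults [a] and [b], and the identity in [insubd], are never reached on [A]. *)
pose pl (x : 'I_(m + k)) (a : 'I_m) := if split x is inl y then y else a.
pose pr (x : 'I_(m + k)) (b : 'I_k) := if split x is inr y then y else b.
pose phi (s : 'S_(m + k)) : 'S_m * 'S_k :=
  (insubd (1%g : {perm 'I_m}) [ffun a => pl (s (lshift k a)) a],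
   insubd (1%g : {perm 'I_k}) [ffun b => pr (s (rshift m b)) b]).
have AR s b : s \in A -> rshift m (pr (s (rshift m b)) b) = s (rshift m b).
  rewrite inE => /forallP/(_ b); rewrite /pr; case: split_ordP => c -> //=.
  by rewrite leqNgt ltn_ord.
have prinj s : s \in A -> injective (fun b => pr (s (rshift m b)) b).
  move=> sA b c /(congr1 (@rshift m k)); rewrite !AR // => /perm_inj.
  exact: rshift_inj.
have AL s a : s \in A -> lshift k (pl (s (lshift k a)) a) = s (lshift k a).
  (* By finiteness the last [k] positions already fill the last [k] values, so no earlier position
     can take one of them. *)
  move=> sA; rewrite /pl; case: split_ordP => c sE //; exfalso.
  have [g _ gK] := injF_bij (prinj s sA).
  have := AR s (g c) sA; rewrite gK -sE => /perm_inj /eqP.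
  by rewrite eq_lrshift.
have plinj s : s \in A -> injective (fun a => pl (s (lshift k a)) a).
  move=> sA b c /(congr1 (@lshift m k)); rewrite !AL // => /perm_inj.
  exact: lshift_inj.
have phi1 s a : s \in A -> (phi s).1 a = pl (s (lshift k a)) a.
  move=> sA; rewrite /phi /= -pvalE insubdK ?ffunE //.
  by apply/injectiveP => b c; rewrite !ffunE; apply: plinj.
have phi2 s b : s \in A -> (phi s).2 b = pr (s (rshift m b)) b.
  move=> sA; rewrite /phi /= -pvalE insubdK ?ffunE //.
  by apply/injectiveP => c d; rewrite !ffunE; apply: prinj.
have phi_inj : {in A &, injective phi}.
  move=> s t sA tA st; apply/permP => x; rewrite -(splitK x).
  case: (split x) => y /=.
    by rewrite -AL // -[RHS]AL // -!phi1 // st.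
  by rewrite -AR // -[RHS]AR // -!phi2 // st.
rewrite -(card_in_imset phi_inj) (leq_trans (subset_leq_card (subsetT _))) //.
by rewrite cardsT card_prod !card_Sn.
Qed.

Lemma rowsub_congr m n (f : 'I_m -> 'I_n) (E N : 'M[R]_n) :
  rowsub f E *m N *m (rowsub f E)^T = mxsub f f (E *m N *m E^T).
Proof. by rewrite mul_rowsub_mx trmx_mxsub [RHS]mxsub_mul. Qed.

(** In an adapted frame a permutation contributes only if it preserves the two blocks. Then the
    factor from [F] is at most 1 by calibration, and the determinant is bounded through its Gram
    matrix by [posdef_det_le]. *)
Lemma wedge_top_frame_le m k (h : 'M[R]_(m + k)) (g : 'M[R]_k) (J : 'M[R]_(m + k, k))
    (F : 'M[R]_(m, m + k) -> R) (E : 'M[R]_(m + k)) :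
  posdef h -> posdef g ->
  (forall e : 'M_(m, m + k), e *m h *m e^T = 1%:M -> `|F e| <= 1) ->
  E *m h *m E^T = 1%:M -> usubmx E *m J = 0 ->
  `|wedge_top F (fun X => \det (X *m J)) E| * Num.sqrt (\det g)
  <= Num.sqrt (\tr (E *m (J *m g *m J^T) *m E^T) / k%:R) ^+ k.
Proof.
move=> hp gp Fle EhE EJ.
set N := J *m g *m J^T; set b := _ ^+ k.
pose A := [set s : 'S_(m + k) | [forall b : 'I_k, (m <= s (rshift m b))%N]].
have b0 : 0 <= b by rewrite exprn_ge0 // sqrtr_ge0.
have g0 := posdef_det_gt0 gp.
have NE p (B : 'M_(p, m + k)) : B *m N *m B^T = (B *m J) *m g *m (B *m J)^T.
  by rewrite /N trmx_mul !mulmxA.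
have N0 p (B : 'M_(p, m + k)) i : 0 <= (B *m N *m B^T) i i.
  have -> : (B *m N *m B^T) i i = (row i (B *m J) *m g *m (row i (B *m J))^T) 0 0.
    by rewrite NE -row_mul mxE [RHS]mxE; apply: eq_bigr => j _; rewrite !mxE.
  by case: (eqVneq (row i (B *m J)) 0) => [->|/(proj2 gp)/ltW//]; rewrite !mul0mx mxE.
have term (s : 'S_(m + k)) : `|(-1) ^+ s * F (usubmx (row_perm s E))
     * \det (dsubmx (row_perm s E) *m J)| * Num.sqrt (\det g) <= (s \in A)%:R * b.
  rewrite normrM normrMsign.
  set B := dsubmx _; have [sA|sA] := boolP (s \in A); last first.
    (* Such an [s] places a frame vector from the kernel of [J] among the last [k] arguments. *)
    have -> : \det (B *m J) = 0.
      move: sA; rewrite inE => /forallPn[c]; rewrite -ltnNge => cm.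
      rewrite (expand_det_row _ c) big1 // => j _.
      suff -> : (B *m J) c j = (usubmx E *m J) (Ordinal cm) j by rewrite EJ mxE mul0r.
      rewrite !mxE; apply: eq_bigr => l _; rewrite !mxE; congr (E _ _ * _).
      exact: val_inj.
    by rewrite normr0 mulr0 !mul0r.
  rewrite mul1r.
  apply: (@le_trans _ _ (`|\det (B *m J)| * Num.sqrt (\det g))).
    rewrite ler_wpM2r ?sqrtr_ge0 // ler_piMl // Fle //.
    rewrite usubmxEsub row_permEsub -mxsub_comp rowsub_congr EhE.
    apply/matrixP => i j; rewrite !mxE (inj_eq perm_inj).
    by rewrite (inj_eq (@lshift_inj _ _)).
  have detJ : (`|\det (B *m J)| * Num.sqrt (\det g)) ^+ 2 = \det (B *m N *m B^T).
    by rewrite NE !det_mulmx det_tr exprMn sqr_sqrtr ?ltW // real_normK ?num_real // expr2 mulrAC.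
  (* Passing from the rows of [E] to those of [B] drops only nonnegative diagonal entries. *)
  have trle : 0 <= \tr (B *m N *m B^T) <= \tr (E *m N *m E^T).
    rewrite sumr_ge0 //= /B dsubmxEsub row_permEsub -mxsub_comp rowsub_congr.
    rewrite /mxtrace [leRHS](reindex_inj (@perm_inj _ s)) big_split_ord /=.
    by rewrite -[leLHS]add0r lerD ?sumr_ge0 // ler_sum // => b' _; rewrite mxE.
  (* In the singular case the Gram matrix is only semidefinite, but the left-hand side is zero. *)
  have [J0|J0] := eqVneq (\det (B *m J)) 0; first by rewrite J0 normr0 mul0r.
  rewrite -(@ler_pXn2r _ 2) ?nnegrE ?mulr_ge0 ?sqrtr_ge0 // detJ.
  rewrite /b -exprM mulnC exprM sqr_sqrtr ?divr_ge0 ?ler0n //; last first.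
    by case/andP: trle => t0 /(le_trans t0).
  rewrite NE (le_trans (posdef_det_le _)) //.
    by apply: posdef_congr => //; rewrite unitmxE unitfE.
  rewrite -NE; case/andP: trle => t0 tle.
  by rewrite lerXn2r ?nnegrE ?divr_ge0 ?ler0n // ?(le_trans t0) // ler_wpM2r // invr_ge0.
rewrite /wedge_top normrM -mulrA.
have c0 : (0 : R) < (m`! * k`!)%:R by rewrite ltr0n muln_gt0 !fact_gt0.
rewrite [X in X * _]gtr0_norm ?invr_gt0 // ler_pdivrMl //.
apply: (@le_trans _ _ (\sum_(s : 'S_(m + k)) (s \in A)%:R * b)).
  rewrite (le_trans (ler_wpM2r (sqrtr_ge0 _) (ler_norm_sum _ _ _))) //.
  by rewrite big_distrl /= ler_sum.
rewrite -big_distrl /= ler_wpM2r // -natr_sum ler_nat.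
apply: leq_trans (card_block_perm m k).
by rewrite -sum1_card [X in (_ <= X)%N]big_mkcond /= leq_sum // => s _; case: ifP.
Qed.

(** The frame inequality carried back to the coordinate basis: the wedge scales by [\det E], which
    compensates the density of [h], and [E^T *m E] is the inverse metric, which turns the trace in
    the frame into |du|^2. *)
Lemma calibration_le m k (h : 'M[R]_(m + k)) (g : 'M[R]_k) (J : 'M[R]_(m + k, k))
    (F : 'M[R]_(m, m + k) -> R) :
  posdef h -> posdef g -> row_multilinear F ->
  (forall e : 'M_(m, m + k), e *m h *m e^T = 1%:M -> `|F e| <= 1) ->
  wedge_top F (fun X => \det (X *m J)) 1%:M * Num.sqrt (\det g)
  <= (Num.sqrt k%:R ^+ k)^-1 * Num.sqrt (\tr (invmx h *m (J *m g *m J^T))) ^+ k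
     * Num.sqrt (\det h).
Proof.
move=> hp gp Fl Fle; have [E EhE EJ] := adapted_frame J hp.
have h0 := posdef_det_gt0 hp.
have hu : h \in unitmx by rewrite unitmxE unitfE gt_eqF.
have EE : E^T *m E = invmx h.
  have /mulmx1C : E *m (h *m E^T) = 1%:M by rewrite mulmxA.
  by rewrite -mulmxA => /(congr1 (mulmx (invmx h))); rewrite mulKmx // mulmx1.
have detE : Num.sqrt (\det h) * `|\det E| = 1.
  have := congr1 (fun X => Num.sqrt (\det X)) EhE.
  rewrite !det_mulmx det_tr mulrAC -expr2 det1 sqrtr1 sqrtrM ?sqr_ge0 //.
  by rewrite sqrtr_sqr mulrC.
have := wedge_top_frame_le hp gp Fle EhE EJ.
rewrite wedge_top_det // normrM; set N := J *m g *m J^T.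
rewrite mxtrace_mulC [E^T *m _]mulmxA EE => H.
apply: (@le_trans _ _ (`|wedge_top F (fun X => \det (X *m J)) 1%:M| * Num.sqrt (\det g))).
  by rewrite ler_wpM2r ?sqrtr_ge0 ?ler_norm.
rewrite -[leLHS]mul1r -[X in X * _ <= _]detE -!mulrA [leRHS]mulrA [leRHS]mulrC.
rewrite ler_wpM2l ?sqrtr_ge0 // mulrA; apply: (le_trans H).
by rewrite [_ / _]mulrC sqrtrM ?invr_ge0 ?ler0n // sqrtrV ?ler0n // exprMn exprVn.
Qed.

End Calibration.

(** * The divergence identity as pure algebra *)

Section DivergenceIdentity.
Variables (R : numFieldType) (n k : nat).
Local Notation index := {ffun 'I_k -> 'I_n}.
Variables (A : index -> R) (dA : 'I_n -> index -> R).
Hypothesis A_anti : forall (f : index) a b, a != b ->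
  A [ffun c => f (tperm a b c)] = - A f.
Hypothesis dA_div : forall a (Z : index -> R),
  (forall f g : index, (forall b, b != a -> f b = g b) -> Z f = Z g) ->
  \sum_(f : index) dA (f a) f * Z f = 0.

Lemma sum_anti_sym a b (Z : index -> R) : a != b ->
  (forall f : index, Z [ffun c => f (tperm a b c)] = Z f) -> \sum_(f : index) A f * Z f = 0.
Proof.
move=> ab Zs; apply: (@sum_antisym R k _ _ (tperm a b)) => [x xN|f].
  apply/eqP; move/eqP: xN; rewrite -subr_eq0 opprK -mulr2n mulrn_eq0 /=.
  by [].
by rewrite A_anti // Zs mulNr.
Qed.

(** All quantities are values at one point. [A] and [dA] are the dual coefficients of alpha and
    their partial derivatives, [r] and [dr] the target density and its gradient, [P] the Jacobian of
    the map, [V] the velocity of the variation with derivatives [PV], [s] and [ds] the cut-off and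
    its gradient, [H] the second derivatives of the map. *)
Variables (r : R) (dr : 'I_k -> R) (P : 'I_n -> 'I_k -> R) (V : 'I_k -> R).
Variables (s : R) (ds : 'I_n -> R) (PV : 'I_n -> 'I_k -> R) (H : 'I_n -> 'I_n -> 'I_k -> R).
Hypothesis H_sym : forall c c' b, H c c' b = H c' c b.

(* The terms in [H] cancel by antisymmetry of [A], and those in [dA] because [A]
   is divergence free. *)
Lemma divergence_identity :
  \sum_(a : 'I_k) \sum_(f : index)
    (dA (f a) f * (r * (s * V a) * \prod_(b | b != a) P (f b) b)
     + A f * ((\sum_d dr d * P (f a) d) * (s * V a) * \prod_(b | b != a) P (f b) b
        + r * (ds (f a) * V a + s * PV (f a) a) * \prod_(b | b != a) P (f b) b
        + r * (s * V a) * \sum_(b | b != a) H (f a) (f b) b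
             * \prod_(d | (d != a) && (d != b)) P (f d) d))
  = (\sum_d dr d * (s * V d)) * (\sum_(f : index) A f * \prod_b P (f b) b)
    + r * \sum_(f : index) A f *
        \sum_a (s * PV (f a) a + ds (f a) * V a) * \prod_(b | b != a) P (f b) b.
Proof.
rewrite big_distrl /=.
under [X in _ = _ + r * X]eq_bigr do rewrite big_distrr /=.
rewrite [X in _ = _ + r * X]exchange_big /= [X in _ = _ + X]big_distrr /= -big_split /=.
apply: eq_bigr => a _; rewrite big_split /= dA_div ?add0r; last first.
  move=> f g fg; congr (_ * _ * _); apply: eq_bigr => b ba; congr (P _ _).
  exact: fg.
under eq_bigr => f _ do rewrite (mulrDr (A f)) (mulrDr (A f)).
rewrite !big_split /=.
have -> : \sum_(f : index) A f * (r * (s * V a) * \sum_(b | b != a) H (f a) (f b) b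
             * \prod_(d | (d != a) && (d != b)) P (f d) d) = 0.
  under eq_bigr do rewrite mulrCA big_distrr /=.
  rewrite -big_distrr /= exchange_big /= big1 ?mulr0 // => b ba.
  apply: (sum_anti_sym (a := a) (b := b)); first by rewrite eq_sym.
  move=> f; rewrite !ffunE tpermL tpermR H_sym; congr (_ * _).
  by apply: eq_bigr => d /andP[da db]; rewrite ffunE tpermD // eq_sym.
rewrite addr0; congr (_ + _); last first.
  rewrite big_distrr /=; apply: eq_bigr => f _.
  have aux (x y z w : R) : x * (y * z * w) = y * (x * (z * w)) by ring.
  by rewrite aux [_ + s * _]addrC.
have E f : A f * ((\sum_d dr d * P (f a) d) * (s * V a) * \prod_(b | b != a) P (f b) b)
   = \sum_d (dr d * (s * V a)) * (A f * (P (f a) d * \prod_(b | b != a) P (f b) b)).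
  rewrite !big_distrl big_distrr /=; apply: eq_bigr => d _.
  have aux (x y z w t : R) : x * (y * z * w * t) = y * w * (x * (z * t)) by ring.
  exact: aux.
under eq_bigr do rewrite E.
(* Only [d = a] survives: otherwise column [d] of [P] occurs twice, which is symmetric in [f a] and
   [f d]. *)
rewrite exchange_big /= (bigD1 a) //= [X in _ + X]big1 ?addr0 => [|d da].
  rewrite -big_distrr /=; congr (_ * _); apply: eq_bigr => f _.
  by rewrite [in RHS](bigD1 a).
rewrite -big_distrr /= (sum_anti_sym (a := a) (b := d)) ?mulr0 //; first by rewrite eq_sym.
move=> f; rewrite !(bigD1 (P := fun b => b != a) d) //= !ffunE tpermL tpermR mulrCA.
congr (_ * (_ * _)); apply: eq_bigr => b /andP[ba bd].
by rewrite ffunE tpermD // eq_sym.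
Qed.

End DivergenceIdentity.

(** * C1 functions and second derivatives *)

From mathcomp Require Import all_classical all_reals all_analysis.
From mathcomp Require Import measurable_realfun.

Import Order.TTheory GRing.Theory Num.Theory.
Import numFieldNormedType.Exports.

Local Open Scope classical_set_scope.
Local Open Scope ring_scope.

Section C1.
Context {R : realType}.

(** Differentiability is asked on a neighbourhood, so that the directional derivatives are
    meaningful around [x]; their continuity is asked at [x] alone, which makes the notion usable
    pointwise. *)
Definition C1_at (V : normedModType R) (f : V -> R) (x : V) : Prop :=
  (\forall z \near x, differentiable f z) /\
  forall v, {for x, continuous (fun z => 'D_v f z)}.

Lemma near_eq_continuous (T U : topologicalType) (f g : T -> U) (x : T) :
  (\forall z \near x, f z = g z) -> {for x, continuous f} -> {for x, continuous g}.
Proof.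
move=> fg fx; rewrite /prop_for /continuous_at -(nbhs_singleton fg).
exact: cvg_trans (near_eq_cvg fg) fx.
Qed.

Lemma near_eq_differentiable (V W : normedModType R) (f g : V -> W) (x : V) :
  (\forall z \near x, f z = g z) -> differentiable f x -> differentiable g x.
Proof.
move=> fg df; have [dc dl] := (diff_locallyP _ _).1 df.
have gl : g \o shift x = cst (g x) + 'd f x +o_ 0 id.
  apply: eqaddoE; apply/eqaddoP => e e0.
  move: fg; rewrite (near_shift 0) subr0 => fg0.
  have fgx : f x = g x by move: (nbhs_singleton fg0); rewrite /= add0r.
  have /(_ _ e0) := (eqaddoP _ _ _ _).1 dl; apply: filterS2 fg0.
  by move=> h /= fgh; rewrite !fctE /= fgh fgx.
by apply/diff_locallyP; rewrite (diff_unique dc gl).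
Qed.

Lemma continuous_sum (T : topologicalType) I (r : seq I) (F : I -> T -> R) (x : T) :
  (forall i, {for x, continuous (F i)}) ->
  {for x, continuous (fun z => \sum_(i <- r) F i z)}.
Proof.
move=> cF; elim: r => [|i r IH].
  apply: (@near_eq_continuous _ _ (fun=> 0)); last exact: cvg_cst.
  by apply: nearW => z; rewrite big_nil.
apply: (@near_eq_continuous _ _ (F i + fun z => \sum_(i <- r) F i z)).
  by apply: nearW => z; rewrite big_cons.
exact: continuousD.
Qed.

Section Closure.
Context {V : normedModType R}.
Implicit Types (f g : V -> R) (x v : V).

Lemma C1_at_differentiable f x : C1_at f x -> differentiable f x.
Proof. by case=> /nbhs_singleton. Qed.

Lemma C1_at_continuous f x : C1_at f x -> {for x, continuous f}.
Proof. by move/C1_at_differentiable/differentiable_continuous. Qed.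

Lemma C1_at_is_derive f x v : C1_at f x -> is_derive x v f ('D_v f x).
Proof. by move/C1_at_differentiable/diff_derivable/derivableP. Qed.

Lemma near_eq_C1_at f g x : (\forall z \near x, f z = g z) -> C1_at f x -> C1_at g x.
Proof.
move=> fg [df cf]; have fg' := near_join fg.
split; [near=> z|move=> v].
  by apply: (@near_eq_differentiable _ _ f); near: z.
apply: near_eq_continuous (cf v); near=> z.
by apply: near_eq_derive; near: z.
Unshelve. all: by end_near. Qed.

Lemma C1_at_cst (a : R) x : C1_at (fun=> a) x.
Proof.
split=> [|v]; first by apply: nearW => z; exact: differentiable_cst.
apply: (@near_eq_continuous _ _ (fun=> 0)); last exact: cvg_cst.
by apply: nearW => z; rewrite derive_cst.
Qed.

Lemma C1_atD f g x : C1_at f x -> C1_at g x -> C1_at (fun z => f z + g z) x.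
Proof.
move=> [df cf] [dg cg]; split=> [|v].
  by apply: filterS2 df dg => z; exact: differentiableD.
apply: (@near_eq_continuous _ _ (('D_v f : V -> R) + 'D_v g)).
  by apply: filterS2 df dg => z fz gz; rewrite deriveD //; exact: diff_derivable.
by apply: continuousD; [exact: cf|exact: cg].
Qed.

Lemma C1_atM f g x : C1_at f x -> C1_at g x -> C1_at (fun z => f z * g z) x.
Proof.
move=> C1f C1g; have [df cf] := C1f; have [dg cg] := C1g; split=> [|v].
  by apply: filterS2 df dg => z; exact: differentiableM.
apply: (@near_eq_continuous _ _ ((f \* 'D_v g) + (g \* 'D_v f))).
  apply: filterS2 df dg => z fz gz.
  by rewrite [RHS]deriveM //; exact: diff_derivable.
apply: continuousD.
  exact: (continuousM (C1_at_continuous C1f) (cg v)).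
exact: (continuousM (C1_at_continuous C1g) (cf v)).
Qed.

Lemma C1_at_sum I (r : seq I) (P : pred I) (F : I -> V -> R) x :
  (forall i, P i -> C1_at (F i) x) -> C1_at (fun z => \sum_(i <- r | P i) F i z) x.
Proof.
move=> CF; elim: r => [|i r IH].
  by apply: near_eq_C1_at (C1_at_cst 0 x); apply: nearW => z; rewrite big_nil.
have [Pi|nPi] := boolP (P i); last first.
  by apply: near_eq_C1_at IH; apply: nearW => z; rewrite big_cons (negPf nPi).
apply: near_eq_C1_at (C1_atD (CF i Pi) IH).
by apply: nearW => z; rewrite big_cons Pi.
Qed.

Lemma C1_at_prod I (r : seq I) (P : pred I) (F : I -> V -> R) x :
  (forall i, P i -> C1_at (F i) x) -> C1_at (fun z => \prod_(i <- r | P i) F i z) x.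
Proof.
move=> CF; elim: r => [|i r IH].
  by apply: near_eq_C1_at (C1_at_cst 1 x); apply: nearW => z; rewrite big_nil.
have [Pi|nPi] := boolP (P i); last first.
  by apply: near_eq_C1_at IH; apply: nearW => z; rewrite big_cons (negPf nPi).
apply: near_eq_C1_at (C1_atM (CF i Pi) IH).
by apply: nearW => z; rewrite big_cons Pi.
Qed.

Lemma C1_at_det m (F : V -> 'M[R]_m) x :
  (forall i j, C1_at (fun z => F z i j) x) -> C1_at (fun z => \det (F z)) x.
Proof.
move=> CF; apply: C1_at_sum => s _; apply: C1_atM; first exact: C1_at_cst.
exact: C1_at_prod.
Qed.

End Closure.

Lemma differentiable_rV (V : normedModType R) m n (f : V -> 'M[R]_(m, n)) x :
  (forall i j, differentiable (fun z => f z i j) x) -> differentiable f x.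
Proof.
move=> df.
have -> : f = \sum_(i < m) \sum_(j < n) (fun z => f z i j *: delta_mx i j).
  apply/funext => z; rewrite {1}(matrix_sum_delta (f z)) fct_sumE.
  by apply: eq_bigr => i _; rewrite fct_sumE.
by do 2!(apply: differentiable_sum => ?); exact: differentiableZl.
Qed.

Lemma differentiable_entry (V : normedModType R) m n (f : V -> 'M[R]_(m, n)) x i j :
  differentiable f x -> differentiable (fun z => f z i j) x.
Proof.
move=> df; exact: (differentiable_comp df (differentiable_coord (f x) i j)).
Qed.

Lemma derive_entry (V : normedModType R) m n (f : V -> 'M[R]_(m, n)) x v i j :
  differentiable f x -> ('D_v f x) i j = 'D_v (fun z => f z i j) x.
Proof. by move=> df; rewrite derive_mx ?mxE //; exact: diff_derivable. Qed.

Lemma derive_comp (U V W : normedModType R) (f : U -> V) (g : V -> W) x v :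
  differentiable f x -> differentiable g (f x) ->
  'D_v (g \o f) x = 'D_('D_v f x) g (f x).
Proof.
move=> df dg; have dgf := differentiable_comp df dg.
by rewrite (deriveE _ dgf) (deriveE _ dg) (deriveE _ df) diff_comp.
Qed.

Lemma derive_rV_sum m (W : normedModType R) (g : 'rV[R]_m -> W) x (v : 'rV_m) :
  differentiable g x -> 'D_v g x = \sum_c v 0 c *: 'D_(delta_mx 0 c) g x.
Proof.
move=> dg; rewrite deriveE // {1}(row_sum_delta v) linear_sum.
by apply: eq_bigr => c _; rewrite linearZ /= deriveE.
Qed.

Lemma derive_comp_rV (V W : normedModType R) m (f : V -> 'rV[R]_m) (g : 'rV[R]_m -> W) x v :
  differentiable f x -> differentiable g (f x) ->
  'D_v (g \o f) x = \sum_c 'D_v (fun z => f z 0 c) x *: 'D_(delta_mx 0 c) g (f x).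
Proof.
move=> df dg; rewrite derive_comp // derive_rV_sum //.
by apply: eq_bigr => c _; rewrite derive_entry.
Qed.

Lemma C1_at_comp (V : normedModType R) m (f : V -> 'rV[R]_m) (g : 'rV[R]_m -> R) x :
  (forall c, C1_at (fun z => f z 0 c) x) -> C1_at g (f x) -> C1_at (g \o f) x.
Proof.
move=> C1f [dg cg].
have dfx : \forall z \near x, differentiable f z.
  have : \forall z \near x, forall c, differentiable (fun z => f z 0 c) z.
    by apply: filter_forall => c; have [] := C1f c.
  apply: filterS => z dz; apply: differentiable_rV => i c.
  by rewrite (_ : i = 0) ?ord1.
have cfx := differentiable_continuous (nbhs_singleton dfx).
have dgf : \forall z \near x, differentiable g (f z) by exact: (cfx _ dg).
split=> [|v].
  by apply: filterS2 dfx dgf => z dfz dgz; exact: differentiable_comp.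
apply: (@near_eq_continuous _ _ (fun z =>
    \sum_c 'D_v (fun z => f z 0 c) z * 'D_(delta_mx 0 c) g (f z))).
  by apply: filterS2 dfx dgf => z dfz dgz; rewrite derive_comp_rV.
apply: continuous_sum => c; apply: continuousM; first by have [_] := C1f c; exact.
exact: continuous_comp cfx (cg _).
Qed.

Lemma C1_at_comp1 (V : normedModType R) (f : V -> R) (g dg : R -> R) x :
  C1_at f x -> (\forall s \near f x, is_derive (s : R) (1 : R) g (dg s)) ->
  {for f x, continuous dg} -> C1_at (g \o f) x.
Proof.
move=> C1f gdg cdg; have [df cf] := C1f.
have cfx := C1_at_continuous C1f.
have gf : \forall z \near x, is_derive (f z) 1 g (dg (f z)) by exact: (cfx _ gdg).
split=> [|v].
  apply: filterS2 df gf => z dfz [gz _]; apply: differentiable_comp => //.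
  exact/derivable1_diffP.
apply: (@near_eq_continuous _ _ ((dg \o f) \* 'D_v f)).
  apply: filterS2 df gf => z dfz [gz gE].
  have dgz : differentiable g (f z) by exact/derivable1_diffP.
  rewrite derive_comp // [RHS]deriveE // -[X in 'd g _ X]mulr1 linearZ /= -deriveE // gE.
  by rewrite mulrC.
by apply: continuousM; [exact: continuous_comp|exact: cf].
Qed.

Lemma C1_atV (V : normedModType R) (f : V -> R) x :
  C1_at f x -> f x != 0 -> C1_at (fun z => (f z)^-1) x.
Proof.
move=> C1f fx0; apply: (C1_at_comp1 (dg := fun s => - s ^- 2) C1f).
  have : \forall s \near f x, s != 0.
    by apply: open_nbhs_nbhs; split => //; exact: open_neq.
  apply: filterS => s s0; apply: DeriveDef; first exact: derivableV.
  by rewrite deriveV // derive_id [LHS]mulr1.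
apply: continuousN; apply: continuousV; first by rewrite expf_neq0.
exact: exprn_continuous.
Qed.

Lemma C1_at_sqrt (V : normedModType R) (f : V -> R) x :
  C1_at f x -> 0 < f x -> C1_at (fun z => Num.sqrt (f z)) x.
Proof.
move=> C1f fx0; apply: (C1_at_comp1 (dg := fun s => (2 * Num.sqrt s)^-1) C1f).
  have : \forall s \near f x, 0 < s by exact: lt_nbhsr.
  by apply: filterS => s s0; exact: is_derive1_sqrt.
apply: continuousV; first by rewrite mulf_neq0 // gt_eqF // sqrtr_gt0.
apply: continuousM; first exact: cvg_cst.
exact: sqrt_continuous.
Qed.


End C1.

Section C2.
Context {R : realType}.

Lemma Ck_on_ext (V W : normedModType R) r (U : set V) (f g : V -> W) : open U ->
  (forall x, U x -> f x = g x) -> Ck_on r U f -> Ck_on r U g.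
Proof.
move=> oU; elim: r f g => [|r IH] f g fg /=.
  move=> cf x Ux; apply: near_eq_continuous (cf x Ux).
  by apply: filterS (open_nbhs_nbhs (conj oU Ux)) => z Uz; exact: fg.
have nfg x : U x -> \forall z \near x, f z = g z.
  by move=> Ux; apply: filterS (open_nbhs_nbhs (conj oU Ux)) => z Uz; exact: fg.
case=> df cf; split=> [x Ux|v].
  exact: near_eq_differentiable (nfg x Ux) (df x Ux).
by apply: IH (cf v) => x Ux; apply: near_eq_derive; exact: nfg.
Qed.

Lemma smooth_on_differentiable (V W : normedModType R) (U : set V) (f : V -> W) x :
  smooth_on U f -> U x -> differentiable f x.
Proof. by move=> /(_ 1%N)[df _]; exact: df. Qed.

Lemma smooth_on_derive (V W : normedModType R) (U : set V) (f : V -> W) v :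
  smooth_on U f -> smooth_on U ('D_v f).
Proof. by move=> sf r; have [_ H] := sf r.+1; exact: H. Qed.

Lemma smooth_on_entry (V : normedModType R) m n (U : set V) (f : V -> 'M[R]_(m, n)) i j :
  open U -> smooth_on U f -> smooth_on U (fun x => f x i j : R^o).
Proof.
move=> oU sf r; elim: r f sf => [|r IH] f sf /=.
  move=> x Ux; apply: (@differentiable_continuous _ _ _ _ (fun x => f x i j)).
  exact: differentiable_entry (smooth_on_differentiable sf Ux).
split=> [x Ux|v].
  exact: differentiable_entry (smooth_on_differentiable sf Ux).
apply: (Ck_on_ext oU _ (IH _ (smooth_on_derive v sf))) => x Ux.
exact: derive_entry (smooth_on_differentiable sf Ux).
Qed.

Lemma smooth_on_C1_at (V : normedModType R) (U : set V) (f : V -> R) x :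
  open U -> smooth_on U (f : V -> R^o) -> U x -> C1_at f x.
Proof.
move=> oU sf Ux; split=> [|v].
  apply: filterS (open_nbhs_nbhs (conj oU Ux)) => z.
  exact: (@smooth_on_differentiable _ R^o).
exact: (smooth_on_derive v sf 0%N).
Qed.

Lemma is_derive_line (V W : normedModType R) (f : V -> W) (x v : V) (s : R) :
  differentiable f (s *: v + x) ->
  is_derive s (1 : R) (fun r : R => f (r *: v + x)) ('D_v f (s *: v + x)).
Proof.
move=> df.
have dl : is_derive s (1 : R) (fun r : R => r *: v + x) v.
  have -> : (fun r : R => r *: v + x) = (fun r => r *: v) + cst x by [].
  have dsc : is_derive s (1 : R) (fun r : R => r *: v) v.
    apply: DeriveDef; first exact/derivable1_diffP.
    by rewrite deriveE // diff_val scale1r.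
  by have := is_deriveD dsc (is_derive_cst x s 1); rewrite addr0.
have [dl1 dl2] := dl.
have dld : differentiable (fun r : R => r *: v + x) s by exact/derivable1_diffP.
apply: DeriveDef.
  by apply/derivable1_diffP; exact: (differentiable_comp dld df).
by rewrite [LHS](derive_comp (f := fun r : R => r *: v + x)) // dl2.
Qed.

Lemma line_MVT (V : normedModType R) (f : V -> R) (x v : V) (h : R) : 0 < h ->
  (forall s, 0 <= s <= h -> differentiable f (s *: v + x)) ->
  exists2 s, 0 < s < h & f (h *: v + x) - f x = h * 'D_v f (s *: v + x).
Proof.
move=> h0 df.
have [s| |s + fE] := @MVT R (fun r => f (r *: v + x)) (fun r => 'D_v f (r *: v + x)) 0 h h0.
- by rewrite in_itv => /andP[s0 sh]; apply: is_derive_line; apply: df; rewrite !ltW.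
- apply: derivable_within_continuous => s; rewrite in_itv => sh.
  by have [] := is_derive_line (df s sh).
- rewrite in_itv => sh; exists s => //.
  by move: fE; rewrite scale0r add0r subr0 mulrC.
Qed.

Lemma is_derive_translate (V : normedModType R) (a x v : V) :
  is_derive x v (fun z => a + z) v.
Proof. by have := is_deriveD (is_derive_cst a x v) (is_derive_id x v); rewrite add0r. Qed.

(** The mean value theorem is applied twice: along [v] to the increment of [f] in direction [w],
    then along [w] to the derivative ['D_v f]. *)
Lemma second_difference (V : normedModType R) (f : V -> R) (x v w : V) (e h : R) :
  0 < h -> h * (`|v| + `|w|) < e ->
  (forall z, `|z - x| < e -> differentiable f z /\ differentiable ('D_v f) z) ->
  exists2 p, `|p - x| < e &
    f (h *: v + (h *: w + x)) - f (h *: w + x) - (f (h *: v + x) - f x)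
    = h * h * 'D_w ('D_v f) p.
Proof.
move=> h0 he df.
have near a b : 0 <= a <= h -> 0 <= b <= h -> `|a *: v + (b *: w + x) - x| < e.
  move=> /andP[a0 ah] /andP[b0 bh]; apply: le_lt_trans he.
  rewrite addrA addrK (le_trans (ler_normD _ _)) // !normrZ !ger0_norm // mulrDr.
  by rewrite lerD // ler_wpM2r.
have nearv a : 0 <= a <= h -> `|a *: v + x - x| < e.
  by move=> ah; have := near a 0 ah; rewrite scale0r add0r; apply; rewrite lexx ltW.
pose g z := f (h *: w + z) - f z.
have dg z : (forall b, 0 <= b <= h -> `|b *: w + z - x| < e) ->
    differentiable g z /\ 'D_v g z = 'D_v f (h *: w + z) - 'D_v f z.
  move=> nz; have d0 : differentiable f z.
    have := proj1 (df _ (nz 0 _)); rewrite scale0r add0r; apply.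
    by rewrite lexx ltW.
  have d1 : differentiable f (h *: w + z).
    by apply: (proj1 (df _ (nz h _))); rewrite lexx ltW.
  have dt : differentiable (fun z => h *: w + z) z by [].
  have d2 := differentiable_comp dt d1.
  split; first exact: differentiableB.
  have -> : g = (f \o (fun z => h *: w + z)) - f by [].
  rewrite deriveB; [|exact: diff_derivable..].
  by rewrite (derive_comp v dt d1) (@derive_val _ _ _ _ _ _ _ (is_derive_translate _ z v)).
have [s sh gE] : exists2 s, 0 < s < h & g (h *: v + x) - g x = h * 'D_v g (s *: v + x).
  apply: (line_MVT (f := g) h0) => s sh; apply: (proj1 (dg _ _)) => b bh.
  by rewrite addrCA near.
have sh' : 0 <= s <= h by case/andP: sh => *; rewrite !ltW.
have [b bh fE] : exists2 b, 0 < b < h &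
    'D_v f (h *: w + (s *: v + x)) - 'D_v f (s *: v + x)
      = h * 'D_w ('D_v f) (b *: w + (s *: v + x)).
  apply: (line_MVT (f := 'D_v f) h0) => b bh; apply: (proj2 (df _ _)).
  by rewrite addrCA near.
exists (b *: w + (s *: v + x)).
  by rewrite addrCA near //; case/andP: bh => *; rewrite !ltW.
rewrite -mulrA -fE -(proj2 (dg _ _)) -?gE; last by move=> c ch; rewrite addrCA near.
by rewrite /g [h *: v + (h *: w + x)]addrCA; ring.
Qed.

Lemma eq_of_near_eq (V : normedModType R) (A B : V -> R) (x : V) :
  {for x, continuous A} -> {for x, continuous B} ->
  (forall d : R, 0 < d -> exists p q, [/\ `|p - x| < d, `|q - x| < d & A p = B q]) ->
  A x = B x.
Proof.
move=> cA cB AB; apply/eqP; rewrite -subr_eq0 -normr_le0.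
apply/ler_addgt0Pr => _/posnumP[e]; rewrite add0r.
have e2 : 0 < e%:num / 2 by rewrite divr_gt0.
have /cvgrPdist_lt/(_ _ e2) nA := cA.
have /cvgrPdist_lt/(_ _ e2) nB := cB.
have : \forall z \near x, (`|A x - A z| < e%:num / 2) /\ (`|B x - B z| < e%:num / 2).
  exact: filterI nA nB.
move=> /nbhs_normP[d /= d0 Hd].
have [p [q [pd qd pq]]] := AB d d0.
have [Ap _] : (`|A x - A p| < e%:num / 2) /\ (`|B x - B p| < e%:num / 2).
  by apply: Hd; rewrite /ball_ /= distrC.
have [_ Bq] : (`|A x - A q| < e%:num / 2) /\ (`|B x - B q| < e%:num / 2).
  by apply: Hd; rewrite /ball_ /= distrC.
rewrite (le_trans (ler_distD (A p) _ _)) // [leRHS](splitr e%:num).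
by rewrite lerD // ?ltW // pq distrC.
Qed.

(** The second difference is symmetric in [v] and [w], so both mixed derivatives take a common value
    at points arbitrarily close to [x]; their continuity concludes. *)
Lemma schwarz (V : normedModType R) (f : V -> R) (x v w : V) :
  C1_at f x -> C1_at ('D_v f) x -> C1_at ('D_w f) x ->
  'D_w ('D_v f) x = 'D_v ('D_w f) x.
Proof.
move=> [df _] [dvf cvf] [dwf cwf].
apply: (eq_of_near_eq (cvf w) (cwf v)) => d d0.
have : \forall z \near x, differentiable f z /\
    (differentiable ('D_v f) z /\ differentiable ('D_w f) z).
  exact: filterI df (filterI dvf dwf).
move=> /nbhs_normP[r /= r0 Hr].
pose e := Num.min d r.
have e0 : 0 < e by rewrite lt_min d0.
have He z : `|z - x| < e ->
    differentiable f z /\ (differentiable ('D_v f) z /\ differentiable ('D_w f) z).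
  by rewrite lt_min => /andP[_ zr]; apply: Hr; rewrite /ball_ /= distrC.
(* The parallelogram of sides [h *: v] and [h *: w] stays in the ball of radius [e]; the added 1
   keeps the denominator positive. *)
pose h := e / (`|v| + `|w| + 1) / 2.
have vw : 0 < `|v| + `|w| + 1 by rewrite ltr_pwDr // addr_ge0.
have h0 : 0 < h by rewrite !divr_gt0.
have hd : h * (`|v| + `|w|) < e.
  apply: (@lt_le_trans _ _ (h * (`|v| + `|w| + 1))).
    by rewrite ltr_pM2l // ltrDl.
  by rewrite /h mulrAC divfK ?gt_eqF // ler_pdivrMr // ler_peMr ?ltW // ltr1n.
have [p pd pE] := second_difference h0 hd (fun z ze => conj (He z ze).1 (He z ze).2.1).
have hd' : h * (`|w| + `|v|) < e by rewrite addrC.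
have [q qd qE] := second_difference h0 hd' (fun z ze => conj (He z ze).1 (He z ze).2.2).
have hh : h * h != 0 by rewrite mulf_neq0 // gt_eqF.
exists p, q; split; [|by move: qd; rewrite lt_min => /andP[]|].
  by move: pd; rewrite lt_min => /andP[].
have SE : f (h *: v + (h *: w + x)) - f (h *: w + x) - (f (h *: v + x) - f x)
    = f (h *: w + (h *: v + x)) - f (h *: v + x) - (f (h *: w + x) - f x).
  rewrite [h *: w + (h *: v + x)]addrCA.
  by move: (f _) (f (_ + x)) (f (_ + x)) (f x) => a b c d'; ring.
exact: (mulfI hh (etrans (etrans (esym pE) SE) qE)).
Qed.

End C2.

(** * Derivatives of products, of touching functions and of powers of a square root *)

Section Derivatives.
Context {R : realType}.

Lemma is_derive_bigsum (V : normedModType R) I (r : seq I) (F : I -> V -> R) (dF : I -> R) x v :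
  (forall i, is_derive x v (F i) (dF i)) ->
  is_derive x v (fun z => \sum_(i <- r) F i z) (\sum_(i <- r) dF i).
Proof.
move=> FdF; elim: r => [|i r IH].
  rewrite big_nil; apply: (near_eq_is_derive _ (is_derive_cst 0 x v)).
  by apply: nearW => z; rewrite big_nil.
rewrite big_cons; apply: (near_eq_is_derive _ (is_deriveD (FdF i) IH)).
by apply: nearW => z; rewrite big_cons.
Qed.

Lemma is_derive_bigprod (V : normedModType R) (I : eqType) (r : seq I)
    (F : I -> V -> R) (dF : I -> R) x v :
  uniq r -> (forall i, is_derive x v (F i) (dF i)) ->
  is_derive x v (fun z => \prod_(i <- r) F i z)
    (\sum_(i <- r) dF i * \prod_(j <- r | j != i) F j x).
Proof.
move=> + FdF; elim: r => [|i r IH] /=.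
  rewrite big_nil => _; apply: (near_eq_is_derive _ (is_derive_cst (1 : R) x v)).
  by apply: nearW => z; rewrite big_nil.
move=> /andP[ir /IH {}IH]; rewrite big_cons.
apply: (near_eq_is_derive (f := (F i * fun z => \prod_(i <- r) F i z))).
  by apply: nearW => z; rewrite big_cons.
apply: is_derive_eq (is_deriveM (FdF i) IH) _.
rewrite addrC; congr (_ + _).
  rewrite big_cons eqxx /= [LHS]mulrC; congr (_ * _); rewrite [RHS]big_seq_cond [LHS]big_seq.
  apply: eq_bigl => j; case: (boolP (j \in r)) => //= jr.
  by apply/esym; apply: contraNneq ir => <-.
rewrite [LHS]big_distrr /= big_seq [RHS]big_seq; apply: eq_bigr => j jr.
rewrite big_cons ifT; first by rewrite mulrCA.
by apply: contraNneq ir => ->.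
Qed.

Lemma derive_at_min (f : R -> R) (t : R) : derivable f t 1 ->
  (\forall s \near t, f t <= f s) -> 'D_1 f t = 0.
Proof.
move=> df; rewrite (near_shift 0) subr0 => mn.
have dc : h^-1 *: (f (h *: 1 + t) - f t) @[h --> 0^'] --> 'D_1 f t := df.
have mn1 : \forall h \near (0 : R), f t <= f (h *: 1 + t).
  by apply: filterS mn => h; rewrite /= [_%:A]mulr1.
apply/eqP; rewrite eq_le; apply/andP; split.
  apply: (cvgr_to_le (cvg_dnbhs_at_left dc)); near=> h.
  have h0 : h < 0 by near: h; exact: nbhs_left_lt.
  apply: mulr_le0_ge0; first by rewrite invr_le0 ltW.
  by rewrite subr_ge0; near: h; exact: cvg_within mn1.
apply: (cvgr_to_ge (cvg_dnbhs_at_right dc)); near=> h.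
have h0 : 0 < h by near: h; exact: nbhs_right_gt.
apply: mulr_ge0; first by rewrite invr_ge0 ltW.
by rewrite subr_ge0; near: h; exact: cvg_within mn1.
Unshelve. all: by end_near. Qed.

(** The difference has a local minimum at [t]. This is how an inequality with equality at one point
    becomes an equality of derivatives. *)
Lemma is_derive_le (f g : R -> R) (t df dg : R) :
  is_derive t (1 : R) f df -> is_derive t (1 : R) g dg -> g t = f t ->
  (\forall s \near t, g s <= f s) -> df = dg.
Proof.
move=> fdf gdg gf le; apply/eqP; rewrite -subr_eq0; apply/eqP.
have [dfg <-] := is_deriveB fdf gdg.
apply: derive_at_min => //; apply: filterS le => s gfs.
by rewrite !fctE gf subrr subr_ge0.
Qed.

(* At a zero of [N] the derivative of [N] vanishes as well, and [k >= 2] makes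
   [sqrt N ^ k] of the order of [N]. *)
Lemma derivable_sqrtX (k : nat) (N : R -> R) (t dN : R) : (2 <= k)%N ->
  is_derive t (1 : R) N dN -> (\forall s \near t, 0 <= N s) ->
  is_derive t (1 : R) (fun s => Num.sqrt (N s) ^+ k)
    (k%:R / 2 * Num.sqrt (N t) ^+ (k - 2) * dN).
Proof.
move=> k2 NdN N0; have [dNt dNE] := NdN.
have cN : {for t, continuous N} by apply/differentiable_continuous/derivable1_diffP.
have [Nt|Nt] := ltP 0 (N t).
  have sd : is_derive t (1 : R) (Num.sqrt \o N) ((2 * Num.sqrt (N t))^-1 * dN).
    have [ds dsE] := is_derive1_sqrt Nt.
    have dNd : differentiable N t by apply/derivable1_diffP; exact: dNt.
    have dsd : differentiable Num.sqrt (N t) by exact/derivable1_diffP.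
    apply: DeriveDef; first by apply/derivable1_diffP; exact: differentiable_comp.
    rewrite derive_comp // dNE deriveE // -[X in 'd _ _ X]mulr1 linearZ /= -deriveE // dsE.
    by rewrite [LHS]mulrC.
  have s0 : Num.sqrt (N t) != 0 by rewrite gt_eqF // sqrtr_gt0.
  have -> : (fun s => Num.sqrt (N s) ^+ k) = (Num.sqrt \o N) ^+ k.
    by apply/funext => s; rewrite exprfctE.
  have H := is_deriveX k sd; apply: (is_derive_eq H).
  have -> : k.-1 = (k - 2).+1 by rewrite -subn1 subnSK.
  have aux (c s p d : R) : s != 0 -> c * (s * p) * ((2 * s)^-1 * d) = c / 2 * p * d.
    by move=> s1; field.
  by rewrite exprS; exact: aux.
have Nt0 : N t = 0 by apply/eqP; rewrite eq_le Nt (nbhs_singleton N0).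
have dN0 : dN = 0.
  rewrite -dNE; apply: derive_at_min => //.
  by apply: filterS N0 => s; rewrite Nt0.
(* The quotient is [sqrt N ^ (k - 2)] times the difference quotient of [N]. For [k = 2] the first
   factor is 1, and only the vanishing of [dN] gives the limit. *)
have q0 : h^-1 *: (Num.sqrt (N (h *: 1 + t)) ^+ k - Num.sqrt (N t) ^+ k) @[h --> 0^'] --> (0 : R).
  have dc : h^-1 *: (N (h *: 1 + t) - N t) @[h --> 0^'] --> dN by rewrite -dNE; exact: dNt.
  have sc : Num.sqrt (N (h *: 1 + t)) ^+ (k - 2) @[h --> 0^'] --> Num.sqrt (N t) ^+ (k - 2).
    apply: cvg_within_filter.
    have t0 : (0 : R) *: 1 + t = t by rewrite scale0r add0r.
    rewrite -[in X in _ --> X]t0.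
    have lin : {for (0 : R), continuous (fun h : R => h *: 1 + t)}.
      by apply: continuousD; [exact: scalel_continuous|exact: cst_continuous].
    have cN0 : {for (0 : R) *: 1 + t, continuous N} by rewrite t0.
    have cs := continuous_comp (continuous_comp lin cN0) (@sqrt_continuous R _).
    exact: (continuous_comp cs (@exprn_continuous _ (k - 2) _)).
  have P := cvgM sc dc; rewrite dN0 mulr0 in P.
  apply: (cvg_trans _ (P _)); apply: near_eq_cvg.
  move: N0; rewrite (near_shift 0) subr0 => N0.
  apply: cvg_within; apply: filterS N0 => h /= Nh.
  have hA : (h%:A : R) = h by exact: mulr1.
  rewrite hA Nt0 sqrtr0 expr0n gtn_eqF ?(leq_trans _ k2) // !subr0.
  rewrite -[in RHS](subnK k2) exprD sqr_sqrtr //; exact: mulrCA.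
apply: DeriveDef; first by apply/cvg_ex; exists 0.
by rewrite dN0 mulr0; apply/cvg_lim.
Qed.

End Derivatives.

(** * Iterated integrals, charts and the volume measure *)

Lemma row_mx_headE (R : nzRingType) n (v : 'rV[R]_n.+1) :
  v = row_mx ((v ord0 ord0)%:M : 'rV_1) (@rsubmx _ 1 1 n v).
Proof.
rewrite -[LHS](@hsubmxK _ 1 1 n); congr (@row_mx _ 1 1 n _ _).
by rewrite [LHS]mx11_scalar mxE; congr (v _ _)%:M; apply: val_inj.
Qed.

Section IteratedIntegral.
Context {R : realType}.
Local Open Scope ereal_scope.
Import HBNNSimple.

Lemma measurable_translate (s : R) :
  measurable_fun [set: measurableTypeR R] ((fun x => x + s)%R : _ -> measurableTypeR R).
Proof.
apply: continuous_measurable_fun => x.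
by apply: cvgD; [exact: cvg_id|exact: cvg_cst].
Qed.

(** The translated measure agrees with Lebesgue measure on half-open intervals, which determine
    it. *)
Lemma lebesgue_measure_translate (s : R) (A : set R) : measurable A ->
  lebesgue_measure ((fun x => x + s)%R @^-1` A) = lebesgue_measure A :> \bar R.
Proof.
move=> mA.
pose mu := pushforward (@lebesgue_measure R) ((fun x => x + s)%R : _ -> measurableTypeR R).
have mf := measurable_translate s.
pose mu' : {measure set (measurableTypeR R) -> \bar R} :=
  measure_function_pushforward__canonical__measure_function_Measure lebesgue_measure mf.
rewrite -[LHS]/(mu' A); apply/esym/lebesgue_measure_unique => // _ [[a b]] _ <-.
rewrite /mu' /= /pushforward.
have -> : (fun x => x + s)%R @^-1` `]a, b]%classic = `](a - s)%R, (b - s)%R]%classic.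
  by apply/seteqP; split => x /=; rewrite !in_itv /= ltrBlDr lerBrDr.
by rewrite !lebesgue_measure_itv /= !lte_fin ltrD2r -!EFinB opprB addrA subrK.
Qed.

(** The integral is a supremum over the simple functions below [f], and these can be translated. The
    argument covers arbitrary nonnegative [f], as required for the partial integrals inside
    [integral_rV]. *)
Lemma integral_translate_le (f : R -> \bar R) (s : R) : (forall x, 0 <= f x) ->
  \int[lebesgue_measure]_(x in [set: R]) f (x + s)%R
  <= \int[lebesgue_measure]_(x in [set: R]) f x.
Proof.
move=> f0; rewrite !ge0_integralTE //.
apply: ge_ereal_sup => _ [h hf <-]; apply: ereal_sup_ubound => /=.
pose g : measurableTypeR R -> R := fun x => h (x - s)%R.
have mg : measurable_fun [set: measurableTypeR R] g.
  exact: (measurableT_comp (f := h) _ (measurable_translate _)).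
have fg : finite_set (range g).
  by apply: sub_finite_set (@fimfunP _ _ h) => _ [x _ <-]; exists (x - s)%R.
have ng : forall x, (0 <= g x)%R by move=> x; exact: fun_ge0.
pose h1 := isMeasurableFun.Build _ _ _ _ g mg.
pose h2 := FiniteImage.Build _ _ g fg.
pose h3 := isNonNegFun.Build _ _ g ng.
pose h' : {nnsfun measurableTypeR R >-> R} := HB.pack g h1 h2 h3.
exists h'.
  by move=> x /=; have := hf (x - s)%R; rewrite subrK.
rewrite /sintegral; apply: eq_fsbigr => x _; congr (_ * _).
rewrite -[in RHS](lebesgue_measure_translate (- s)%R) //.
by rewrite -[X in 'measurable X]setTI; exact: measurable_funP1.
Qed.

Lemma integral_translate (f : R -> \bar R) (s : R) : (forall x, 0 <= f x) ->
  \int[lebesgue_measure]_(x in [set: R]) f (x + s)%R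
  = \int[lebesgue_measure]_(x in [set: R]) f x.
Proof.
move=> f0; apply/eqP; rewrite eq_le integral_translate_le //=.
have := @integral_translate_le (fun x => f (x + s)%R) (- s)%R (fun x => f0 _).
by under eq_integral do rewrite subrK.
Qed.

Lemma integral_rV_ge0 n (f : 'rV[R]_n -> \bar R) :
  (forall y, 0 <= f y) -> 0 <= integral_rV f.
Proof.
elim: n f => [|n IH] f f0 //=; apply: integral_ge0 => x _; exact: IH.
Qed.

Lemma integral_rV_translate n (f : 'rV[R]_n -> \bar R) (v : 'rV_n) :
  (forall y, 0 <= f y) -> integral_rV (fun y => f (y + v)%R) = integral_rV f.
Proof.
elim: n f v => [|n IH] f v f0 /=; first by rewrite [v]thinmx0 addr0.
pose v0 : R := v ord0 ord0; pose v' : 'rV_n := @rsubmx _ 1 1 n v.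
have vE : v = row_mx (v0%:M : 'rV_1) v'.
  exact: row_mx_headE.
rewrite -[RHS](@integral_translate _ v0) => [|x]; last by apply: integral_rV_ge0.
apply: eq_integral => x _.
rewrite -[in RHS](IH _ v') //; congr integral_rV; apply/funext => y.
congr f; rewrite [in LHS]vE; apply/rowP => j; rewrite !mxE.
by case: split_ordP => l _; rewrite !mxE ?mulrnDl.
Qed.

Lemma integral_rV_cst0 n : integral_rV (fun _ : 'rV[R]_n => 0 : \bar R) = 0.
Proof. by elim: n => //= n ->; rewrite integral0. Qed.

(** Balls of row vectors are boxes: fixing the first coordinate leaves a ball of the same radius or
    nothing. *)
Lemma integral_rV_ball n (a : 'rV[R]_n) (r : R) : (0 < r)%R ->
  integral_rV (fun y => (\1_(ball a r) y)%:E) < +oo.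
Proof.
move=> r0; elim: n a => [|n IH] a /=.
  by rewrite ltry.
pose a0 : R := a ord0 ord0; pose a' : 'rV_n := @rsubmx _ 1 1 n a.
have aE : a = row_mx (a0%:M : 'rV_1) a'.
  exact: row_mx_headE.
have bE x (y : 'rV_n) : (ball a r : set 'rV_n.+1) (row_mx (x%:M : 'rV_1) y)
    <-> ball a0 r x /\ ball a' r y.
  split=> [[_ ab]|[ax [_ ay]]].
    split; first by have := ab ord0 (@lshift 1 n ord0); rewrite aE !(@row_mxEl _ 1 1 n) !mxE.
    split=> // i j; have := ab i (@rshift 1 n j).
    by rewrite aE !(@row_mxEr _ 1 1 n).
  split=> // i j; rewrite aE; case: (@split_ordP 1 n j) => l ->.
    by rewrite !(@row_mxEl _ 1 1 n) !mxE !ord1 eqxx.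
  by rewrite !(@row_mxEr _ 1 1 n).
rewrite (_ : integral _ _ _ = \int[lebesgue_measure]_(x in ball a0 r)
   (cst (integral_rV (fun y => (\1_(ball a' r) y)%:E)) x)); last first.
  rewrite [RHS]integral_mkcond; apply: eq_integral => x _; rewrite /patch.
  case: ifPn; rewrite ?inE ?notin_setE => ax.
    congr integral_rV; apply/funext => y; rewrite !indicE; congr (_ %:R)%:E.
    congr (nat_of_bool _); apply/idP/idP; rewrite !inE; [by move/bE => []|].
    by move=> ay; apply/bE.
  rewrite -[RHS](integral_rV_cst0 n); congr integral_rV; apply/funext => y.
  by rewrite indicE memNset // => /bE [].
rewrite integral_cst; last exact: measurable_ball.
rewrite lte_mul_pinfty //.
- by apply: integral_rV_ge0 => y; rewrite lee_fin.
- by rewrite ge0_fin_numE ?IH //; apply: integral_rV_ge0 => y; rewrite lee_fin.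
- have := lebesgue_measure_ball a0 (ltW r0); rewrite /= => ->; exact: ltry.
Qed.

End IteratedIntegral.

Section Charts.
Context {R : realType} {n : nat}.
Implicit Types M : oriented_manifold R n.

Lemma chart_codom_open M (i : chart_idx M) : open (chart_codom (atlas i)).
Proof. exact: open_chart_codom. Qed.

Lemma chart_inv_dom M (i : chart_idx M) y : chart_codom (atlas i) y ->
  chart_dom (atlas i) (chart_inv (atlas i) y).
Proof. by move=> [p dp <-]; rewrite chart_coordK. Qed.

Lemma chart_invK M (i : chart_idx M) y : chart_codom (atlas i) y ->
  chart_coord (atlas i) (chart_inv (atlas i) y) = y.
Proof. by move=> [p dp <-]; rewrite chart_coordK. Qed.

Lemma chart_coord_codom M (i : chart_idx M) p : chart_dom (atlas i) p ->
  chart_codom (atlas i) (chart_coord (atlas i) p).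
Proof. by move=> dp; exists p. Qed.

Lemma chart_coord_cont M (i : chart_idx M) p : chart_dom (atlas i) p ->
  {for p, continuous (chart_coord (atlas i))}.
Proof.
move=> dp; have := @chart_coord_continuous _ _ _ (atlas i).
rewrite continuous_open_subspace; last exact: open_chart_dom.
by apply; rewrite inE.
Qed.

Lemma chart_inv_cont M (i : chart_idx M) y : chart_codom (atlas i) y ->
  {for y, continuous (chart_inv (atlas i))}.
Proof.
move=> dy; have := @chart_inv_continuous _ _ _ (atlas i).
rewrite continuous_open_subspace; last exact: open_chart_codom.
by apply; rewrite inE.
Qed.

Lemma chart_dom_nbhs M (i : chart_idx M) p : chart_dom (atlas i) p ->
  \forall q \near p, chart_dom (atlas i) q.
Proof. by move=> dp; apply: open_nbhs_nbhs; split => //; exact: open_chart_dom. Qed.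

Lemma chart_codom_nbhs M (i : chart_idx M) y : chart_codom (atlas i) y ->
  \forall z \near y, chart_codom (atlas i) z.
Proof. by move=> dp; apply: open_nbhs_nbhs; split => //; exact: open_chart_codom. Qed.

Lemma local_domP k M (L : oriented_manifold R k) (f : M -> L) i j y :
  local_dom f i j y <->
  chart_codom (atlas i) y /\ chart_dom (atlas j) (f (chart_inv (atlas i) y)).
Proof.
split=> [[p [dp dfp] <-]|[cy dfy]].
  by split; [exists p|rewrite chart_coordK].
exists (chart_inv (atlas i) y); last exact: chart_invK.
by split => //; exact: chart_inv_dom.
Qed.

Lemma metric_C1_at M (h : riem_metric M) (i : chart_idx M) a b y :
  chart_codom (atlas i) y -> C1_at (fun z => h i z a b) y.
Proof.
move=> cy; apply: smooth_on_C1_at cy; first exact: chart_codom_open.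
by apply: smooth_on_entry; [exact: chart_codom_open|exact: metric_smooth].
Qed.

Lemma metric_pos M (h : riem_metric M) (i : chart_idx M) y :
  chart_codom (atlas i) y -> posdef (h i y).
Proof.
by move=> cy; split; [exact: (Defs.metric_sym h cy)|move=> v v0; exact: (metric_posdef h cy)].
Qed.

Definition density M (h : riem_metric M) (i : chart_idx M) y := Num.sqrt (\det (h i y)).

Lemma density_gt0 M (h : riem_metric M) i y : chart_codom (atlas i) y -> 0 < density h i y.
Proof. by move=> cy; rewrite sqrtr_gt0; apply: posdef_det_gt0; exact: metric_pos. Qed.

Lemma density_C1_at M (h : riem_metric M) i y :
  chart_codom (atlas i) y -> C1_at (density h i) y.
Proof.
move=> cy; apply: C1_at_sqrt; last by apply: posdef_det_gt0; exact: metric_pos.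
by apply: C1_at_det => a b; exact: metric_C1_at.
Qed.

Lemma borel_open M (U : set M) : open U -> measurable (U : set (borel_space M)).
Proof. exact: sub_sigma_algebra. Qed.

Lemma borel_continuous M (U : set M) (f : M -> R) : open U ->
  (forall p, U p -> {for p, continuous f}) ->
  measurable_fun (U : set (borel_space M)) (f : borel_space M -> R).
Proof.
move=> oU cf; apply: (measurability _ (RGenOpens.measurableE R)).
move=> _ [_ [a [b ->] <-]]; apply: borel_open.
suff sub : (U `&` f @^-1` `]a, b[) `<=` (U `&` f @^-1` `]a, b[)°.
  by have := sub; rewrite -[X in X -> _]/([set A : set M | A `<=` A°] _) -openE.
move=> p [Up fp]; apply: filterI; first by apply: open_nbhs_nbhs.
apply: (cf p Up); apply: open_nbhs_nbhs; split => //.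
Qed.

(** Extension by zero moves a coordinate integrand to the manifold, where it can be integrated
    against the measure. *)
Definition chart_fun M (i : chart_idx M) (g : 'rV[R]_n -> R) : borel_space M -> R :=
  (fun p : M => g (chart_coord (atlas i) p)) \_ (chart_dom (atlas i)).

Lemma chart_fun_in M (i : chart_idx M) g p : chart_dom (atlas i) p ->
  chart_fun i g p = g (chart_coord (atlas i) p).
Proof. by move=> dp; rewrite /chart_fun patchT // inE. Qed.

Lemma chart_fun_out M (i : chart_idx M) g p : ~ chart_dom (atlas i) p -> chart_fun i g p = 0.
Proof. by move=> dp; rewrite /chart_fun patchN // notin_setE. Qed.

Lemma measurable_chart_fun M (i : chart_idx M) (g : 'rV[R]_n -> R) :
  (forall y, chart_codom (atlas i) y -> {for y, continuous g}) ->
  measurable_fun [set: borel_space M] (chart_fun i g).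
Proof.
move=> cg; have md : measurable (chart_dom (atlas i) : set (borel_space M)).
  by apply: borel_open; exact: open_chart_dom.
apply: ((measurable_restrictT (fun p : borel_space M => g (chart_coord (atlas i) p)) md).1).
apply: borel_continuous; first exact: open_chart_dom.
move=> p dp; apply: continuous_comp; first exact: chart_coord_cont.
by apply: cg; exact: chart_coord_codom.
Qed.

Section Volume.
Variables (M : oriented_manifold R n) (h : riem_metric M).
Variable mu : {measure set (borel_space M) -> \bar R}.
Hypothesis hmu : is_vol_measure h mu.

(** The inverse density cancels the weight in [is_vol_measure] and leaves a flat integral. *)
Lemma vol_chart_integral (i : chart_idx M) (w : 'rV[R]_n -> R) :
  (forall y, 0 <= w y) -> (forall y, ~ chart_codom (atlas i) y -> w y = 0) ->
  (forall y, chart_codom (atlas i) y -> {for y, continuous w}) ->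
  (\int[mu]_(p in setT) (chart_fun i (fun y => (density h i y)^-1 * w y) p)%:E
   = integral_rV (EFin \o w))%E.
Proof.
move=> w0 wout cw; rewrite (hmu (i := i)).
- congr integral_rV; apply/funext => y; rewrite /patch; case: ifPn.
    rewrite inE => cy; rewrite chart_fun_in; last exact: chart_inv_dom.
    rewrite chart_invK // -EFinM /= mulrAC mulVf ?mul1r // gt_eqF //.
    exact: density_gt0.
  by rewrite notin_setE => cy; rewrite /= wout.
- apply/measurable_EFinP; apply: measurable_chart_fun => y cy.
  apply: continuousM; last exact: cw.
  apply: continuousV; first by rewrite gt_eqF // density_gt0.
  exact: C1_at_continuous (density_C1_at h cy).
- move=> p; rewrite lee_fin /chart_fun /patch; case: ifP => // _.
  by rewrite mulr_ge0 // invr_ge0 sqrtr_ge0.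
- by move=> p dp; rewrite chart_fun_out.
Qed.

(** [is_vol_measure] speaks of nonnegative functions, so positive and negative parts are translated
    separately; [pos] treats both at once, with [f] the identity or the opposite. Both supports must
    lie in the chart for the flat integrals to see all of [w]. *)
Lemma vol_chart_translate (i : chart_idx M) (w : 'rV[R]_n -> R) (v : 'rV[R]_n) :
  continuous w -> (forall y, w y != 0 -> chart_codom (atlas i) y) ->
  (forall y, w (y + v) != 0 -> chart_codom (atlas i) y) ->
  (\int[mu]_(p in setT) (chart_fun i (fun y => (density h i y)^-1 * w (y + v)) p)%:E
  = \int[mu]_(p in setT) (chart_fun i (fun y => (density h i y)^-1 * w y) p)%:E)%E.
Proof.
move=> cw w1 w2.
pose pos (f : R -> R) (w : 'rV[R]_n -> R) y := Num.max (f (w y)) 0.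
have posE (w' : 'rV[R]_n -> R) : ((fun p => (chart_fun i (fun y => (density h i y)^-1 * w' y) p)%:E)^\+
     = fun p => (chart_fun i (fun y => (density h i y)^-1 * pos id w' y) p)%:E)%E.
  apply/funext => p; rewrite funeposE /pos /chart_fun /patch; case: ifP => _ /=.
    by rewrite -EFin_max maxr_pMr ?invr_ge0 ?sqrtr_ge0 // mulr0.
  by rewrite maxxx.
have negE (w' : 'rV[R]_n -> R) : ((fun p => (chart_fun i (fun y => (density h i y)^-1 * w' y) p)%:E)^\-
     = fun p => (chart_fun i (fun y => (density h i y)^-1 * pos -%R w' y) p)%:E)%E.
  apply/funext => p; rewrite funenegE /pos /chart_fun /patch; case: ifP => _ /=.
    by rewrite -EFin_max maxr_pMr ?invr_ge0 ?sqrtr_ge0 // mulr0 mulrN.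
  by rewrite oppr0 maxxx.
have inv (f : R -> R) : f 0 = 0 -> continuous f ->
  (\int[mu]_(p in setT) (chart_fun i (fun y => (density h i y)^-1 * pos f (fun z => w (z + v)) y) p)%:E
   = \int[mu]_(p in setT) (chart_fun i (fun y => (density h i y)^-1 * pos f w y) p)%:E)%E.
  move=> f0 cf.
  have pc (w' : 'rV[R]_n -> R) y : {for y, continuous w'} -> {for y, continuous (pos f w')}.
    move=> cw'; have cc : {for y, continuous (fun=> 0 : R)} by exact: cst_continuous.
    apply: (continuous_max _ cc).
    exact: (continuous_comp cw' (cf _)).
  have cv : continuous (fun z : 'rV[R]_n => w (z + v)).
    move=> y; apply: (continuous_comp (f := fun z : 'rV[R]_n => z + v)); last exact: cw.
    apply: (continuousD (f := id) (g := cst v)); last exact: cst_continuous.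
    by move=> ?; exact.
  rewrite !vol_chart_integral.
  - by rewrite -[RHS](integral_rV_translate v) // => y; rewrite lee_fin /pos le_max lexx orbT.
  - by move=> y; rewrite /pos le_max lexx orbT.
  - move=> y cy; rewrite /pos; have [->|w0] := eqVneq (w y) 0; first by rewrite f0 maxxx.
    by case: cy; exact: w1.
  - by move=> y _; apply: pc; first [exact: cw|exact: cv].
  - by move=> y; rewrite /pos le_max lexx orbT.
  - move=> y cy; rewrite /pos; have [->|w0] := eqVneq (w (y + v)) 0; first by rewrite f0 maxxx.
    by case: cy; exact: w2.
  - by move=> y _; apply: pc; first [exact: cw|exact: cv].
rewrite integralE [RHS]integralE !posE !negE.
have cid : continuous (id : R -> R) by move=> ?; exact.
have cN : continuous (-%R : R -> R) by exact: opp_continuous.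
by rewrite (inv id erefl cid) (inv -%R (oppr0 _) cN).
Qed.

Hypothesis mu_fin : (mu [set: borel_space M] < +oo)%E.

Lemma integrable_bounded (f : borel_space M -> R) (C : R) :
  measurable_fun [set: borel_space M] f -> (forall p, `|f p| <= C) ->
  mu.-integrable setT (EFin \o f).
Proof.
move=> mf fC; apply: measurable_bounded_integrable => //.
exists C; split; first exact: num_real.
by move=> x Cx p _; exact: le_trans (fC p) (ltW Cx).
Qed.

(* Integration by parts in a chart: the integral of [w (y + s *: e)] does not
   depend on [s], so its derivative at [s = 0] vanishes. *)
Lemma stokes_chart (i : chart_idx M) (w : 'rV[R]_n -> R) (a e : 'rV[R]_n) (r C : R) :
  0 < r -> ball a (3 * r) `<=` chart_codom (atlas i) ->
  (forall y, ball a (3 * r) y -> (density h i y)^-1 <= C) ->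
  (forall y, C1_at w y) -> (forall y, ~ ball a r y -> w y = 0) ->
  mu.-integrable setT (EFin \o chart_fun i (fun y => (density h i y)^-1 * 'D_e w y))
  /\ (\int[mu]_(p in setT) chart_fun i (fun y => (density h i y)^-1 * 'D_e w y) p = 0)%R.
Proof.
move=> r0 sub dC Cw wout.
have Dout y : ~ ball a (2 * r) y -> 'D_e w y = 0.
  move=> nay; rewrite -(derive_cst (0 : R) y e); apply: near_eq_derive.
  near=> z; apply: wout => az; apply: nay.
  have yz : ball y r z by near: z; exact: nbhsx_ballx.
  rewrite mulr2n mulrDl mul1r; exact: ball_triangle az (ball_sym yz).
have cD : continuous ('D_e w) by move=> y; exact: (Cw y).2.
have [B B0 Bw] : exists2 B, 0 <= B & forall y, `|'D_e w y| <= B.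
  pose K := [set v : 'rV[R]_n | forall c, closed_ball (a ord0 c) (2 * r) (v ord0 c)].
  have cK : compact K.
    apply: (@rV_compact R n (fun c => closed_ball (a ord0 c) (2 * r))) => c.
    by apply: closed_ballR_compact; rewrite mulr_gt0.
  have [B [_ HB]] := compact_bounded (continuous_compact (continuous_subspaceT cD) cK).
  exists (Num.max 0 (B + 1)); first by rewrite le_max lexx.
  move=> y; have [Dy|/eqP] := eqVneq ('D_e w y) 0; first by rewrite Dy normr0 le_max lexx.
  move=> Dy; rewrite le_max; apply/orP; right; apply: (HB _ _ _).
    by rewrite ltrDl.
  exists y => // c; apply: subset_closed_ball.
  have [_] : ball a (2 * r) y by apply: contrapT => nay; apply: Dy; exact: Dout.
  by apply.
have cw : continuous w by move=> y; exact: C1_at_continuous.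
(* For [|s| < d] the translation by [s *: e] moves points by less than [r]; the 1 allows [e = 0].
   The radii [r], [2 * r] and [3 * r] serve the support of [w], its derivative and the translates of
   the latter. *)
pose d := r / (`|e| + 1).
have e1 : 0 < `|e| + 1 by rewrite ltr_pwDr.
have d0 : 0 < d by rewrite divr_gt0.
have de (s : R) : `|s| < d -> `|s *: e| < r.
  rewrite /d ltr_pdivlMr // => sd; rewrite normrZ; apply: le_lt_trans sd.
  by rewrite ler_wpM2l // lerDl.
have shift_in (s : R) y rho : `|s| < d -> ball a rho (y + s *: e) -> ball a (rho + r) y.
  move=> sd ay; apply: (ball_triangle ay); rewrite -ball_normE /ball_ /=.
  by rewrite addrAC subrr add0r de.
have b23 y : ball a (2 * r) y -> ball a (3 * r) y.
  by apply: le_ball; lra.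
have b12 y : ball a r y -> ball a (2 * r) y.
  by apply: le_ball; lra.
have w_in y : w y != 0 -> ball a r y.
  by move=> wy; apply: contrapT => /wout wy0; rewrite wy0 eqxx in wy.
have ws_in (s : R) y : `|s| < d -> w (y + s *: e) != 0 -> ball a (2 * r) y.
  by move=> sd /w_in /(shift_in _ _ _ sd); rewrite mulr2n mulrDl mul1r.
have dens0 y : 0 <= (density h i y)^-1 by rewrite invr_ge0 sqrtr_ge0.
have C0 : 0 <= C by apply: le_trans (dC a _) => //; apply: ballxx; rewrite mulr_gt0.
have cdens y : chart_codom (atlas i) y -> {for y, continuous (fun y => (density h i y)^-1)}.
  move=> cy; apply: continuousV; first by rewrite gt_eqF // density_gt0.
  exact: C1_at_continuous (density_C1_at h cy).
have ctr (s : R) : continuous (fun y : 'rV[R]_n => y + s *: e).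
  move=> y; apply: (continuousD (f := id) (g := cst (s *: e))); last exact: cst_continuous.
  by move=> ?; exact.
have chart_int (u : 'rV[R]_n -> R) (B' : R) : continuous u -> 0 <= B' ->
    (forall y, `|u y| <= B') -> (forall y, u y != 0 -> ball a (3 * r) y) ->
    (forall p, `|chart_fun i (fun y => (density h i y)^-1 * u y) p| <= C * B') /\
    mu.-integrable setT (EFin \o chart_fun i (fun y => (density h i y)^-1 * u y)).
  move=> cu B'0 ub uin.
  have le p : `|chart_fun i (fun y => (density h i y)^-1 * u y) p| <= C * B'.
    rewrite /chart_fun /patch; case: ifP => _; last by rewrite normr0 mulr_ge0.
    have [->|u0] := eqVneq (u (chart_coord (atlas i) p)) 0.
      by rewrite mulr0 normr0 mulr_ge0.
    by rewrite normrM ger0_norm // ler_pM //; apply: dC; exact: uin.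
  split => //; apply: (integrable_bounded _ le); apply: measurable_chart_fun => y cy.
  by apply: continuousM; [exact: cdens|exact: cu].
pose f (s : R) := chart_fun i (fun y => (density h i y)^-1 * w (y + s *: e)).
have [W W0 Ww] : exists2 W, 0 <= W & forall y, `|w y| <= W.
  pose K := [set v : 'rV[R]_n | forall c, closed_ball (a ord0 c) r (v ord0 c)].
  have cK : compact K.
    apply: (@rV_compact R n (fun c => closed_ball (a ord0 c) r)) => c.
    exact: closed_ballR_compact.
  have [B' [_ HB]] := compact_bounded (continuous_compact (continuous_subspaceT cw) cK).
  exists (Num.max 0 (B' + 1)); first by rewrite le_max lexx.
  move=> y; have [->|wy] := eqVneq (w y) 0; first by rewrite normr0 le_max lexx.
  rewrite le_max; apply/orP; right; apply: (HB _ _ _).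
    by rewrite ltrDl.
  exists y => // c; apply: subset_closed_ball.
  by have [_] := w_in _ wy; apply.
have fint s : `|s| < d -> mu.-integrable setT (EFin \o f s).
  move=> sd; apply: (chart_int (fun y => w (y + s *: e)) W _ _ _ _).2 => //.
    by move=> y; apply: continuous_comp; [exact: ctr|exact: cw].
  by move=> y /(ws_in _ _ sd)/b23.
pose g (s : R) := chart_fun i (fun y => (density h i y)^-1 * 'D_e w (y + s *: e)).
have fder s p : is_derive s (1 : R) (f ^~ p) (g s p).
  have [dp|dp] := pselect (chart_dom (atlas i) p); last first.
    have -> : f ^~ p = cst 0 by apply/funext => z; rewrite /f chart_fun_out.
    by rewrite /g chart_fun_out //; exact: is_derive_cst.
  set y := chart_coord (atlas i) p.
  have Hl : is_derive s (1 : R) (fun z : R => w (z *: e + y)) ('D_e w (s *: e + y)).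
    by apply: is_derive_line; exact: C1_at_differentiable.
  have -> : f ^~ p = (density h i y)^-1 \*: (fun z : R => w (z *: e + y)).
    by apply/funext => z; rewrite /f chart_fun_in // -/y addrC.
  by rewrite /g chart_fun_in // -/y [y + _]addrC; exact: is_deriveZ.
have D_in (s : R) y : `|s| < d -> 'D_e w (y + s *: e) != 0 -> ball a (3 * r) y.
  move=> sd Dy; have -> : 3 * r = 2 * r + r by ring.
  apply: (shift_in s) => //; apply: contrapT => /Dout D0.
  by rewrite D0 eqxx in Dy.
have gP s : `|s| < d -> (forall p, `|g s p| <= C * B) /\ mu.-integrable setT (EFin \o g s).
  move=> sd; apply: (chart_int (fun y => 'D_e w (y + s *: e)) B) => // y.
    exact: (continuous_comp (ctr s y) (cD _)).
  exact: D_in.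
have F0 s : `|s| < d -> (\int[mu]_(p in setT) f s p = \int[mu]_(p in setT) f 0 p)%R.
  move=> sd; rewrite /Rintegral /f; congr fine.
  have s0 : (fun y => (density h i y)^-1 * w (y + 0 *: e)) =
      (fun y => (density h i y)^-1 * w y).
    by apply/funext => y; rewrite scale0r addr0.
  rewrite s0; apply: vol_chart_translate => // y.
    by move=> /w_in/b12/b23/sub.
  by move=> /(ws_in _ _ sd)/b23/sub.
have I0 : `](- d), d[%classic (0 : R) by rewrite /= in_itv /= oppr_lt0 d0.
have It s : `](- d), d[%classic s -> `|s| < d by rewrite /= in_itv /= ltr_norml.
have g0E : g 0 = chart_fun i (fun y => (density h i y)^-1 * 'D_e w y).
  by congr chart_fun; apply/funext => y; rewrite scale0r addr0.
have d0' : `|0 : R| < d by rewrite normr0.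
rewrite -g0E; split; first exact: (gP 0 d0').2.
have fd1 s p : `](- d), d[%classic s -> partial1of2 f s p = g s p.
  by move=> _; rewrite partial1of2E; have [_ ->] := fder s p.
have K := @cvg_differentiation_under_integral R _ (borel_space M) mu f setT measurableT
  0 (- d) d I0 (fun s Is => fint s (It s Is)).
have {}K := K (fun s p _ _ => @ex_derive _ _ _ _ _ _ _ (fder s p)) (fun=> C * B).
have {}K := K (fun _ => mulr_ge0 C0 B0).
have CBint : mu.-integrable setT (EFin \o (fun=> C * B) : borel_space M -> \bar R).
  apply: (@integrable_bounded (fun=> C * B) (C * B)).
    exact: measurable_cst.
  by move=> p; rewrite ger0_norm // mulr_ge0.
have {}K := K CBint.
have gub s p : `](- d), d[%classic s -> setT p -> `|partial1of2 f s p| <= C * B.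
  by move=> Is _; rewrite fd1 //; exact: (gP s (It s Is)).1.
have {}K := K gub.
have gI : (\int[mu]_(p in setT) partial1of2 f 0 p = \int[mu]_(p in setT) g 0 p)%R.
  by congr Rintegral; apply/funext => p; exact: fd1.
rewrite -gI; apply: (cvg_unique _ K); first exact: norm_hausdorff.
apply: cvg_near_cst; near=> s.
rewrite addr0 F0 ?subrr ?scaler0 //; near: s; exact: dnbhs0_lt.
Unshelve. all: by end_near. Qed.

End Volume.
End Charts.

(** * Change of charts *)

Section ChartChange.
Context {R : realType}.

Lemma jacobianE m p (f : 'rV[R]_m -> 'rV[R]_p) y c b : differentiable f y ->
  ('J f y) c b = 'D_(delta_mx 0 c) (fun z => f z 0 b) y.
Proof.
move=> df; rewrite -derive_entry // deriveEjacobian //.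
by rewrite -rowE [RHS]mxE.
Qed.

Lemma jacobian_comp m p q (f : 'rV[R]_m -> 'rV[R]_p) (g : 'rV[R]_p -> 'rV[R]_q) y :
  differentiable f y -> differentiable g (f y) ->
  'J (g \o f) y = 'J f y *m 'J g (f y).
Proof.
move=> df dg; have dgf := differentiable_comp df dg.
apply/matrixP => c b; rewrite (jacobianE _ _ dgf) [RHS]mxE.
rewrite (derive_comp_rV (g := fun w => g w 0 b) _ df); last exact: differentiable_entry.
by apply: eq_bigr => d _; rewrite (jacobianE _ _ df) (jacobianE _ _ dg).
Qed.

Lemma near_eq_jacobian m p (f g : 'rV[R]_m -> 'rV[R]_p) y :
  (\forall z \near y, f z = g z) -> differentiable f y -> 'J f y = 'J g y.
Proof.
move=> fg df; have dg := near_eq_differentiable fg df.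
apply/matrixP => c b; apply: etrans (jacobianE c b df) _.
apply: etrans (esym (jacobianE c b dg)).
by apply: near_eq_derive; apply: filterS fg => z ->.
Qed.

Lemma transition_differentiable m (L : oriented_manifold R m) (j j' : chart_idx L) q :
  chart_dom (atlas j) q -> chart_dom (atlas j') q ->
  differentiable (local_rep (id : L -> L) j j') (chart_coord (atlas j) q).
Proof.
move=> dj dj'; apply: smooth_on_differentiable (transition_smooth j j') _.
by exists q.
Qed.

Lemma transition_det_gt0 m (L : oriented_manifold R m) (j j' : chart_idx L) q :
  chart_dom (atlas j) q -> chart_dom (atlas j') q ->
  0 < \det ('J (local_rep (id : L -> L) j j') (chart_coord (atlas j) q)).
Proof. by move=> dj dj'; apply: transition_oriented; exists q. Qed.

Lemma metric_change m (L : oriented_manifold R m) (g : riem_metric L) (j j' : chart_idx L) q :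
  chart_dom (atlas j) q -> chart_dom (atlas j') q ->
  let S := 'J (local_rep (id : L -> L) j j') (chart_coord (atlas j) q) in
  g j (chart_coord (atlas j) q) = S *m g j' (chart_coord (atlas j') q) *m S^T.
Proof.
move=> dj dj' S; have ld : local_dom (id : L -> L) j j' (chart_coord (atlas j) q) by exists q.
rewrite (metric_compat g ld) -/S; congr (_ *m g _ _ *m _).
by rewrite /local_rep /= chart_coordK.
Qed.

Variables (n k : nat) (M : oriented_manifold R n) (L : oriented_manifold R k).
Variables (h : riem_metric M) (g : riem_metric L).

(** |du|^2 as a function of the Gram matrices of the two metrics and the Jacobian. *)
Definition du2 (hi : 'M[R]_n) (gj : 'M[R]_k) (J : 'M[R]_(n, k)) :=
  \tr (invmx hi *m (J *m gj *m J^T)).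

Lemma du2_source (hi : 'M[R]_n) gj (T : 'M[R]_n) (J : 'M[R]_(n, k)) :
  hi \in unitmx -> T \in unitmx ->
  du2 (T *m hi *m T^T) gj (T *m J) = du2 hi gj J.
Proof.
move=> hu Tu; rewrite /du2; have TTu : T^T \in unitmx by rewrite unitmx_tr.
have -> : invmx (T *m hi *m T^T) = invmx T^T *m invmx hi *m invmx T.
  have Xu : T *m hi *m T^T \in unitmx by rewrite !unitmx_mul Tu hu TTu.
  apply: (can_inj (mulKmx Xu)); rewrite mulmxV // -!mulmxA (mulmxA T^T) mulmxV // mul1mx.
  by rewrite (mulmxA hi) mulmxV // mul1mx mulmxV.
rewrite trmx_mul !mulmxA -!(mulmxA _ (invmx T)) mulVmx // mulmx1.
by rewrite mxtrace_mulC !mulmxA mulmxV // mul1mx.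
Qed.

Lemma du2_target (hi : 'M[R]_n) gj (S : 'M[R]_k) (J : 'M[R]_(n, k)) :
  du2 hi gj (J *m S) = du2 hi (S *m gj *m S^T) J.
Proof. by rewrite /du2 trmx_mul !mulmxA. Qed.

Section PointChange.
Variables (v : M -> L) (p : M) (i : chart_idx M) (j : chart_idx L).
Hypothesis pi : chart_dom (atlas i) p.
Hypothesis pj : chart_dom (atlas j) (v p).
Hypothesis cv : {for p, continuous v}.
Let y := chart_coord (atlas i) p.
Hypothesis dv : differentiable (local_rep v i j) y.

Let cy : chart_codom (atlas i) y := chart_coord_codom pi.

Lemma near_chart_target j' : chart_dom (atlas j') (v p) ->
  \forall z \near y, chart_codom (atlas i) z /\ chart_dom (atlas j') (v (chart_inv (atlas i) z)).
Proof.
move=> pj'; apply: filterI; first exact: chart_codom_nbhs.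
have ci := chart_inv_cont cy.
have cvi : {for chart_inv (atlas i) y, continuous v} by rewrite chart_coordK.
apply: (continuous_comp ci cvi); rewrite /= chart_coordK //.
exact: chart_dom_nbhs.
Qed.

Lemma local_rep_target j' : chart_dom (atlas j') (v p) ->
  \forall z \near y,
    (local_rep (id : L -> L) j j' \o local_rep v i j) z = local_rep v i j' z.
Proof.
move=> pj'; apply: filterS (near_chart_target pj) => z [cz dz].
by rewrite /local_rep /= chart_coordK.
Qed.

Lemma local_rep_pt j' : local_rep v i j' y = chart_coord (atlas j') (v p).
Proof. by rewrite /local_rep /= chart_coordK. Qed.

Lemma jacobian_target j' : chart_dom (atlas j') (v p) ->
  differentiable (local_rep v i j') y /\
  'J (local_rep v i j') y
  = 'J (local_rep v i j) y *m 'J (local_rep (id : L -> L) j j') (chart_coord (atlas j) (v p)).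
Proof.
move=> pj'; have ne := local_rep_target pj'.
have dt : differentiable (local_rep (id : L -> L) j j') (local_rep v i j y).
  by rewrite local_rep_pt; exact: transition_differentiable.
have dc := differentiable_comp dv dt.
split; first exact: near_eq_differentiable ne dc.
apply: etrans (esym (near_eq_jacobian ne dc)) _.
by apply: etrans (jacobian_comp dv dt) _; rewrite local_rep_pt.
Qed.

Lemma jacobian_source i' : chart_dom (atlas i') p ->
  differentiable (local_rep v i' j) (chart_coord (atlas i') p) /\
  'J (local_rep v i' j) (chart_coord (atlas i') p)
  = 'J (local_rep (id : M -> M) i' i) (chart_coord (atlas i') p) *m 'J (local_rep v i j) y.
Proof.
move=> pi'; set y' := chart_coord (atlas i') p.
have ty : local_rep (id : M -> M) i' i y' = y by rewrite /local_rep /= chart_coordK.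
have ne : \forall z \near y', (local_rep v i j \o local_rep (id : M -> M) i' i) z = local_rep v i' j z.
  have cy' : chart_codom (atlas i') y' := chart_coord_codom pi'.
  have : \forall z \near y', chart_dom (atlas i) (chart_inv (atlas i') z).
    apply: (chart_inv_cont cy'); rewrite chart_coordK //; exact: chart_dom_nbhs.
  by apply: filterS => z dz; rewrite /local_rep /= chart_coordK.
have dt : differentiable (local_rep (id : M -> M) i' i) y' by exact: transition_differentiable.
have dv' : differentiable (local_rep v i j) (local_rep (id : M -> M) i' i y') by rewrite ty.
have dc := differentiable_comp dt dv'.
split; first exact: near_eq_differentiable ne dc.
apply: etrans (esym (near_eq_jacobian ne dc)) _.
by apply: etrans (jacobian_comp dt dv') _; rewrite ty.
Qed.

End PointChange.

Lemma unit_transition m (N : oriented_manifold R m) (j j' : chart_idx N) q :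
  chart_dom (atlas j) q -> chart_dom (atlas j') q ->
  'J (local_rep (id : N -> N) j j') (chart_coord (atlas j) q) \in unitmx.
Proof.
by move=> dj dj'; rewrite unitmxE unitfE gt_eqF // transition_det_gt0.
Qed.

(** [norm_d] uses charts selected by [chart_at], which change with the point, whereas
    differentiation needs fixed ones. The trace is invariant under changes of chart on both
    sides. *)
Lemma norm_dE (v : M -> L) p i j :
  chart_dom (atlas i) p -> chart_dom (atlas j) (v p) -> {for p, continuous v} ->
  differentiable (local_rep v i j) (chart_coord (atlas i) p) ->
  norm_d h g v p = Num.sqrt (du2 (h i (chart_coord (atlas i) p))
    (g j (chart_coord (atlas j) (v p))) ('J (local_rep v i j) (chart_coord (atlas i) p))).
Proof.
move=> pi pj cv dv; rewrite /norm_d /pullback_metric; set i0 := chart_at p.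
have pi0 : chart_dom (atlas i0) p by exact: mem_chart_at.
rewrite (chart_coordK pi0); set j0 := chart_at (v p).
have pj0 : chart_dom (atlas j0) (v p) by exact: mem_chart_at.
have [dv0 J0] := jacobian_source pi dv pi0.
have [dv1 J1] := jacobian_target pi0 pj cv dv0 pj0.
have cy := chart_coord_codom pi.
have hu : h i (chart_coord (atlas i) p) \in unitmx.
  by rewrite unitmxE unitfE gt_eqF // (posdef_det_gt0 (metric_pos h cy)).
apply: (congr1 Num.sqrt).
apply: etrans (congr1 (du2 (h i0 (chart_coord (atlas i0) p))
  (g j0 (chart_coord (atlas j0) (v p)))) J1) _.
apply: etrans (du2_target _ _ _ _) _.
apply: etrans (congr1 (fun G => du2 (h i0 (chart_coord (atlas i0) p)) G
  ('J (local_rep v i0 j) (chart_coord (atlas i0) p))) (esym (metric_change g pj pj0))) _.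
apply: etrans (congr1 (du2 _ _) J0) _.
apply: etrans (congr1 (fun H => du2 H _ _) (metric_change h pi0 pi)) _.
exact: du2_source hu (unit_transition pi0 pi).
Qed.

(** Here the orientation of the target atlas enters: the square root yields the absolute value of
    [\det S]. *)
Lemma vol_target_change p (X : 'M[R]_(k, p)) (J : 'M[R]_(p, k)) (S G : 'M[R]_k) :
  0 < \det S -> Num.sqrt (\det G) * \det (X *m (J *m S))
  = \det (X *m J) * Num.sqrt (\det (S *m G *m S^T)).
Proof.
move=> S0; rewrite mulmxA (det_mulmx _ S) (det_mulmx _ S^T) det_mulmx det_tr mulrAC -expr2.
by rewrite sqrtrM ?sqr_ge0 // sqrtr_sqr gtr0_norm // [LHS]mulrC mulrA.
Qed.

Lemma pullback_vol_formE (v : M -> L) p i j (X : 'M[R]_(k, n)) :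
  chart_dom (atlas i) p -> chart_dom (atlas j) (v p) -> {for p, continuous v} ->
  differentiable (local_rep v i j) (chart_coord (atlas i) p) ->
  pullback_form v (vol_form g) i (chart_coord (atlas i) p) X
  = \det (X *m 'J (local_rep v i j) (chart_coord (atlas i) p))
    * Num.sqrt (\det (g j (chart_coord (atlas j) (v p)))).
Proof.
move=> pi pj cv dv; rewrite /pullback_form /vol_form (chart_coordK pi).
set j0 := chart_at (v p).
have pj0 : chart_dom (atlas j0) (v p) by exact: mem_chart_at.
have [dv0 J0] := jacobian_target pi pj cv dv pj0.
apply: etrans (congr1 (fun J => _ * \det (X *m J)) J0) _.
apply: etrans (vol_target_change _ _ _ (transition_det_gt0 pj pj0)) _.
by apply: (congr1 (fun G => _ * Num.sqrt (\det G))); exact: esym (metric_change g pj pj0).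
Qed.

End ChartChange.

(** * Calculus on the product of time and coordinate space *)

Lemma pair_ext (A B : Type) (z w : A * B) : z.1 = w.1 -> z.2 = w.2 -> z = w.
Proof. by case: z w => [? ?] [? ?] /= -> ->. Qed.

Section TimeSpace.
Context {R : realType} {n : nat}.
Local Notation X := (R^o * 'rV[R]_n)%type.
Implicit Types (H : X -> R) (y : 'rV[R]_n).

Definition e_time : X := (1, 0).
Definition e_space (c : 'I_n) : X := (0, delta_mx 0 c).

Lemma derive_dirD (V W : normedModType R) (f : V -> W) x v w (a b : R) :
  differentiable f x -> 'D_(a *: v + b *: w) f x = a *: 'D_v f x + b *: 'D_w f x.
Proof. by move=> df; rewrite !deriveE // linearD !linearZ. Qed.

Lemma is_derive_time H y (s t : R) : differentiable H (t * s, y) ->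
  is_derive t (1 : R) (fun t : R => H (t * s, y)) (s * 'D_e_time H (t * s, y)).
Proof.
move=> dH.
have E (r : R) : (r * s, y) = r *: ((s, 0) : X) + (0, y).
  by apply: pair_ext; rewrite /= ?scaler0 ?add0r ?addr0.
have -> : (fun t : R => H (t * s, y)) = (fun r : R => H (r *: ((s, 0) : X) + (0, y))).
  by apply/funext => r; rewrite E.
have dH' : differentiable H (t *: ((s, 0) : X) + (0, y)) by rewrite -E.
have [dl dE] := is_derive_line dH'; apply: DeriveDef => //; rewrite dE -E.
have -> : ((s, 0) : X) = s *: e_time + 0 *: e_time.
  by rewrite scale0r addr0; apply: pair_ext; rewrite /= ?scaler0 // [RHS]mulr1.
by rewrite derive_dirD // scale0r addr0.
Qed.

Lemma is_derive_space H y (t : R) (v : 'rV[R]_n) : differentiable H (t, y) ->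
  is_derive y v (fun z => H (t, z)) ('D_((0, v) : X) H (t, y)).
Proof.
move=> dH.
have dp : differentiable (fun z : 'rV[R]_n => ((t, z) : X)) y.
  by apply: differentiable_pair.
have dv : 'D_v (fun z : 'rV[R]_n => ((t, z) : X)) y = (0, v).
  rewrite deriveE // diff_pair //.
  by rewrite diff_cst diff_val.
apply: DeriveDef; first by apply: diff_derivable; exact: (differentiable_comp dp dH).
by rewrite (derive_comp (f := fun z : 'rV[R]_n => ((t, z) : X)) v dp dH) dv.
Qed.

Lemma C1_at_slice H y (t : R) : C1_at H (t, y) -> C1_at (fun z => H (t, z)) y.
Proof.
move=> [dH cH].
have cp : {for y, continuous (fun z : 'rV[R]_n => ((t, z) : X))}.
  by apply: differentiable_continuous; exact: differentiable_pair.
have dHn : \forall z \near y, differentiable H (t, z) by exact: (cp _ dH).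
split=> [|v].
  apply: filterS dHn => z dHz.
  have dp : differentiable (fun z : 'rV[R]_n => ((t, z) : X)) z.
    by apply: differentiable_pair.
  exact: (differentiable_comp dp dHz).
apply: (near_eq_continuous (f := fun z => 'D_((0, v) : X) H (t, z))).
  by apply: filterS dHn => z /(is_derive_space v) [].
exact: (continuous_comp cp (cH _)).
Qed.

(** Chain rule along the graph of the rescaled cut-off. The time term is the source of the gradient
    of [psi] in the first variation. *)
Lemma is_derive_graph H (psi : 'rV[R]_n -> R) y (t : R) (v : 'rV[R]_n) :
  differentiable psi y -> differentiable H (t * psi y, y) ->
  differentiable (fun z => H (t * psi z, z)) y /\
  'D_v (fun z => H (t * psi z, z)) y
  = 'D_((0, v) : X) H (t * psi y, y) + t * 'D_v psi y * 'D_e_time H (t * psi y, y).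
Proof.
move=> dpsi dH.
have dt : differentiable (fun z => t * psi z : R^o) y.
  exact: (differentiableZ t dpsi).
have dp : differentiable (fun z : 'rV[R]_n => ((t * psi z, z) : X)) y.
  exact: differentiable_pair.
have dv : 'D_v (fun z : 'rV[R]_n => ((t * psi z, z) : X)) y
    = (t * 'D_v psi y) *: e_time + 1 *: ((0, v) : X).
  rewrite deriveE // diff_pair // diff_val.
  have -> : 'd (fun z => t * psi z : R^o) y v = t * 'D_v psi y.
    rewrite -deriveE //; by have := deriveZ t (@diff_derivable _ _ _ _ _ v dpsi).
  apply: pair_ext; rewrite /= scale1r ?scaler0 ?add0r //.
  by rewrite addr0 [_ *: _]mulr1.
split; first exact: (differentiable_comp dp dH).
rewrite (derive_comp (f := fun z : 'rV[R]_n => ((t * psi z, z) : X)) v dp dH) dv.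
apply: etrans (derive_dirD _ _ _ _ dH) _.
by rewrite scale1r; exact: addrC.
Qed.

End TimeSpace.

Section MatrixCalculus.
Context {R : realType}.

Lemma derivable_mulmx (V : normedModType R) m p q (A : V -> 'M[R]_(m, p))
    (B : V -> 'M[R]_(p, q)) x v :
  (forall i j, derivable (fun z => A z i j) x v) ->
  (forall i j, derivable (fun z => B z i j) x v) ->
  forall i j, derivable (fun z => (A z *m B z) i j) x v.
Proof.
move=> dA dB i j.
have : is_derive x v (fun z => \sum_l A z i l * B z l j)
    (\sum_l (A x i l * 'D_v (fun z => B z l j) x + B x l j * 'D_v (fun z => A z i l) x)).
  apply: is_derive_bigsum => l.
  have dAl := derivableP (dA i l); have dBl := derivableP (dB l j).
  exact: (is_deriveM dAl dBl).
case=> + _; have -> // : (fun z => (A z *m B z) i j) = fun z => \sum_l A z i l * B z l j.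
by apply/funext => z; rewrite mxE.
Qed.

Lemma C1_at_mulmx (V : normedModType R) m p q (A : V -> 'M[R]_(m, p))
    (B : V -> 'M[R]_(p, q)) x :
  (forall i j, C1_at (fun z => A z i j) x) ->
  (forall i j, C1_at (fun z => B z i j) x) ->
  forall i j, C1_at (fun z => (A z *m B z) i j) x.
Proof.
move=> dA dB i j.
have -> : (fun z => (A z *m B z) i j) = fun z => \sum_l A z i l * B z l j.
  by apply/funext => z; rewrite mxE.
by apply: C1_at_sum => l _; exact: C1_atM.
Qed.

Lemma C1_at_invmx (V : normedModType R) m (A : V -> 'M[R]_m) x :
  (forall i j, C1_at (fun z => A z i j) x) -> \det (A x) != 0 ->
  forall i j, C1_at (fun z => (invmx (A z)) i j) x.
Proof.
move=> CA Ax i j; have Cd := C1_at_det CA.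
have nd : \forall z \near x, \det (A z) != 0.
  have n0 : nbhs (\det (A x)) [set s : R | s != 0].
    by apply: open_nbhs_nbhs; split => //; exact: open_neq.
  exact: (C1_at_continuous Cd n0).
apply: (near_eq_C1_at (f := fun z => (\det (A z))^-1 * (\adj (A z)) i j)).
  by apply: filterS nd => z dz; rewrite /invmx unitmxE unitfE dz [RHS]mxE.
apply: C1_atM; first exact: C1_atV.
have -> : (fun z => (\adj (A z)) i j) = fun z => cofactor (A z) j i.
  by apply/funext => z; rewrite mxE.
apply: C1_atM; first exact: C1_at_cst.
apply: C1_at_det => a b.
have -> : (fun z => (row' j (col' i (A z))) a b) = fun z => A z (lift j a) (lift i b).
  by apply/funext => z; rewrite !mxE.
exact: CA.
Qed.

Lemma posdef_gram_ge0 m p (g : 'M[R]_m) (B : 'M[R]_(p, m)) i : posdef g ->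
  0 <= (B *m g *m B^T) i i.
Proof.
move=> [_ gp]; have -> : (B *m g *m B^T) i i = (row i B *m g *m (row i B)^T) 0 0.
  by rewrite -row_mul mxE [RHS]mxE; apply: eq_bigr => j _; rewrite !mxE.
by case: (eqVneq (row i B) 0) => [->|/gp/ltW//]; rewrite !mul0mx mxE.
Qed.

(** In an orthonormal frame for [h] the trace is a sum of diagonal entries of a Gram matrix. *)
Lemma du2_ge0 n k (h : 'M[R]_n) (g : 'M[R]_k) J : posdef h -> posdef g -> 0 <= du2 h g J.
Proof.
move=> hp gp; have [E [T [_ _ ET hE]]] := cholesky hp.
have TE := mulmx1C ET.
rewrite /du2; have -> : invmx h = E^T *m E.
  have hu : h \in unitmx by rewrite unitmxE unitfE gt_eqF // posdef_det_gt0.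
  apply: (can_inj (mulKmx hu)); rewrite mulmxV // hE -!mulmxA (mulmxA T^T) -trmx_mul ET.
  by rewrite trmx1 mul1mx TE.
rewrite -(mulmxA E^T) mxtrace_mulC sumr_ge0 // => i _.
have -> : E *m (J *m g *m J^T) *m E^T = (E *m J) *m g *m (E *m J)^T.
  by rewrite trmx_mul !mulmxA.
exact: posdef_gram_ge0.
Qed.

End MatrixCalculus.

(** * First variation of the energy density *)

Lemma near_all (T : topologicalType) (x : T) (P : T -> Prop) :
  (forall z, P z) -> \forall z \near x, P z.
Proof. by move=> HP; exact: nearW. Qed.

Section Family.
Context {R : realType} {n k : nat}.
Variables (M : oriented_manifold R n) (L : oriented_manifold R k).
Variables (h : riem_metric M) (g : riem_metric L).
Variables (e : R) (u_ : R -> M -> L).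
Hypothesis fam : smooth_family e u_.
Variables (i : chart_idx M) (j : chart_idx L).
Local Notation X := (R^o * 'rV[R]_n)%type.

Definition fam_rep (z : X) : 'rV[R]_k := local_rep (u_ z.1) i j z.2.
Definition fam_dom : set X := [set z | `|z.1| < e /\ local_dom (u_ z.1) i j z.2].

Lemma fam_domP z : fam_dom z <-> [/\ `|z.1| < e, chart_codom (atlas i) z.2 &
  chart_dom (atlas j) (u_ z.1 (chart_inv (atlas i) z.2))].
Proof.
split=> [[ze /local_domP[cz dz]]|[ze cz dz]]; first by [].
by split=> //; apply/local_domP.
Qed.

Lemma fam_dom_nbhs z : fam_dom z -> \forall w \near z, fam_dom w.
Proof.
move=> /fam_domP[ze cz dz].
have n1 : \forall w \near z, `|w.1| < e.
  have c1 : {for z, continuous (fun w : X => `|w.1|)}.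
    by apply: continuous_comp; [exact: cvg_fst|exact: norm_continuous].
  exact: (c1 _ (lt_nbhsl ze)).
have n2 : \forall w \near z, chart_codom (atlas i) w.2.
  have c2 : {for z, continuous (snd : X -> _)} by exact: cvg_snd.
  exact: (c2 _ (chart_codom_nbhs cz)).
have n3 : \forall w \near z, chart_dom (atlas j) (u_ w.1 (chart_inv (atlas i) w.2)).
  have cf := fam.1 z.1 (chart_inv (atlas i) z.2) ze.
  have cp : {for z, continuous (fun w : X => (w.1, chart_inv (atlas i) w.2) : R * M)}.
    have c1 : {for z, continuous (fst : X -> R)} by exact: cvg_fst.
    have c2 : {for z, continuous (snd : X -> 'rV[R]_n)} by exact: cvg_snd.
    exact: (cvg_pair c1 (continuous_comp c2 (chart_inv_cont cz))).
  have cc := continuous_comp cp cf.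
  exact: (cc _ (chart_dom_nbhs dz)).
by apply: filterS3 n1 n2 n3 => w w1 w2 w3; apply/fam_domP.
Qed.

Lemma fam_dom_open : open fam_dom.
Proof. by rewrite openE => z /fam_dom_nbhs. Qed.

Lemma fam_rep_smooth : smooth_on fam_dom fam_rep.
Proof. exact: fam.2. Qed.

Definition fam_comp (b : 'I_k) : X -> R := fun z => fam_rep z 0 b.
Definition fam_time (b : 'I_k) : X -> R := 'D_e_time (fam_comp b).
Definition fam_space (c : 'I_n) (b : 'I_k) : X -> R := 'D_(e_space c) (fam_comp b).

Lemma fam_comp_smooth b : smooth_on fam_dom (fam_comp b : X -> R^o).
Proof. by apply: smooth_on_entry; [exact: fam_dom_open|exact: fam_rep_smooth]. Qed.

Lemma fam_comp_C1 b z : fam_dom z -> C1_at (fam_comp b) z.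
Proof. exact: smooth_on_C1_at fam_dom_open (fam_comp_smooth b). Qed.

Lemma fam_time_C1 b z : fam_dom z -> C1_at (fam_time b) z.
Proof. exact: smooth_on_C1_at fam_dom_open (smooth_on_derive _ (fam_comp_smooth b)). Qed.

Lemma fam_space_C1 c b z : fam_dom z -> C1_at (fam_space c b) z.
Proof. exact: smooth_on_C1_at fam_dom_open (smooth_on_derive _ (fam_comp_smooth b)). Qed.

Lemma fam_schwarz_time c b z : fam_dom z ->
  'D_(e_space c) (fam_time b) z = 'D_e_time (fam_space c b) z.
Proof.
move=> dz; apply: schwarz; [exact: fam_comp_C1|exact: fam_time_C1|exact: fam_space_C1].
Qed.

Lemma fam_schwarz_space c c' b z : fam_dom z ->
  'D_(e_space c) (fam_space c' b) z = 'D_(e_space c') (fam_space c b) z.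
Proof.
move=> dz; apply: schwarz; [exact: fam_comp_C1|exact: fam_space_C1|exact: fam_space_C1].
Qed.

Lemma C1_at_snd (f : 'rV[R]_n -> R) (z : X) : C1_at f z.2 -> C1_at (fun w : X => f w.2) z.
Proof.
move=> Cf; apply: (C1_at_comp (f := snd : X -> _)) Cf => c.
have dsnd (w : X) : differentiable (snd : X -> 'rV[R]_n) w.
  by apply: linear_differentiable => ?; exact: cvg_snd.
have dc (w : X) : differentiable (fun w : X => w.2 0 c) w.
  exact: (differentiable_entry 0 c (dsnd w)).
split=> [|v]; first by apply: near_all => w; exact: dc.
apply: (near_eq_continuous (f := fun=> v.2 0 c)); last exact: cvg_cst.
apply: near_all => w; rewrite -(derive_entry v 0 c (dsnd w)) deriveE //.
by rewrite diff_lin // => ?; exact: cvg_snd.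
Qed.

Lemma fam_metric_C1 (f : 'rV[R]_k -> R) z :
  fam_dom z -> C1_at f (fam_rep z) -> C1_at (fun w => f (fam_rep w)) z.
Proof. by move=> dz; apply: C1_at_comp => c; exact: fam_comp_C1. Qed.

Lemma fam_rep_codom z : fam_dom z -> chart_codom (atlas j) (fam_rep z).
Proof. by move=> /fam_domP[_ cz dz]; exact: chart_coord_codom. Qed.

Definition fam_du2 (z : X) : R :=
  du2 (h i z.2) (g j (fam_rep z)) (\matrix_(c, b) fam_space c b z).

Lemma fam_du2_C1 z : fam_dom z -> C1_at fam_du2 z.
Proof.
move=> dz; have /fam_domP[_ cz _] := dz; rewrite /fam_du2 /du2 /mxtrace.
apply: C1_at_sum => a _; apply: C1_at_mulmx => [a' b'|].
  apply: C1_at_invmx; first by move=> ? ?; exact: (C1_at_snd (metric_C1_at _ _ _ cz)).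
  by rewrite gt_eqF // (posdef_det_gt0 (metric_pos h cz)).
have CJ a' b' : C1_at (fun w => (\matrix_(c, b) fam_space c b w) a' b') z.
  by apply: near_eq_C1_at (fam_space_C1 a' b' dz); apply: near_all => w; rewrite mxE.
apply: C1_at_mulmx; last first.
  move=> a' b'; apply: near_eq_C1_at (CJ b' a'); apply: near_all => w.
  by rewrite [RHS]mxE.
apply: C1_at_mulmx => // a' b'.
apply: (fam_metric_C1 (f := fun q => g j q a' b') dz).
by apply: metric_C1_at; exact: fam_rep_codom.
Qed.

Lemma fam_du2_ge0 z : fam_dom z -> 0 <= fam_du2 z.
Proof.
move=> dz; have /fam_domP[_ cz _] := dz.
by apply: du2_ge0; apply: metric_pos => //; exact: fam_rep_codom.
Qed.

Section Graph.
Variables (psi : 'rV[R]_n -> R) (y : 'rV[R]_n) (t : R).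
Hypothesis dpsi : differentiable psi y.
Hypothesis dty : fam_dom (t * psi y, y).

(** The Jacobian of z |-> u_(t psi(z))(z), with the value and the gradient of [psi] replaced by free
    parameters [s] and [d]; it thus becomes a curve of matrices in [t] at a fixed point. *)
Definition graph_jac (s : R) (d : 'I_n -> R) (t : R) : 'M[R]_(n, k) :=
  \matrix_(c, b) (fam_space c b (t * s, y) + t * d c * fam_time b (t * s, y)).

Lemma graph_jacobian :
  differentiable (fun z => fam_rep (t * psi z, z)) y /\
  'J (fun z => fam_rep (t * psi z, z)) y
  = graph_jac (psi y) (fun c => 'D_(delta_mx 0 c) psi y) t.
Proof.
have dg b : differentiable (fun z => fam_comp b (t * psi z, z)) y.
  by apply: (is_derive_graph 0 dpsi _).1; exact: C1_at_differentiable (fam_comp_C1 b dty).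
have dr : differentiable (fun z => fam_rep (t * psi z, z)) y.
  by apply: differentiable_rV => a b; rewrite (ord1 a); exact: dg.
split=> //; apply/matrixP => c b; rewrite (jacobianE _ _ dr) [RHS]mxE.
exact: (is_derive_graph _ dpsi (C1_at_differentiable (fam_comp_C1 b dty))).2.
Qed.

End Graph.
End Family.

Section FirstVariation.
Context {R : realType} {m k : nat}.
Local Notation n := (m + k)%N.
Variables (M : oriented_manifold R n) (L : oriented_manifold R k).
Variables (h : riem_metric M) (g : riem_metric L).
Variables (alpha : diff_form M m).
Hypothesis halpha : closed_calibration h alpha.
Hypothesis k2 : (2 <= k)%N.
Variables (e : R) (u_ : R -> M -> L).
Hypothesis fam : smooth_family e u_.
Variables (i : chart_idx M) (j : chart_idx L).
Local Notation X := (R^o * 'rV[R]_n)%type.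
Local Notation rep := (fam_rep u_ i j).
Local Notation Vt := (fam_time u_ i j).
Local Notation Ps := (fam_space u_ i j).

Definition energy_cst : R := (Num.sqrt k%:R ^+ k)^-1.

Lemma form_row_multilinear y : chart_codom (atlas i) y -> row_multilinear (form_val alpha i y).
Proof. by move=> cy A B C a b c; exact: form_multilinear. Qed.

Lemma form_C1 (B : 'M[R]_(m, n)) y : chart_codom (atlas i) y -> C1_at (fun z => form_val alpha i z B) y.
Proof.
move=> cy.
have sm : smooth_on (chart_codom (atlas i)) (fun z => form_val alpha i z B : R^o).
  exact: form_smooth.
by apply: smooth_on_C1_at cy; first exact: chart_codom_open.
Qed.

Definition dcoef (f : {ffun 'I_k -> 'I_n}) (y : 'rV[R]_n) : R := dual_coef (form_val alpha i y) f.

Lemma is_derive_dcoef f y v : chart_codom (atlas i) y ->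
  is_derive y v (dcoef f) (dual_coef (fun B => 'D_v (fun z => form_val alpha i z B) y) f).
Proof.
move=> cy; rewrite /dcoef /dual_coef; apply: is_deriveZ; apply: is_derive_bigsum => s.
set B := usubmx _; set D := \det _.
have dB := C1_at_is_derive v (form_C1 B cy).
have -> : (fun z => (-1) ^+ s * form_val alpha i z B * D)
    = ((-1) ^+ s * D) \*: (fun z => form_val alpha i z B).
  by apply/funext => z; rewrite mulrAC.
by rewrite mulrAC; exact: is_deriveZ.
Qed.

Lemma dcoef_C1 f y : chart_codom (atlas i) y -> C1_at (dcoef f) y.
Proof.
move=> cy; apply: C1_atM; first exact: C1_at_cst.
apply: C1_at_sum => s _; apply: C1_atM; last exact: C1_at_cst.
by apply: C1_atM; [exact: C1_at_cst|exact: form_C1].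
Qed.

(** Evaluating [closed_form] on standard basis vectors gives exactly the alternating sums that
    [dual_coef_div] asks for. *)
Lemma dcoef_div y a (Z : {ffun 'I_k -> 'I_n} -> R) : chart_codom (atlas i) y ->
  (forall f f' : {ffun 'I_k -> 'I_n}, (forall b, b != a -> f b = f' b) -> Z f = Z f') ->
  \sum_(f : {ffun 'I_k -> 'I_n})
    dual_coef (fun B => 'D_(delta_mx 0 (f a)) (fun z => form_val alpha i z B) y) f * Z f = 0.
Proof.
move=> cy Zf.
apply: (dual_coef_div (T := fun c B => 'D_(delta_mx 0 c) (fun z => form_val alpha i z B) y)) Zf.
  by rewrite pnatr_eq0.
move=> v; apply: etrans (halpha.2 i y (rowsub v 1%:M) cy); rewrite /ext_deriv.
apply: eq_bigr => l _.
have -> : row l (rowsub v 1%:M) = delta_mx 0 (v l) :> 'rV[R]_n.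
  by apply/rowP => q; rewrite !mxE eqxx eq_sym.
have -> // : row' l (rowsub v 1%:M) = rowsub (fun x => v (lift l x)) 1%:M :> 'M[R]_(m, n).
by apply/matrixP => p q; rewrite !mxE.
Qed.

Section AtPoint.
Variable y : 'rV[R]_n.
Hypothesis dy : fam_dom e u_ i j (0, y).
Variables (s : R) (d : 'I_n -> R).

Let cy : chart_codom (atlas i) y.
Proof. by have /fam_domP[] := dy. Qed.

Let rho := density g j.
Let drho (b : 'I_k) := 'D_(delta_mx 0 b) rho (rep (0, y)).

(* With [s = psi y] and [d] the gradient of [psi] at [y], this is the derivative
   at [t = 0] of the coefficient of alpha ^ v_t^* vol_L, where v_t is the map
   p |-> u_(t psi(p))(p). *)
Definition density_variation : R :=
  (\sum_b drho b * (s * Vt b (0, y))) *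
    (\sum_(f : {ffun 'I_k -> 'I_n}) dcoef f y * \prod_b Ps (f b) b (0, y))
  + rho (rep (0, y)) * \sum_(f : {ffun 'I_k -> 'I_n}) dcoef f y *
      \sum_a (s * 'D_e_time (Ps (f a) a) (0, y) + d (f a) * Vt a (0, y))
        * \prod_(b | b != a) Ps (f b) b (0, y).

Hypothesis calibrated :
  wedge_top (form_val alpha i y) (fun X => \det (X *m \matrix_(c, b) Ps c b (0, y))) 1%:M
    * rho (rep (0, y))
  = energy_cst * Num.sqrt (fam_du2 h g u_ i j (0, y)) ^+ k * density h i y.

Lemma near_curve : \forall t \near (0 : R), fam_dom e u_ i j (t * s, y).
Proof.
have c0 : {for (0 : R), continuous (fun t : R => ((t * s, y) : X))}.
  have c1 : {for (0 : R), continuous (fun t : R => t * s : R^o)}.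
    by apply: continuousM; [exact: cvg_id|exact: cvg_cst].
  exact: (cvg_pair c1 (@cst_continuous _ _ y _)).
have dy0 : nbhs ((0 * s, y) : X) (fam_dom e u_ i j).
  by rewrite mul0r; exact: fam_dom_nbhs.
exact: (c0 _ dy0).
Qed.

Lemma is_derive_time0 (H : X -> R) : C1_at H (0, y) ->
  is_derive (0 : R) (1 : R) (fun t : R => H (t * s, y)) (s * 'D_e_time H (0, y)).
Proof.
move=> /C1_at_differentiable dH.
by have := @is_derive_time _ _ H y s 0; rewrite mul0r; exact.
Qed.

Let qd b : is_derive (0 : R) (1 : R) (fun t : R => rep (t * s, y) 0 b) (s * Vt b (0, y)).
Proof. exact: (is_derive_time0 (fam_comp_C1 fam b dy)). Qed.

Let Jd c b : is_derive (0 : R) (1 : R) (fun t : R => graph_jac u_ i j y s d t c b)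
  (s * 'D_e_time (Ps c b) (0, y) + d c * Vt b (0, y)).
Proof.
have -> : (fun t : R => graph_jac u_ i j y s d t c b) =
   (fun t => Ps c b (t * s, y)) + (id * (d c \*: (fun t => Vt b (t * s, y)))).
  by apply/funext => t; rewrite mxE mulrA.
apply: is_deriveD; first exact: (is_derive_time0 (fam_space_C1 fam c b dy)).
have dV := is_deriveZ (d c) (is_derive_time0 (fam_time_C1 fam b dy)).
apply: is_derive_eq (is_deriveM (is_derive_id (0 : R) 1) dV) _.
by rewrite /= scale0r add0r mul0r [LHS]mulr1.
Qed.

Let qdiff : differentiable (fun t : R => rep (t * s, y)) 0.
Proof.
by apply/derivable1_diffP/derivable_mxP => a b; rewrite (ord1 a); have [] := qd b.
Qed.

Let q0 : rep (0 * s, y) = rep (0, y). Proof. by rewrite mul0r. Qed.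

Let cq : chart_codom (atlas j) (rep (0, y)) := fam_rep_codom dy.

Let rhod : is_derive (0 : R) (1 : R) (fun t : R => rho (rep (t * s, y)))
  (\sum_b drho b * (s * Vt b (0, y))).
Proof.
have dr : differentiable rho (rep (0 * s, y)).
  by rewrite q0; exact: C1_at_differentiable (density_C1_at g cq).
apply: DeriveDef.
  by apply/derivable1_diffP; exact: (differentiable_comp qdiff dr).
rewrite (derive_comp_rV (f := fun t : R => rep (t * s, y)) 1 qdiff dr).
by apply: eq_bigr => b _; rewrite q0 [LHS]mulrC; have [_ ->] := qd b.
Qed.

Let gd a b : derivable (fun t : R => g j (rep (t * s, y)) a b) 0 1.
Proof.
have dg : differentiable (fun q => g j q a b) (rep (0 * s, y)).
  by rewrite q0; exact: C1_at_differentiable (metric_C1_at g a b cq).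
by apply/derivable1_diffP; exact: (differentiable_comp qdiff dg).
Qed.

Let Nt (t : R) := du2 (h i y) (g j (rep (t * s, y))) (graph_jac u_ i j y s d t).

Let Nd : derivable Nt 0 1.
Proof.
have dJ c b : derivable (fun t : R => graph_jac u_ i j y s d t c b) 0 1 by have [] := Jd c b.
have dJt b c : derivable (fun t : R => (graph_jac u_ i j y s d t)^T b c) 0 1.
  have -> : (fun t : R => (graph_jac u_ i j y s d t)^T b c) =
    fun t => graph_jac u_ i j y s d t c b by apply/funext => t; rewrite [LHS]mxE.
  exact: dJ.
have dM1 := derivable_mulmx dJ gd.
have dM2 := derivable_mulmx dM1 dJt.
have dM0 a b : derivable (fun _ : R => invmx (h i y) a b) 0 1 by exact: derivable_cst.
have dM := derivable_mulmx dM0 dM2.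
by have [] := is_derive_bigsum (index_enum 'I_n) (fun a => derivableP (dM a a)).
Qed.

(* The right-hand side of the calibration inequality minus the left-hand side is
   minimal at [t = 0], so the energy density has the derivative of the
   calibrated side. *)
Lemma first_variation :
  is_derive (0 : R) (1 : R) (fun t => energy_cst * Num.sqrt (Nt t) ^+ k)
    ((density h i y)^-1 * density_variation).
Proof.
have Nge : \forall t \near (0 : R), 0 <= Nt t.
  apply: filterS near_curve => t dt; apply: du2_ge0; first exact: metric_pos.
  by apply: metric_pos; exact: (fam_rep_codom dt).
(* Differentiability of the energy density, also at zeros of du; only its existence matters here,
   since the comparison below supplies the value. *)
have Fd := is_deriveZ energy_cst (derivable_sqrtX k2 (derivableP Nd) Nge).
have D0 : density h i y != 0 by rewrite gt_eqF // density_gt0.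
pose G t := (\sum_(f : {ffun 'I_k -> 'I_n}) dcoef f y * \prod_b graph_jac u_ i j y s d t (f b) b)
  * rho (rep (t * s, y)).
have GE t : G t = wedge_top (form_val alpha i y) (fun X => \det (X *m graph_jac u_ i j y s d t)) 1%:M
    * rho (rep (t * s, y)).
  by rewrite /G wedge_top_dual.
have J0 : graph_jac u_ i j y s d 0 = \matrix_(c, b) Ps c b (0, y).
  by apply/matrixP => c b; rewrite !mxE !mul0r addr0.
have Gd : is_derive (0 : R) (1 : R) G density_variation.
  have Sd : is_derive (0 : R) (1 : R)
    (fun t => \sum_(f : {ffun 'I_k -> 'I_n}) dcoef f y * \prod_b graph_jac u_ i j y s d t (f b) b)
    (\sum_(f : {ffun 'I_k -> 'I_n}) dcoef f y *
      \sum_a (s * 'D_e_time (Ps (f a) a) (0, y) + d (f a) * Vt a (0, y))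
        * \prod_(b | b != a) graph_jac u_ i j y s d 0 (f b) b).
    apply: is_derive_bigsum => f; apply: is_deriveZ.
    by apply: is_derive_bigprod => [|b]; [exact: index_enum_uniq|exact: Jd].
  apply: is_derive_eq (is_deriveM Sd rhod) _.
  rewrite J0 q0 /density_variation [LHS]addrC [in LHS]addrC; congr (_ + _).
    rewrite [RHS]mulrC; congr (_ * _); apply: eq_bigr => f _; congr (_ * _).
    by apply: eq_bigr => b _; rewrite mxE.
  congr (_ * _); apply: eq_bigr => f _; congr (_ * _); apply: eq_bigr => a _.
  by congr (_ * _); apply: eq_bigr => b _; rewrite mxE.
have Gle : \forall t \near (0 : R), (density h i y)^-1 * G t <= energy_cst * Num.sqrt (Nt t) ^+ k.
  apply: filterS near_curve => t dt; rewrite GE ler_pdivrMl ?density_gt0 // [leRHS]mulrC.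
  have cal B : B *m h i y *m B^T = 1%:M -> `|form_val alpha i y B| <= 1 by exact: halpha.1.
  have gp := metric_pos g (fam_rep_codom dt).
  have cl := calibration_le (graph_jac u_ i j y s d t) (metric_pos h cy) gp (form_row_multilinear cy) cal.
  exact: cl.
have G0 : (density h i y)^-1 * G 0 = energy_cst * Num.sqrt (Nt 0) ^+ k.
  rewrite GE /Nt J0 q0 calibrated /fam_du2 /=.
  by rewrite mulrC mulfK.
have Gd' := is_deriveZ (density h i y)^-1 Gd.
have E := is_derive_le Fd Gd' G0 Gle.
by rewrite E in Fd.
Qed.

End AtPoint.
End FirstVariation.

(** * The first variation as a divergence *)

Section Flux.
Context {R : realType} {m k : nat}.
Local Notation n := (m + k)%N.
Variables (M : oriented_manifold R n) (L : oriented_manifold R k).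
Variables (h : riem_metric M) (g : riem_metric L).
Variables (alpha : diff_form M m).
Hypothesis halpha : closed_calibration h alpha.
Variables (e : R) (u_ : R -> M -> L).
Hypothesis fam : smooth_family e u_.
Variables (i : chart_idx M) (j : chart_idx L).
Local Notation rep := (fam_rep u_ i j).
Local Notation Vt := (fam_time u_ i j).
Local Notation Ps := (fam_space u_ i j).
Local Notation dcoef := (dcoef alpha i).

(** Summed over [a] and [f], with [flux psi a f] in direction [f a], this is, up to sign, the vector
    field dual to alpha ^ psi u^*(i_V vol_L), V being the velocity at time 0: slot [a] carries V in
    place of a differential. The summands are kept apart because each is differentiated in its own
    coordinate direction. *)
Definition flux (psi : 'rV[R]_n -> R) (a : 'I_k) (f : {ffun 'I_k -> 'I_n}) (z : 'rV[R]_n) : R :=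
  dcoef f z * (density g j (rep (0, z)) * (psi z * Vt a (0, z))
    * \prod_(b | b != a) Ps (f b) b (0, z)).

Variables (psi : 'rV[R]_n -> R) (y : 'rV[R]_n).
Hypothesis dy : fam_dom e u_ i j (0, y).
Hypothesis Cpsi : C1_at psi y.

Let cy : chart_codom (atlas i) y.
Proof. by have /fam_domP[] := dy. Qed.

Let cq : chart_codom (atlas j) (rep (0, y)) := fam_rep_codom dy.

Let rhoC : C1_at (fun z => density g j (rep (0, z))) y.
Proof.
exact: (C1_at_slice (fam_metric_C1 fam dy (density_C1_at g cq))).
Qed.

Lemma flux_C1 a f : C1_at (flux psi a f) y.
Proof.
apply: C1_atM; first exact: dcoef_C1.
apply: C1_atM; last first.
  by apply: C1_at_prod => b _; exact: (C1_at_slice (fam_space_C1 fam (f b) b dy)).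
apply: C1_atM; first exact: rhoC.
apply: C1_atM; first exact: Cpsi.
exact: (C1_at_slice (fam_time_C1 fam a dy)).
Qed.

Let spaceD c H : C1_at H (0, y) ->
  is_derive y (delta_mx 0 c) (fun z => H (0, z)) ('D_(e_space c) H (0, y)).
Proof. by move=> /C1_at_differentiable; exact: is_derive_space. Qed.

Let rhoD c : is_derive y (delta_mx 0 c) (fun z => density g j (rep (0, z)))
  (\sum_d 'D_(delta_mx 0 d) (density g j) (rep (0, y)) * Ps c d (0, y)).
Proof.
have dr : differentiable (fun z => rep (0, z)) y.
  apply: differentiable_rV => a b; rewrite (ord1 a).
  exact: C1_at_differentiable (C1_at_slice (fam_comp_C1 fam b dy)).
have dd := C1_at_differentiable (density_C1_at g cq).
apply: is_derive_eq (C1_at_is_derive _ rhoC) _.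
rewrite (derive_comp_rV (f := fun z => rep (0, z)) _ dr dd).
apply: eq_bigr => d _; rewrite [LHS]mulrC; congr (_ * _).
by have [_] := spaceD c (fam_comp_C1 fam d dy).
Qed.

Let prodD c a (f : {ffun 'I_k -> 'I_n}) :
  is_derive y (delta_mx 0 c) (fun z => \prod_(b | b != a) Ps (f b) b (0, z))
  (\sum_(b | b != a) 'D_(e_space c) (Ps (f b) b) (0, y)
     * \prod_(d | (d != a) && (d != b)) Ps (f d) d (0, y)).
Proof.
have pd b := spaceD c (fam_space_C1 fam (f b) b dy).
have ur : uniq [seq b <- index_enum 'I_k | b != a] by rewrite filter_uniq // index_enum_uniq.
have F : (fun z => \prod_(b <- [seq b <- index_enum 'I_k | b != a]) Ps (f b) b (0, z))
   = (fun z => \prod_(b | b != a) Ps (f b) b (0, z)).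
  by apply/funext => z; rewrite big_filter.
rewrite -F; apply: is_derive_eq (is_derive_bigprod ur pd) _.
by rewrite big_filter; apply: eq_bigr => b _; rewrite big_filter_cond.
Qed.

Lemma divergence_flux : \sum_a \sum_(f : {ffun 'I_k -> 'I_n}) 'D_(delta_mx 0 (f a)) (flux psi a f) y
  = density_variation g alpha u_ i j y (psi y) (fun c => 'D_(delta_mx 0 c) psi y).
Proof.
pose dA (c : 'I_n) (f : {ffun 'I_k -> 'I_n}) : R :=
  dual_coef (fun B => 'D_(delta_mx 0 c) (fun z => form_val alpha i z B) y) f.
pose PV (c : 'I_n) (b : 'I_k) : R := 'D_e_time (Ps c b) (0, y).
pose H (c c' : 'I_n) (b : 'I_k) : R := 'D_(e_space c) (Ps c' b) (0, y).
have anti (f : {ffun 'I_k -> 'I_n}) a b : a != b -> dcoef [ffun c => f (tperm a b c)] y = - dcoef f y.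
  exact: dual_coef_tperm.
have div a (Z : {ffun 'I_k -> 'I_n} -> R) :
    (forall f f' : {ffun 'I_k -> 'I_n}, (forall b, b != a -> f b = f' b) -> Z f = Z f') ->
    \sum_(f : {ffun 'I_k -> 'I_n}) dA (f a) f * Z f = 0.
  move=> Zf; rewrite /dA.
  by apply: (dcoef_div halpha cy Zf).
have Hs c c' b : H c c' b = H c' c b by exact: (fam_schwarz_space fam c c' b dy).
have DI := divergence_identity anti div (density g j (rep (0, y)))
  (fun d => 'D_(delta_mx 0 d) (density g j) (rep (0, y))) (fun c b => Ps c b (0, y))
  (fun b => Vt b (0, y)) (psi y) (fun c => 'D_(delta_mx 0 c) psi y) PV Hs.
apply: etrans DI; apply: eq_bigr => a _; apply: eq_bigr => f _.
have Vd := spaceD (f a) (fam_time_C1 fam a dy).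
have pd := C1_at_is_derive (delta_mx 0 (f a)) Cpsi.
have d0 := is_derive_dcoef alpha f (delta_mx 0 (f a)) cy.
have d1 := is_deriveM pd Vd.
have d2 := is_deriveM (rhoD (f a)) d1.
have d3 := is_deriveM d2 (prodD (f a) a f).
have d4 := is_deriveM d0 d3.
have E4 : 'D_(delta_mx 0 (f a)) (flux psi a f) y = _ := (derive_val (is_derive := d4)).
have aux (A r p V P S Q q v D : R) :
    A * (r * (p * V) * S + P * (r * (p * v + V * q) + p * V * Q)) + r * (p * V) * P * D
    = D * (r * (p * V) * P) + A * (Q * (p * V) * P + r * (q * V + p * v) * P + r * (p * V) * S).
  by ring.
(* The space derivative of the velocity becomes the time derivative of the Jacobian, as it occurs in
   [density_variation]. *)
rewrite (fam_schwarz_time fam (f a) a dy) in E4.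
apply: etrans E4 _; exact: aux.
Qed.
End Flux.

Section C1Functions.
Context {R : realType} {n : nat} {M : oriented_manifold R n}.

Definition C1_fun (psi : M -> R) := forall i y, chart_codom (atlas i) y ->
  C1_at (psi \o chart_inv (atlas i)) y.

Lemma C1_fun_continuous psi p : C1_fun psi -> {for p, continuous psi}.
Proof.
move=> Cpsi; have dp := mem_chart_at p; set i := chart_at p in dp.
have cp := chart_coord_codom dp.
have c1 := C1_at_continuous (Cpsi _ _ cp).
have c2 := continuous_comp (chart_coord_cont dp) c1.
apply: near_eq_continuous c2; apply: filterS (chart_dom_nbhs dp) => q dq /=.
by rewrite chart_coordK.
Qed.

Lemma C1_fun_sum (I : Type) (r : seq I) (psi : I -> M -> R) :
  (forall q, C1_fun (psi q)) -> C1_fun (fun p => \sum_(q <- r) psi q p).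
Proof. by move=> Cpsi i y cy; apply: C1_at_sum => q _; exact: Cpsi. Qed.

End C1Functions.

Section EnergyCurve.
Context {R : realType} {m k : nat}.
Local Notation n := (m + k)%N.
Variables (M : oriented_manifold R n) (L : oriented_manifold R k).
Local Notation c_k := (@energy_cst R k).
Variables (h : riem_metric M) (g : riem_metric L).
Variables (alpha : diff_form M m).
Hypothesis halpha : closed_calibration h alpha.
Hypothesis k2 : (2 <= k)%N.
Variables (e : R) (u_ : R -> M -> L).
Hypothesis fam : smooth_family e u_.

Definition calibrated := forall i j y, fam_dom e u_ i j (0, y) ->
  wedge_top (form_val alpha i y)
      (fun X => \det (X *m \matrix_(c, b) fam_space u_ i j c b (0, y))) 1%:M
    * density g j (fam_rep u_ i j (0, y))
  = c_k * Num.sqrt (fam_du2 h g u_ i j (0, y)) ^+ k * density h i y.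
Hypothesis cal : calibrated.

(* Cutting off the time parameter with [psi] localises the variation without
   needing a linear structure on the target. *)
Definition graph_energy (psi : M -> R) (p : M) (t : R) : R :=
  c_k * norm_d h g (fun q => u_ (t * psi q) q) p ^+ k.

Definition energy_rate (psi : M -> R) (p : M) : R := 'D_1 (graph_energy psi p) 0.

Lemma fam_dom_coord i j p t : `|t| < e -> chart_dom (atlas i) p ->
  chart_dom (atlas j) (u_ t p) -> fam_dom e u_ i j (t, chart_coord (atlas i) p).
Proof.
by move=> te dp du; apply/fam_domP; split=> //=; rewrite ?chart_coordK //; exact: chart_coord_codom.
Qed.

Lemma graph_energyE psi p i j t : C1_fun psi -> chart_dom (atlas i) p ->
  let y := chart_coord (atlas i) p in
  fam_dom e u_ i j (t * psi p, y) ->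
  graph_energy psi p t = c_k *
    Num.sqrt (du2 (h i y) (g j (fam_rep u_ i j (t * psi p, y)))
      (graph_jac u_ i j y (psi p)
         (fun c => 'D_(delta_mx 0 c) (psi \o chart_inv (atlas i)) y) t)) ^+ k.
Proof.
move=> Cpsi dp y dty; have /fam_domP[te cy dj] := dty.
have py : chart_inv (atlas i) y = p by exact: chart_coordK.
have psiy : (psi \o chart_inv (atlas i)) y = psi p by rewrite /= py.
have dpsi := C1_at_differentiable (Cpsi i y cy).
have dty' : fam_dom e u_ i j (t * (psi \o chart_inv (atlas i)) y, y) by rewrite psiy.
have [dr rE] := graph_jacobian fam dpsi dty'.
rewrite psiy in rE.
pose v q := u_ (t * psi q) q.
have cv : {for p, continuous v}.
  have c1 : {for p, continuous (fun q => (t * psi q, q))}.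
    have c3 : {for p, continuous (fun q => t * psi q)}.
      by apply: continuousM; [exact: cst_continuous|exact: C1_fun_continuous].
    have c4 : {for p, continuous (fun q : M => q)} by exact: cvg_id.
    exact: (cvg_pair c3 c4).
  exact: (continuous_comp c1 (fam.1 _ p te)).
have dvp : chart_dom (atlas j) (v p) by move: dj; rewrite /= py.
rewrite /graph_energy (norm_dE h g dp dvp cv dr) -/y.
have -> : chart_coord (atlas j) (v p) = fam_rep u_ i j (t * psi p, y).
  by rewrite /fam_rep /local_rep /= py.
by rewrite -rE.
Qed.

Lemma is_derive_graph_energy psi p i j : C1_fun psi -> chart_dom (atlas i) p ->
  let y := chart_coord (atlas i) p in
  fam_dom e u_ i j (0, y) ->
  is_derive (0 : R) (1 : R) (graph_energy psi p) ((density h i y)^-1 *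
    density_variation g alpha u_ i j y (psi p)
      (fun c => 'D_(delta_mx 0 c) (psi \o chart_inv (atlas i)) y)).
Proof.
move=> Cpsi dp y dy.
have fv := first_variation halpha k2 fam dy (psi p)
  (fun c => 'D_(delta_mx 0 c) (psi \o chart_inv (atlas i)) y) (cal dy).
apply: near_eq_is_derive fv.
apply: filterS (near_curve fam dy (psi p)) => t dt.
by apply/esym; exact: graph_energyE.
Qed.

(** The left-hand side involves no choice of charts, so the right-hand side may be computed in any
    charts around [p] and its image. *)
Lemma energy_rateE psi p i j : C1_fun psi -> chart_dom (atlas i) p ->
  let y := chart_coord (atlas i) p in
  fam_dom e u_ i j (0, y) ->
  energy_rate psi p = (density h i y)^-1 *
    density_variation g alpha u_ i j y (psi p)
      (fun c => 'D_(delta_mx 0 c) (psi \o chart_inv (atlas i)) y).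
Proof. by move=> Cpsi dp y dy; have [] := is_derive_graph_energy Cpsi dp dy. Qed.

End EnergyCurve.

Section Calibrated.
Context {R : realType} {m k : nat}.
Local Notation n := (m + k)%N.
Variables (M : oriented_manifold R n) (L : oriented_manifold R k).
Local Notation c_k := (@energy_cst R k).
Variables (h : riem_metric M) (g : riem_metric L).
Variables (alpha : diff_form M m).
Variables (e : R) (u_ : R -> M -> L).
Hypothesis fam : smooth_family e u_.

Lemma fam_slice_jacobian i j t y : fam_dom e u_ i j (t, y) ->
  differentiable (local_rep (u_ t) i j) y /\
  'J (local_rep (u_ t) i j) y = \matrix_(c, b) fam_space u_ i j c b (t, y).
Proof.
move=> dy.
have dr : differentiable (local_rep (u_ t) i j) y.
  apply: differentiable_rV => a b; rewrite (ord1 a).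
  exact: C1_at_differentiable (C1_at_slice (fam_comp_C1 fam b dy)).
split=> //; apply/matrixP => c b; rewrite (jacobianE _ _ dr) [RHS]mxE.
by have [_] := is_derive_space (delta_mx 0 c) (C1_at_differentiable (fam_comp_C1 fam b dy)).
Qed.

Lemma fam_continuous t p : `|t| < e -> {for p, continuous (u_ t)}.
Proof.
move=> te; have c1 : {for p, continuous (fun q : M => (t, q))}.
  have c2 : {for p, continuous (fun q : M => t)} by exact: cst_continuous.
  have c3 : {for p, continuous (fun q : M => q)} by exact: cvg_id.
  exact: (cvg_pair c2 c3).
exact: (continuous_comp c1 (fam.1 _ _ te)).
Qed.

Lemma fam_norm_dE i j t p : chart_dom (atlas i) p ->
  fam_dom e u_ i j (t, chart_coord (atlas i) p) ->
  norm_d h g (u_ t) p = Num.sqrt (fam_du2 h g u_ i j (t, chart_coord (atlas i) p)).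
Proof.
move=> dp dy; have /fam_domP[te _ /=] := dy; rewrite chart_coordK // => dj.
have [dr JE] := fam_slice_jacobian dy.
rewrite (norm_dE h g dp dj (fam_continuous te) dr) JE.
by rewrite /fam_du2 /fam_rep /local_rep /= chart_coordK.
Qed.

(** The Smith equation evaluated on the coordinate frame [1%:M], with the target chart selected by
    [chart_at] replaced by an arbitrary [j]. *)
Lemma smith_calibrated : 0 < e ->
  (forall i y v, chart_codom (atlas i) y ->
     wedge_form alpha (pullback_form (u_ 0) (vol_form g)) i y v
     = c_k * norm_d h g (u_ 0) (chart_inv (atlas i) y) ^+ k * vol_form h i y v) ->
  calibrated h g alpha e u_.
Proof.
move=> e0 sm i j y dy; have /fam_domP[te cy dj] := dy.
have [dr JE] := fam_slice_jacobian dy.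
have dp := chart_inv_dom cy; have py := chart_invK cy.
have dy' : fam_dom e u_ i j (0, chart_coord (atlas i) (chart_inv (atlas i) y)) by rewrite py.
have dr' : differentiable (local_rep (u_ 0) i j) (chart_coord (atlas i) (chart_inv (atlas i) y)).
  by rewrite py.
have := sm i y 1%:M cy.
rewrite (fam_norm_dE dp dy') py /vol_form det1 mulr1 => smy.
apply: etrans (etrans _ smy) _; last by [].
rewrite /wedge_form /wedge_top -mulrA; congr (_ * _); rewrite mulr_suml.
apply: eq_bigr => s _; rewrite -[LHS]mulrA; congr (_ * _).
have := pullback_vol_formE g (dsubmx (row_perm s 1%:M)) dp dj (fam_continuous te) dr'.
by rewrite py JE => ->.
Qed.

End Calibrated.

Section EnergyRate.
Context {R : realType} {m k : nat}.
Local Notation n := (m + k)%N.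
Variables (M : oriented_manifold R n) (L : oriented_manifold R k).
Variables (h : riem_metric M) (g : riem_metric L).
Variables (alpha : diff_form M m).
Hypothesis halpha : closed_calibration h alpha.
Hypothesis k2 : (2 <= k)%N.
Variables (e : R) (u_ : R -> M -> L).
Hypothesis e0 : 0 < e.
Hypothesis fam : smooth_family e u_.
Hypothesis cal : calibrated h g alpha e u_.
Local Notation rate := (energy_rate h g u_).

Lemma density_variationD i j y (s s' : R) (d d' : 'I_n -> R) :
  density_variation g alpha u_ i j y (s + s') (fun c => d c + d' c)
  = density_variation g alpha u_ i j y s d + density_variation g alpha u_ i j y s' d'.
Proof.
rewrite /density_variation addrACA -mulrDl -mulrDr -!big_split /=; congr (_ * _ + _ * _).
  by apply: eq_bigr => b _; rewrite -mulrDr -mulrDl.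
apply: eq_bigr => f _; rewrite -mulrDr -big_split /=; congr (_ * _).
apply: eq_bigr => a _; rewrite -mulrDl; congr (_ * _).
by rewrite !mulrDl addrACA.
Qed.

Lemma fam_dom_chart_at p :
  fam_dom e u_ (chart_at p) (chart_at (u_ 0 p)) (0, chart_coord (atlas (chart_at p)) p).
Proof. by apply: fam_dom_coord; [rewrite normr0|exact: mem_chart_at|exact: mem_chart_at]. Qed.

Lemma energy_rateD psi psi' p : C1_fun psi -> C1_fun psi' ->
  rate (fun q => psi q + psi' q) p = rate psi p + rate psi' p.
Proof.
move=> C1 C2; have C3 : C1_fun (fun q => psi q + psi' q).
  by move=> i y cy; apply: C1_atD; [exact: C1|exact: C2].
have dy := fam_dom_chart_at p; have cy := chart_coord_codom (mem_chart_at p).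
rewrite !(energy_rateE halpha k2 fam cal _ (mem_chart_at p) dy) //.
rewrite -mulrDr; congr (_ * _); rewrite -density_variationD; congr (density_variation _ _ _ _ _ _ _).
apply/funext => c.
have d1 := C1_at_is_derive (delta_mx 0 c) (C1 _ _ cy).
have d2 := C1_at_is_derive (delta_mx 0 c) (C2 _ _ cy).
by have [_] := is_deriveD d1 d2.
Qed.

(** A zero of a nonnegative cut-off is a minimum, so the gradient vanishes there too, and the rate
    is linear in value and gradient. Hence the rate vanishes wherever the cut-off does, boundary
    points of its support included. *)
Lemma energy_rate_nonneg0 psi p : C1_fun psi -> (forall q, 0 <= psi q) -> psi p = 0 ->
  rate psi p = 0.
Proof.
move=> Cpsi psi0 psip.
have dy := fam_dom_chart_at p; have cy := chart_coord_codom (mem_chart_at p).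
rewrite (energy_rateE halpha k2 fam cal Cpsi (mem_chart_at p) dy) psip.
set y := chart_coord _ p in dy cy *.
have D0 v : 'D_v (psi \o chart_inv (atlas (chart_at p))) y = 0.
  have dl : differentiable (psi \o chart_inv (atlas (chart_at p))) (0 *: v + y).
    by rewrite scale0r add0r; exact: C1_at_differentiable (Cpsi _ _ cy).
  have [dd dE] := is_derive_line dl.
  rewrite scale0r add0r in dE; rewrite -dE; apply: derive_at_min => //.
  apply: near_all => s; rewrite /= scale0r add0r chart_coordK ?psip //.
  exact: mem_chart_at.
rewrite /density_variation big1 => [|b _]; last by rewrite mul0r mulr0.
rewrite mul0r add0r big1 ?mulr0 // => f _; rewrite big1 ?mulr0 // => a _.
by rewrite D0 !mul0r add0r mul0r.
Qed.

Lemma energy_rate_sum (I : Type) (r : seq I) (psi : I -> M -> R) p :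
  (forall q, C1_fun (psi q)) ->
  rate (fun p => \sum_(q <- r) psi q p) p = \sum_(q <- r) rate (psi q) p.
Proof.
move=> Cpsi; elim: r => [|q r IH].
  rewrite big_nil; apply: energy_rate_nonneg0; [|by move=> ?; rewrite big_nil|by rewrite big_nil].
  by apply: C1_fun_sum.
have E : (fun p => \sum_(q <- q :: r) psi q p) = (fun p => psi q p + \sum_(q <- r) psi q p).
  by apply/funext => p'; rewrite big_cons.
rewrite E big_cons -IH; apply: energy_rateD; first exact: Cpsi.
exact: C1_fun_sum.
Qed.

Lemma energy_rate_flux psi p i j : C1_fun psi -> chart_dom (atlas i) p ->
  let y := chart_coord (atlas i) p in
  fam_dom e u_ i j (0, y) ->
  rate psi p = (density h i y)^-1 * \sum_a \sum_(f : {ffun 'I_k -> 'I_n})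
    'D_(delta_mx 0 (f a)) (flux g alpha u_ i j (psi \o chart_inv (atlas i)) a f) y.
Proof.
move=> Cpsi dp y dy; rewrite (energy_rateE halpha k2 fam cal Cpsi dp dy).
have /fam_domP[_ cy _] := dy.
rewrite (divergence_flux g halpha fam dy (Cpsi _ _ cy)) /= /y.
by rewrite chart_coordK.
Qed.

End EnergyRate.

(** * Vanishing of the localised first variation *)

Lemma zero_sum_integral (R : realType) d (T : measurableType d) (mu : {measure set T -> \bar R})
    (I : Type) (r : seq I) (F : I -> T -> R) :
  (forall q, mu.-integrable setT (EFin \o F q) /\ \int[mu]_(p in setT) F q p = 0) ->
  mu.-integrable setT (EFin \o (fun p => \sum_(q <- r) F q p)) /\
  \int[mu]_(p in setT) (\sum_(q <- r) F q p) = 0.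
Proof.
move=> F0; elim: r => [|q r [IH1 IH2]].
  have -> : (fun p => \sum_(q <- [::]) F q p) = fun=> 0 by apply/funext => p; rewrite big_nil.
  split; last by rewrite Rintegral_cst ?mul0r //; exact: measurableT.
  exact: integrable0.
have -> : (fun p => \sum_(q <- q :: r) F q p) = fun p => F q p + \sum_(q <- r) F q p.
  by apply/funext => p; rewrite big_cons.
have [F1 F2] := F0 q; split.
  exact: (integrableD measurableT F1 IH1).
by rewrite RintegralD // F2 IH2 addr0.
Qed.

Section BallStokes.
Context {R : realType} {m k : nat}.
Local Notation n := (m + k)%N.
Variables (M : oriented_manifold R n) (L : oriented_manifold R k).
Variables (h : riem_metric M) (g : riem_metric L).
Variables (alpha : diff_form M m).
Hypothesis halpha : closed_calibration h alpha.
Hypothesis k2 : (2 <= k)%N.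
Variables (e : R) (u_ : R -> M -> L).
Hypothesis e0 : 0 < e.
Hypothesis fam : smooth_family e u_.
Hypothesis cal : calibrated h g alpha e u_.
Variable mu : {measure set (borel_space M) -> \bar R}.
Hypothesis hmu : is_vol_measure h mu.
Hypothesis mu_fin : (mu [set: borel_space M] < +oo)%E.
Local Notation rate := (energy_rate h g u_).

(* The factor [3] leaves room for the translations used in [stokes_chart]. *)
Definition adapted_ball i j a r C := forall y, ball a (3 * r) y ->
  [/\ fam_dom e u_ i j (0, y), density h i y <= C & (density h i y)^-1 <= C].

Lemma adapted_ball_exists p : exists r C, 0 < r /\
  adapted_ball (chart_at p) (chart_at (u_ 0 p)) (chart_coord (atlas (chart_at p)) p) r C.
Proof.
set i := chart_at p; set j := chart_at _; set a := chart_coord _ p.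
have da : fam_dom e u_ i j (0, a) by exact: fam_dom_chart_at.
have /fam_domP[_ ca _] := da.
(* [C] strictly exceeds the density and its inverse at the centre. The bound on the inverse serves
   [stokes_chart], the one on the density the finiteness of the volume. *)
pose C := density h i a + (density h i a)^-1 + 1.
have c0 : {for a, continuous (fun z : 'rV[R]_n => ((0, z) : R^o * 'rV[R]_n))}.
  by apply: differentiable_continuous; exact: differentiable_pair.
have n1 : \forall y \near a, fam_dom e u_ i j (0, y) := c0 _ (fam_dom_nbhs fam da).
have Cd := density_C1_at h ca; have d0 := density_gt0 h ca.
have CdV := C1_atV Cd (lt0r_neq0 d0).
have dV0 : 0 < (density h i a)^-1 by rewrite invr_gt0.
have n2 : \forall y \near a, density h i y < C.
  have lC : density h i a < C by rewrite /C; lra.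
  exact: (C1_at_continuous Cd (lt_nbhsl lC)).
have n3 : \forall y \near a, (density h i y)^-1 < C.
  have lC : (density h i a)^-1 < C by rewrite /C; lra.
  exact: (C1_at_continuous CdV (lt_nbhsl lC)).
have /nbhs_ballP[eps /= eps0 sub] : \forall y \near a, fam_dom e u_ i j (0, y) /\
    density h i y < C /\ (density h i y)^-1 < C by exact: filterI n1 (filterI n2 n3).
exists (eps / 3), C; split; first by rewrite divr_gt0.
move=> y; have -> : 3 * (eps / 3) = eps by field.
by move=> /sub[? [/ltW ? /ltW ?]].
Qed.

Lemma energy_rate_stokes i j a r C psi : 0 < r -> adapted_ball i j a r C ->
  C1_fun psi -> (forall p, 0 <= psi p) ->
  (forall p, psi p != 0 -> chart_dom (atlas i) p /\ ball a r (chart_coord (atlas i) p)) ->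
  mu.-integrable setT (EFin \o rate psi) /\ \int[mu]_(p in setT) rate psi p = 0.
Proof.
move=> r0 adB Cpsi psi0 psiB.
have sub : ball a (3 * r) `<=` chart_codom (atlas i).
  by move=> y /adB[/fam_domP[_ cy _]].
have b23 y : ball a (2 * r) y -> ball a (3 * r) y by apply: le_ball; lra.
have b13 y : ball a r y -> ball a (3 * r) y by apply: le_ball; lra.
pose F (b : 'I_k) (f : {ffun 'I_k -> 'I_n}) : 'rV[R]_n -> R :=
  flux g alpha u_ i j (psi \o chart_inv (atlas i)) b f.
(* The flux is meaningful only inside the charts. Since it vanishes off the ball of radius [r],
   truncation at [3 * r] gives a C1 function on the whole coordinate space. *)
pose w (b : 'I_k) (f : {ffun 'I_k -> 'I_n}) : 'rV[R]_n -> R := (F b f) \_ (ball a (3 * r)).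
have F0 b f y : chart_codom (atlas i) y -> ~ ball a r y -> F b f y = 0.
  move=> cy ny; rewrite /F /flux /=.
  have -> : psi (chart_inv (atlas i) y) = 0.
    apply/eqP; apply: contra_notT ny => /psiB[_].
    by rewrite chart_invK.
  by rewrite mul0r mulr0 mul0r mulr0.
have wF b f y : ball a (3 * r) y -> \forall z \near y, w b f z = F b f z.
  move=> by3; apply: filterS (open_nbhs_nbhs (conj (ball_open a (3 * r)) by3)) => z bz.
  by rewrite /w patchT // inE.
have wout b f y : ~ ball a r y -> w b f y = 0.
  move=> ny; rewrite /w /patch; case: ifPn => //; rewrite inE => b3.
  by apply: F0 => //; exact: sub.
have w0 b f y : ~ ball a (3 * r) y -> \forall z \near y, w b f z = 0.
  move=> ny; apply: filterS (nbhsx_ballx y r r0) => z yz; apply: wout => az.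
  apply: ny; apply: b23; rewrite mulr2n mulrDl mul1r; exact: ball_triangle az (ball_sym yz).
have Cw b f y : C1_at (w b f) y.
  have [b3|nb3] := pselect (ball a (3 * r) y); last first.
    apply: near_eq_C1_at (C1_at_cst 0 y); apply: filterS (w0 b f y nb3) => z wz.
    by rewrite wz.
  have [dy _ _] := adB y b3.
  have /fam_domP[_ cy _] := dy.
  apply: near_eq_C1_at (flux_C1 g alpha fam dy (Cpsi i y cy) b f).
  by apply: filterS (wF b f y b3) => z wz; apply/esym.
have dC y : ball a (3 * r) y -> (density h i y)^-1 <= C by move=> /adB[].
have st (b : 'I_k) (f : {ffun 'I_k -> 'I_n}) :=
  stokes_chart hmu mu_fin (delta_mx 0 (f b)) r0 sub dC (Cw b f) (wout b f).
have rateE : rate psi = (fun p : M => \sum_b \sum_(f : {ffun 'I_k -> 'I_n})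
    chart_fun i (fun y => (density h i y)^-1 * 'D_(delta_mx 0 (f b)) (w b f) y) p).
  apply/funext => p.
  (* Off the chart or off the large ball both sides are zero; inside, [w] agrees with the flux near
     the point. *)
  have psi00 : psi p = 0 -> rate psi p = 0 by exact: (energy_rate_nonneg0 halpha k2 e0 fam cal Cpsi psi0).
  have [dp|ndp] := pselect (chart_dom (atlas i) p); last first.
    rewrite psi00; last by apply/eqP; apply: contra_notT ndp => /psiB[].
    by rewrite big1 // => b _; rewrite big1 // => f _; rewrite chart_fun_out.
  have cy := chart_coord_codom dp; set y := chart_coord (atlas i) p in cy *.
  have [b3|nb3] := pselect (ball a (3 * r) y); last first.
    rewrite psi00; last by apply/eqP; apply: contra_notT nb3 => /psiB[_ /b13].
    rewrite big1 // => b _; rewrite big1 // => f _; rewrite chart_fun_in //.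
    have z0 : \forall z \near y, 0 = w b f z by apply: filterS (w0 b f y nb3).
    have [_ ->] := near_eq_is_derive z0 (is_derive_cst 0 y (delta_mx 0 (f b))).
    by rewrite mulr0.
  have [dy _ _] := adB y b3.
  rewrite (energy_rate_flux halpha k2 fam cal Cpsi dp dy) -/y mulr_sumr.
  apply: eq_bigr => b _; rewrite mulr_sumr; apply: eq_bigr => f _; rewrite chart_fun_in //.
  congr (_ * _).
  have wF' : \forall z \near y, F b f z = w b f z.
    by apply: filterS (wF b f y b3) => z wz; apply/esym.
  have Fd := C1_at_is_derive (delta_mx 0 (f b)) (flux_C1 g alpha fam dy (Cpsi i y cy) b f).
  by have [_ ->] := near_eq_is_derive wF' Fd.
rewrite rateE; apply: zero_sum_integral => b; apply: zero_sum_integral => f; exact: st.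
Qed.

End BallStokes.

(** * Partition of unity *)

Section Bump.
Context {R : realType}.

(* [`|s| ^+ 3 + s ^+ 3] is twice the cube of the positive part of [s]. *)
Lemma is_derive_pos_cube (s : R) :
  is_derive s (1 : R) (fun t : R => `|t| ^+ 3 + t ^+ 3) (3 * `|s| * s + 3 * s ^+ 2).
Proof.
have dX l : is_derive s (1 : R) (fun t : R => t ^+ l) (l%:R * s ^+ l.-1).
  have -> : (fun t : R => t ^+ l) = (id : R -> R) ^+ l by apply/funext => t; rewrite exprfctE.
  have H := is_deriveX l (is_derive_id s (1 : R)); apply: (is_derive_eq H).
  by rewrite /= [LHS]mulr1.
have d2 : is_derive s (1 : R) (fun t : R => t ^+ 2) (2 * s) := dX 2.
have d3 := dX 3.
have N0 : \forall t \near s, 0 <= t ^+ 2 by apply: near_all => t; exact: sqr_ge0.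
(* The cube of [|t|] is that of the square root of [t ^+ 2], which covers [t = 0] without a separate
   case. *)
have := is_deriveD (derivable_sqrtX (k := 3) erefl d2 N0) d3.
have -> : (fun t : R => Num.sqrt (t ^+ 2) ^+ 3) + (fun t => t ^+ 3) = fun t => `|t| ^+ 3 + t ^+ 3.
  by apply/funext => t; rewrite -sqrtr_sqr.
move=> H; apply: is_derive_eq H _; congr (_ + _).
by rewrite sqrtr_sqr expr1; field.
Qed.

Lemma C1_at_pos_cube (V : normedModType R) (f : V -> R) x : C1_at f x ->
  C1_at (fun z => `|f z| ^+ 3 + f z ^+ 3) x.
Proof.
move=> Cf; apply: (C1_at_comp1 (g := fun s => `|s| ^+ 3 + s ^+ 3) Cf
  (dg := fun s => 3 * `|s| * s + 3 * s ^+ 2)).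
  by apply: near_all => s; exact: is_derive_pos_cube.
apply: cvgD; apply: cvgM; try exact: cvg_cst.
- by apply: cvgM; [exact: cvg_cst|exact: norm_continuous].
- exact: cvg_id.
- exact: exprn_continuous.
Qed.

Lemma pos_cube_ge0 (s : R) : 0 <= `|s| ^+ 3 + s ^+ 3.
Proof.
rewrite -lerBlDr sub0r (le_trans (ler_norm _)) // normrN normrX //.
Qed.

Lemma pos_cube_gt0 (s : R) : (0 < `|s| ^+ 3 + s ^+ 3) = (0 < s).
Proof.
have [s0|s0] := leP s 0; last by rewrite addr_gt0 ?exprn_gt0 // normr_gt0 gt_eqF.
by rewrite ler0_norm // exprNn -signr_odd /= expr1 mulN1r addNr ltxx.
Qed.

(** A product over coordinates, since balls of row vectors are boxes; for positive [r], a factor is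
    positive exactly when its coordinate lies within [r] of the centre. *)
Definition box_bump n (a : 'rV[R]_n) (r : R) (y : 'rV[R]_n) : R :=
  \prod_c (`|r ^+ 2 - (y 0 c - a 0 c) ^+ 2| ^+ 3 + (r ^+ 2 - (y 0 c - a 0 c) ^+ 2) ^+ 3).

Lemma box_bump_ge0 n (a : 'rV[R]_n) r y : 0 <= box_bump a r y.
Proof. by apply: prodr_ge0 => c _; exact: pos_cube_ge0. Qed.

Lemma box_bump_C1 n (a : 'rV[R]_n) r y : C1_at (box_bump a r) y.
Proof.
apply: C1_at_prod => c _; apply: C1_at_pos_cube.
have Cc : C1_at (fun z : 'rV[R]_n => z 0 c - a 0 c) y.
  apply: C1_atD (C1_at_cst (- a 0 c) y).
  split=> [|v]; first by apply: near_all => z; exact: differentiable_coord.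
  apply: (near_eq_continuous (f := fun=> v 0 c)); last exact: cst_continuous.
  apply: near_all => z; rewrite -(derive_entry (f := id) v 0 c); last exact: ex_diff.
  by rewrite derive_id.
apply: near_eq_C1_at (C1_atD (C1_at_cst (r ^+ 2) y)
  (C1_atM (C1_at_cst (- 1) y) (C1_atM Cc Cc))).
by apply: near_all => z; rewrite mulN1r -expr2.
Qed.

Lemma box_bump_neq0 n (a : 'rV[R]_n) r y : 0 < r -> box_bump a r y != 0 <-> ball a r y.
Proof.
move=> r0.
have E c : (0 < r ^+ 2 - (y 0 c - a 0 c) ^+ 2) = (`|a 0 c - y 0 c| < r).
  rewrite subr_gt0 distrC -(real_normK (num_real (y 0 c - a 0 c))).
  by rewrite ltr_pXn2r // nnegrE // ltW.
split=> [b0|[_ ab]].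
  split=> // l c; rewrite (ord1 l) /ball /= -E -pos_cube_gt0 lt0r pos_cube_ge0 andbT.
  by apply: contraNneq b0 => b0; apply/prodf_eq0; exists c => //; apply/eqP.
rewrite gt_eqF //; apply: prodr_gt0 => c _; rewrite pos_cube_gt0 E.
exact: (ab 0 c).
Qed.

Definition chart_bump n (M : oriented_manifold R n) (i : chart_idx M) a r : M -> R :=
  chart_fun i (box_bump a r).

Section ChartBump.
Context {n : nat} (M : oriented_manifold R n) (i : chart_idx M) (a : 'rV[R]_n) (r : R).
Hypothesis r0 : 0 < r.
Hypothesis sub : ball a (3 * r) `<=` chart_codom (atlas i).

Lemma chart_bump_ge0 p : 0 <= chart_bump i a r p.
Proof.
have [dp|ndp] := pselect (chart_dom (atlas i) p).
  by rewrite /chart_bump chart_fun_in // box_bump_ge0.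
by rewrite /chart_bump chart_fun_out.
Qed.

Lemma chart_bump_neq0 p : chart_bump i a r p != 0 <->
  chart_dom (atlas i) p /\ ball a r (chart_coord (atlas i) p).
Proof.
have [dp|ndp] := pselect (chart_dom (atlas i) p).
  rewrite /chart_bump chart_fun_in // box_bump_neq0 //.
  by split=> [|[]].
by rewrite /chart_bump chart_fun_out // eqxx; split=> [|[]].
Qed.

(** The support lies in the image of a closed box inside the chart. That image is compact, hence
    closed because the manifold is Hausdorff, so extension by zero is smooth across the edge of the
    chart. *)
Lemma chart_bump_near0 p : ~ chart_dom (atlas i) p ->
  \forall q \near p, chart_bump i a r q = 0.
Proof.
move=> ndp.
pose K := [set y : 'rV[R]_n | forall c, closed_ball (a ord0 c) r (y ord0 c)].
have Kc : K `<=` chart_codom (atlas i).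
  move=> y Ky; apply: sub; split; first by rewrite mulr_gt0.
  move=> l c; rewrite (ord1 l); have := Ky c; rewrite closed_ballE // /closed_ball_ /= => /le_lt_trans.
  by apply; rewrite ltr_pMl // ltr1n.
have cK : compact K.
  by apply: (@rV_compact R n (fun c => closed_ball (a ord0 c) r)) => c; exact: closed_ballR_compact.
have cl : closed (chart_inv (atlas i) @` K).
  apply: compact_closed; first exact: manifold_hausdorff.
  apply: continuous_compact cK; apply: continuous_subspaceW Kc _.
  exact: chart_inv_continuous.
have nK : (~` (chart_inv (atlas i) @` K)) p.
  by move=> [y /Kc cy yp]; apply: ndp; rewrite -yp; exact: chart_inv_dom.
have oK : open (~` (chart_inv (atlas i) @` K)) by exact: closed_openC.
apply: filterS (open_nbhs_nbhs (conj oK nK)) => q nq.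
apply/eqP; apply: contra_notT nq => /chart_bump_neq0[dq [_ bq]].
exists (chart_coord (atlas i) q); last exact: chart_coordK.
by move=> c; apply: subset_closed_ball; exact: bq.
Qed.

Lemma local_dom_id_open i' : open (local_dom (id : M -> M) i' i).
Proof.
have -> : local_dom (id : M -> M) i' i = chart_codom (atlas i') `&`
    (chart_inv (atlas i') @^-1` chart_dom (atlas i)).
  by apply/seteqP; split=> z; rewrite local_domP.
rewrite openE => z [cz dz]; apply: filterI (chart_codom_nbhs cz) _.
exact: (chart_inv_cont cz (chart_dom_nbhs dz)).
Qed.

Lemma chart_bump_C1 : C1_fun (chart_bump i a r).
Proof.
move=> i' y cy; have dp := chart_inv_dom cy; set p := chart_inv (atlas i') y in dp.
have [dip|ndip] := pselect (chart_dom (atlas i) p); last first.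
  apply: near_eq_C1_at (C1_at_cst 0 y).
  have n0 : \forall q \near p, 0 = chart_bump i a r q.
    by apply: filterS (chart_bump_near0 ndip).
  exact: (chart_inv_cont cy n0).
apply: (near_eq_C1_at (f := box_bump a r \o local_rep (id : M -> M) i' i)).
  have nd : \forall z \near y, chart_dom (atlas i) (chart_inv (atlas i') z).
    exact: (chart_inv_cont cy (chart_dom_nbhs dip)).
  by apply: filterS nd => z dz; rewrite /= /chart_bump chart_fun_in.
apply: C1_at_comp; last exact: box_bump_C1.
move=> c; have od := local_dom_id_open (i' := i').
have sm : smooth_on (local_dom (id : M -> M) i' i)
    (fun z => local_rep (id : M -> M) i' i z 0 c : R^o).
  by apply: smooth_on_entry => //; exact: transition_smooth.
have ld : local_dom (id : M -> M) i' i y by apply/local_domP.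
exact: (smooth_on_C1_at od sm ld).
Qed.

End ChartBump.
End Bump.

Section Partition.
Context {R : realType} {m k : nat}.
Local Notation n := (m + k)%N.
Variables (M : oriented_manifold R n) (L : oriented_manifold R k).
Variables (h : riem_metric M).
Variables (e : R) (u_ : R -> M -> L).
Hypothesis e0 : 0 < e.
Hypothesis fam : smooth_family e u_.
Hypothesis cM : @compact M setT.

Local Notation ai p := (chart_at (o := M) p).
Local Notation aj p := (chart_at (u_ 0 p)).
Local Notation ay p := (chart_coord (atlas (ai p)) p).

Record adapted_partition := AdaptedPartition {
  centers : seq M;
  radius : M -> R;
  bound : M -> R;
  weight : M -> M -> R;
  radius_gt0 : forall q, 0 < radius q;
  partition_ball : forall q, adapted_ball h e u_ (ai q) (aj q) (ay q) (radius q) (bound q);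
  weight_C1 : forall q, C1_fun (weight q);
  weight_ge0 : forall q p, 0 <= weight q p;
  weight_supp : forall q p, weight q p != 0 ->
    chart_dom (atlas (ai q)) p /\ ball (ay q) (radius q) (chart_coord (atlas (ai q)) p);
  weight_sum : forall p, \sum_(q <- centers) weight q p = 1 }.

(** Compactness selects finitely many bumps whose sum is positive everywhere; dividing by this sum
    gives the weights. *)
Lemma adapted_partition_exists : inhabited adapted_partition.
Proof.
have /choice[rC rCP] : forall p : M, exists rC : R * R, 0 < rC.1 /\
    adapted_ball h e u_ (ai p) (aj p) (ay p) rC.1 rC.2.
  by move=> p; have [r [C rCp]] := adapted_ball_exists h e0 fam p; exists (r, C).
pose r p := (rC p).1.
have r0 p : 0 < r p by have [] := rCP p.
have sub q : ball (ay q) (3 * r q) `<=` chart_codom (atlas (ai q)).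
  by move=> y /((rCP q).2) [/fam_domP[_ cy _]].
pose b q := chart_bump (ai q) (ay q) (r q).
have Cb q : C1_fun (b q) by apply: chart_bump_C1.
have b0 q p : 0 <= b q p by exact: chart_bump_ge0.
have bsupp q p := @chart_bump_neq0 _ _ M (ai q) (ay q) (r q) (r0 q) p.
have oU q : open [set p | 0 < b q p].
  rewrite openE => p bp; exact: (C1_fun_continuous (Cb q) (lt_nbhsr bp)).
have cov : [set: M] `<=` cover [set: M] (fun q => [set p | 0 < b q p]).
  move=> p _; exists p => //=; rewrite lt0r b0 andbT; apply/bsupp.
  by split; [exact: mem_chart_at|exact: ballxx].
have cM' := cM; rewrite compact_cover in cM'.
have [D _ Dcov] := cM' _ _ _ (fun q _ => oU q) cov.
pose s := finmap.enum_fset D; pose S p := \sum_(q <- s) b q p.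
have S0 p : 0 < S p.
  have [q /= qD bq] := Dcov p I.
  rewrite /S (big_rem q) //=; apply: (lt_le_trans bq).
  by rewrite lerDl sumr_ge0.
have CS : C1_fun S by exact: C1_fun_sum.
constructor; apply: (@AdaptedPartition s r (fun q => (rC q).2) (fun q p => b q p * (S p)^-1)).
- exact: r0.
- by move=> q; have [] := rCP q.
- move=> q i y cy; apply: C1_atM; first exact: Cb.
  by apply: C1_atV; [exact: CS|rewrite /= gt_eqF].
- by move=> q p; rewrite mulr_ge0 // invr_ge0 ltW.
- by move=> q p; rewrite mulf_eq0 negb_or => /andP[/bsupp].
- by move=> p; rewrite -mulr_suml; exact: mulfV (lt0r_neq0 (S0 p)).
Qed.

Variable mu : {measure set (borel_space M) -> \bar R}.
Hypothesis hmu : is_vol_measure h mu.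

Lemma chart_ball_open (i : chart_idx M) a r :
  open (chart_dom (atlas i) `&` chart_coord (atlas i) @^-1` ball a r).
Proof.
rewrite openE => p [dp bp]; apply: filterI (chart_dom_nbhs dp) _.
exact: (chart_coord_cont dp (open_nbhs_nbhs (conj (ball_open a r) bp))).
Qed.

(** On the ball the inverse density is at least [C^-1], and its integral there is the flat volume of
    a box. *)
Lemma chart_ball_fin i j a r C : 0 < r -> adapted_ball h e u_ i j a r C ->
  (mu (chart_dom (atlas i) `&` chart_coord (atlas i) @^-1` ball a r) < +oo)%E.
Proof.
move=> r0 adB; set U := (X in mu X).
have oU : open U by exact: chart_ball_open.
have mU : measurable (U : set (borel_space M)) by exact: borel_open.
have C0 : 0 < C.
  have [da dC _] := adB a (ballxx a (mulr_gt0 (ltr0n _ 3) r0)).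
  have /fam_domP[_ ca _] := da.
  exact: lt_le_trans (density_gt0 h ca) dC.
have b13 y : ball a r y -> ball a (3 * r) y by apply: le_ball; lra.
pose f (p : borel_space M) := chart_fun i (fun y => (density h i y)^-1) p * \1_U p.
have f0 p : 0 <= f p.
  rewrite /f mulr_ge0 //.
  have [dp|ndp] := pselect (chart_dom (atlas i) p); last by rewrite chart_fun_out.
  by rewrite chart_fun_in // invr_ge0 ltW // density_gt0 //; exact: chart_coord_codom.
have mf : measurable_fun [set: borel_space M] f.
  apply: measurable_funM; last exact: measurable_indic.
  apply: measurable_chart_fun => y cy; apply: C1_at_continuous.
  by apply: C1_atV; [exact: density_C1_at|rewrite gt_eqF // density_gt0].
have mfE : measurable_fun [set: borel_space M] (EFin \o f) by exact/measurable_EFinP.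
have intf : (\int[mu]_(p in setT) (f p)%:E = integral_rV (fun y => (\1_(ball a r) y)%:E))%E.
  rewrite (hmu (i := i) mfE) => [|p|p ndp].
  - congr integral_rV; apply/funext => y; rewrite /patch; case: ifPn; rewrite ?inE ?notin_setE.
      move=> cy; rewrite /= /f chart_fun_in; last exact: chart_inv_dom.
      rewrite chart_invK // -EFinM; congr _%:E.
      have -> : \1_U (chart_inv (atlas i) y) = \1_(ball a r) y :> R.
        rewrite !indicE; congr (nat_of_bool _)%:R; apply/idP/idP; rewrite !inE /U /=.
          by move=> [_]; rewrite chart_invK.
        by move=> ab; split; [exact: chart_inv_dom|rewrite chart_invK].
      by rewrite mulrAC -/(density h i y) mulVf ?mul1r // gt_eqF // density_gt0.
    move=> ncy; rewrite indicE memNset // => /b13/adB[/fam_domP[_ cy _] _ _].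
    exact: ncy.
  - by rewrite lee_fin.
  - by rewrite /= /f chart_fun_out // mul0r.
have le1 : (\int[mu]_(p in setT) (C^-1 * \1_U p)%:E <= \int[mu]_(p in setT) (f p)%:E)%E.
  apply: ge0_le_integral => //.
  - by move=> p _; rewrite lee_fin mulr_ge0 // invr_ge0 ltW.
  - by apply/measurable_EFinP/measurable_funM => //; exact: measurable_indic.
  move=> p _; rewrite lee_fin /f indicE; case: (boolP (p \in U)); rewrite ?inE ?notin_setE; last first.
    by rewrite !mulr0.
  move=> [dp bp]; rewrite !mulr1 chart_fun_in //.
  have [dd dC _] := adB _ (b13 _ bp); have /fam_domP[_ cp _] := dd.
  by rewrite lef_pV2 // posrE density_gt0.
have E1 : (\int[mu]_(p in setT) (C^-1 * \1_U p)%:E = C^-1%:E * mu U)%E.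
  under eq_integral do rewrite EFinM.
  rewrite ge0_integralZl_EFin //; first by rewrite integral_indic // setIT.
  - by apply/measurable_EFinP; exact: measurable_indic.
  - by rewrite invr_ge0 ltW.
have fin : (C^-1%:E * mu U < +oo)%E.
  by rewrite -E1 (le_lt_trans le1) // intf integral_rV_ball.
rewrite ltey; apply: contraTneq fin => ->.
by rewrite gt0_muley ?lte_fin ?invr_gt0 // ltxx.
Qed.

(** Weights summing to 1 cannot all vanish at a point, so finitely many adapted balls cover M.
    Finite volume makes constants admissible as dominating functions. *)
Lemma vol_measure_fin : (mu [set: borel_space M] < +oo)%E.
Proof.
have [P] := adapted_partition_exists.
pose U q := chart_dom (atlas (ai q)) `&` chart_coord (atlas (ai q)) @^-1` ball (ay q) (radius P q).
have mU q : measurable (U q : set (borel_space M)) by apply: borel_open; exact: chart_ball_open.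
have fin (s : seq M) : measurable (\big[setU/set0]_(q <- s) U q : set (borel_space M)) /\
   (mu (\big[setU/set0]_(q <- s) U q) < +oo)%E.
  elim: s => [|q s [IH1 IH2]].
    by rewrite big_nil measure0; split=> //; exact: measurable0.
  rewrite big_cons; split; first exact: measurableU.
  apply: le_lt_trans (measureU2 mu (mU q) IH1) _.
  have Uq : (mu (U q) < +oo)%E.
    exact: (chart_ball_fin (radius_gt0 P q) (@partition_ball P q)).
  exact: lte_add_pinfty Uq IH2.
have -> : [set: borel_space M] = \big[setU/set0]_(q <- centers P) U q.
  apply/seteqP; split=> // p _.
  have : \sum_(q <- centers P) weight P q p != 0 by rewrite weight_sum oner_eq0.
  elim: (centers P) => [|q s IH]; first by rewrite !big_nil eqxx.
  rewrite !big_cons; have [->|w0 _] := eqVneq (weight P q p) 0.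
    by rewrite add0r => /IH; right.
  by left; exact: weight_supp w0.
exact: (fin _).2.
Qed.

End Partition.

(** * Differentiation of the energy *)

Section EnergyDerivative.
Context {R : realType} {m k : nat}.
Local Notation n := (m + k)%N.
Variables (M : oriented_manifold R n) (L : oriented_manifold R k).
Variables (h : riem_metric M) (g : riem_metric L).
Hypothesis k2 : (2 <= k)%N.
Variables (e : R) (u_ : R -> M -> L).
Hypothesis e0 : 0 < e.
Hypothesis fam : smooth_family e u_.
Hypothesis cM : @compact M setT.
Local Notation dens t p := (norm_d h g (u_ t) p ^+ k).
Local Notation du i j := (fam_du2 h g u_ i j).

(** The derivative supplied by [derivable_sqrtX], written so that it is visibly continuous in time
    and space together, also at zeros of du. *)
Definition density_rate i j (z : R^o * 'rV[R]_n) : R :=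
  k%:R / 2 * Num.sqrt (du i j z) ^+ (k - 2) * 'D_e_time (du i j) z.

Lemma is_derive_density p i j t : chart_dom (atlas i) p ->
  fam_dom e u_ i j (t, chart_coord (atlas i) p) ->
  is_derive (t : R) (1 : R) (fun t : R => dens t p)
    (density_rate i j (t, chart_coord (atlas i) p)).
Proof.
move=> dp; set y := chart_coord (atlas i) p => dy.
have c0 : {for (t : R), continuous (fun s : R => ((s, y) : R^o * 'rV[R]_n))}.
  have c1 : {for (t : R), continuous (fun s : R => s : R^o)} by exact: cvg_id.
  exact: (cvg_pair c1 (@cst_continuous _ _ y _)).
have nd : \forall s \near t, fam_dom e u_ i j (s, y) := c0 _ (fam_dom_nbhs fam dy).
have dN : is_derive t (1 : R) (fun s : R => du i j (s, y)) ('D_e_time (du i j) (t, y)).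
  have dd : differentiable (du i j) (t * 1, y).
    by rewrite mulr1; exact: C1_at_differentiable (fam_du2_C1 h g fam dy).
  have := is_derive_time dd; rewrite mulr1 mul1r.
  by apply: near_eq_is_derive; apply: near_all => s; rewrite mulr1.
have N0 : \forall s \near t, 0 <= du i j (s, y).
  by apply: filterS nd => s ds; exact: (fam_du2_ge0 h g ds).
apply: near_eq_is_derive (derivable_sqrtX k2 dN N0).
by apply: filterS nd => s ds; rewrite (fam_norm_dE h g fam dp ds).
Qed.

Lemma near_fam_dom p i j t : chart_dom (atlas i) p ->
  fam_dom e u_ i j (t, chart_coord (atlas i) p) ->
  {for (t, p), continuous (fun z : R * M => ((z.1, chart_coord (atlas i) z.2) : R^o * 'rV[R]_n))}.
Proof.
move=> dp dy.
have c1 : {for (t, p), continuous (fun z : R * M => z.1 : R^o)} by exact: cvg_fst.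
have c2 : {for (t, p), continuous (snd : R * M -> M)} by exact: cvg_snd.
exact: (cvg_pair c1 (continuous_comp c2 (chart_coord_cont dp))).
Qed.

Lemma continuous_dens t p : `|t| < e -> {for p, continuous (fun q => dens t q)}.
Proof.
move=> te; have dp := mem_chart_at p; set i := chart_at p in dp.
set j := chart_at (u_ t p).
have dy : fam_dom e u_ i j (t, chart_coord (atlas i) p).
  by apply: fam_dom_coord => //; exact: mem_chart_at.
have c1 : {for p, continuous (fun q : M => ((t, chart_coord (atlas i) q) : R^o * 'rV[R]_n))}.
  exact: (cvg_pair (@cst_continuous _ _ (t : R^o) _) (chart_coord_cont dp)).
have nd : \forall q \near p, fam_dom e u_ i j (t, chart_coord (atlas i) q).
  exact: (c1 _ (fam_dom_nbhs fam dy)).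
apply: (near_eq_continuous (f := fun q => Num.sqrt (du i j (t, chart_coord (atlas i) q)) ^+ k)).
  by apply: filterS2 (chart_dom_nbhs dp) nd => q dq dq'; rewrite (fam_norm_dE h g fam dq dq').
have c2 := continuous_comp c1 (C1_at_continuous (fam_du2_C1 h g fam dy)).
have c3 := continuous_comp c2 (@sqrt_continuous R _).
exact: (continuous_comp c3 (@exprn_continuous R k _)).
Qed.

(** A single [d] is both the length of the time interval and, through [d^-1], the bound. Local
    statements then hold for all small [d], and compactness in the form of near coverings yields one
    [d] for all of M. *)
Lemma dens_uniform : exists2 d : R, 0 < d & forall t p, `|t| < d ->
  [/\ `|t| < e, `|dens t p| <= d^-1, derivable (fun t : R => dens t p) t 1 &
      `|'D_1 (fun t : R => dens t p) t| <= d^-1].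
Proof.
pose P (d : R) (p : M) := forall t, `|t| < d ->
  [/\ `|t| < e, `|dens t p| <= d^-1, derivable (fun t : R => dens t p) t 1 &
      `|'D_1 (fun t : R => dens t p) t| <= d^-1].
have nc := (compact_near_coveringP _).1 cM.
have loc p : [set: M] p -> \forall p' \near p & d \near (0 : R)^'+, P d p'.
  move=> _; have dp := mem_chart_at p; set i := chart_at p in dp.
  set j := chart_at (u_ 0 p).
  have dy : fam_dom e u_ i j (0, chart_coord (atlas i) p) by exact: fam_dom_chart_at.
  set y := chart_coord (atlas i) p in dy.
  have c0 := near_fam_dom dp dy.
  have CN := fam_du2_C1 h g fam dy.
  have cs : {for (0 : R^o, y), continuous (fun z : R^o * 'rV[R]_n => Num.sqrt (du i j z))}.
    exact: (continuous_comp (C1_at_continuous CN) (@sqrt_continuous R _)).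
  have cd : {for (0 : R^o, y), continuous (fun z : R^o * 'rV[R]_n => Num.sqrt (du i j z) ^+ k)}.
    exact: (continuous_comp cs (@exprn_continuous R k _)).
  have cr : {for (0 : R^o, y), continuous (density_rate i j)}.
    apply: continuousM; last exact: CN.2.
    apply: continuousM; first exact: cst_continuous.
    exact: (continuous_comp cs (@exprn_continuous R (k - 2) _)).
  pose B := `|Num.sqrt (du i j (0, y)) ^+ k| + `|density_rate i j (0, y)| + 1.
  have n1 : \forall z \near ((0 : R^o, y) : R^o * 'rV[R]_n), `|Num.sqrt (du i j z) ^+ k| < B.
    have lB : `|Num.sqrt (du i j (0, y)) ^+ k| < B.
      by rewrite /B -addrA ltrDl ltr_wpDl.
    exact: (continuous_comp cd (@norm_continuous _ R _)) _ (lt_nbhsl lB).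
  have n2 : \forall z \near ((0 : R^o, y) : R^o * 'rV[R]_n), `|density_rate i j z| < B.
    have lB : `|density_rate i j (0, y)| < B.
      by rewrite /B addrAC ltrDr ltr_wpDl.
    exact: (continuous_comp cr (@norm_continuous _ R _)) _ (lt_nbhsl lB).
  have n3 := fam_dom_nbhs fam dy.
  have n3' : \forall z \near ((0 : R^o, y) : R^o * 'rV[R]_n), fam_dom e u_ i j z /\
      (`|Num.sqrt (du i j z) ^+ k| < B /\ `|density_rate i j z| < B).
    by apply: filterI n3 _; exact: filterI n1 n2.
  have n4 : \forall z \near ((0 : R, p) : R * M),
      fam_dom e u_ i j (z.1, chart_coord (atlas i) z.2) /\
      (`|Num.sqrt (du i j (z.1, chart_coord (atlas i) z.2)) ^+ k| < B /\
      `|density_rate i j (z.1, chart_coord (atlas i) z.2)| < B).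
    exact: (c0 _ n3').
  have [[A1 A2] /= [nA1 nA2] A12] := n4.
  have /nbhs_ballP[eps /= eps0 subA] := nA1.
  have B0 : 0 < B by rewrite /B ltr_wpDl // addr_ge0.
  (* [d < eps] keeps the times in the product neighbourhood, and [d < B^-1] makes [d^-1] larger than
     the local bound. *)
  exists (A2 `&` chart_dom (atlas i), [set d | 0 < d /\ (d < eps /\ d < B^-1)]) => /=.
    split; first by apply: filterI nA2 (chart_dom_nbhs dp).
    apply: filterI; first exact: nbhs_right_gt.
    by apply: filterI; apply: nbhs_right_lt; rewrite ?invr_gt0.
  move=> [q d] /= [[A2q dq] [d0 [deps dB]]] t td.
  have Bd : B < d^-1 by rewrite -ltf_pV2 ?posrE ?invr_gt0 // invrK.
  have At : A1 t by apply: subA; rewrite /ball /= sub0r normrN; exact: lt_trans td deps.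
  have [dt [b1 b2]] := A12 (t, q) (conj At A2q).
  have [de dE] := is_derive_density dq dt.
  split=> //.
  - by have /fam_domP[] := dt.
  - by rewrite (fam_norm_dE h g fam dq dt) (le_trans (ltW b1)) // ltW.
  - by rewrite dE (le_trans (ltW b2)) // ltW.
have nP : \forall d \near (0 : R)^'+, [set: M] `<=` P d by exact: nc loc.
have nP' : \forall d \near (0 : R)^'+, 0 < d /\ [set: M] `<=` P d.
  by apply: filterI nP; exact: nbhs_right_gt.
have [d [d0 Pd]] := filter_ex nP'.
by exists d => // t p; exact: Pd.
Qed.

Variable mu : {measure set (borel_space M) -> \bar R}.
Hypothesis mu_fin : (mu [set: borel_space M] < +oo)%E.

Lemma is_derive_energy_integral :
  is_derive (0 : R) (1 : R) (fun t : R => \int[mu]_(p in setT) dens t p)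
    (\int[mu]_(p in setT) 'D_1 (fun t : R => dens t p) 0).
Proof.
have [d d0 dP] := dens_uniform.
have Ia : `](- d), d[%classic 0 by rewrite /= in_itv /= oppr_lt0 d0.
have It (t : R) : `](- d), d[%classic t -> `|t| < d by rewrite /= in_itv /= ltr_norml.
have int t : `](- d), d[%classic t -> mu.-integrable setT (EFin \o (fun p => dens t p)).
  move=> /It td; apply: (integrable_bounded mu_fin (C := d^-1)).
    apply: borel_continuous; first exact: openT.
    by move=> p _; apply: continuous_dens; have [] := dP t p td.
  by move=> p; have [] := dP t p td.
have der t (p : borel_space M) : `](- d), d[%classic t -> [set: borel_space M] p ->
    derivable (fun t : R => dens t p) t 1.
  by move=> /It td _; have [] := dP t p td.
have intG : mu.-integrable setT (EFin \o (fun _ : borel_space M => d^-1)).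
  apply: (integrable_bounded mu_fin (C := d^-1)); first exact: measurable_cst.
  by move=> p; rewrite ger0_norm // invr_ge0 ltW.
have G0 (p : borel_space M) : 0 <= d^-1 by rewrite invr_ge0 ltW.
have Gle t (p : borel_space M) : `](- d), d[%classic t -> [set: borel_space M] p ->
    `|partial1of2 (fun t p => dens t p) t p| <= d^-1.
  by move=> /It td _; rewrite /partial1of2 derive1E; have [] := dP t p td.
have cv := cvg_differentiation_under_integral measurableT Ia int der G0 intG Gle.
have E : \int[mu]_(p in setT) partial1of2 (fun t p => dens t p) 0 p
   = \int[mu]_(p in setT) 'D_1 (fun t : R => dens t p) 0.
  by apply: eq_Rintegral => p _; rewrite /partial1of2 derive1E.
rewrite E in cv.
have cv' : h^-1 *: (\int[mu]_(p in setT) dens (h *: 1 + 0) p - \int[mu]_(p in setT) dens 0 p)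
    @[h --> (0 : R)^'] --> \int[mu]_(p in setT) 'D_1 (fun t : R => dens t p) 0.
  apply: cvg_trans cv; apply: near_eq_cvg; apply: nearW => s.
  by rewrite [s%:A]mulr1.
apply: DeriveDef; first by apply/cvg_ex; eexists; exact: cv'.
exact: cvg_lim cv'.
Qed.

End EnergyDerivative.

(** The constant cut-off 1 gives back the original family. It is the sum of the weights, and the
    rate is additive in the cut-off. *)
Lemma integral_energy_rate_cst1 (R : realType) (m k : nat) (M : oriented_manifold R (m + k))
    (L : oriented_manifold R k) (h : riem_metric M) (g : riem_metric L) (alpha : diff_form M m)
    (e : R) (u_ : R -> M -> L) (mu : {measure set (borel_space M) -> \bar R}) :
  (2 <= k)%N -> @compact M setT -> closed_calibration h alpha -> 0 < e ->
  smooth_family e u_ -> calibrated h g alpha e u_ -> is_vol_measure h mu ->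
  mu.-integrable setT (EFin \o energy_rate h g u_ (fun=> 1)) /\
  \int[mu]_(p in setT) energy_rate h g u_ (fun=> 1) p = 0.
Proof.
move=> k2 cM halpha e0 fam cal hmu.
have mu_fin := vol_measure_fin e0 fam cM hmu.
have [P] := adapted_partition_exists h e0 fam cM.
have -> : energy_rate h g u_ (fun=> 1)
    = fun p => \sum_(q <- centers P) energy_rate h g u_ (weight P q) p.
  apply/funext => p; rewrite -(energy_rate_sum halpha k2 e0 fam cal); last exact: weight_C1.
  by congr (energy_rate h g u_ _ p); apply/funext => p'; rewrite weight_sum.
apply: zero_sum_integral => q.
exact: (energy_rate_stokes halpha k2 e0 fam cal hmu mu_fin (radius_gt0 P q)
  (@partition_ball _ _ _ _ _ _ _ _ P q) (@weight_C1 _ _ _ _ _ _ _ _ P q)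
  (weight_ge0 P q) (@weight_supp _ _ _ _ _ _ _ _ P q)).
Qed.

(** Stating this with an equation [mkn] makes the degree [n] a variable, so that eliminating the
    equation reduces the cast to the identity. *)
Lemma smith_critical_point (R : realType) (m k n : nat) (mkn : (m + k)%N = n)
    (M : oriented_manifold R n) (L : oriented_manifold R k)
    (h : riem_metric M) (g : riem_metric L) (alpha : diff_form M m) (u : M -> L) :
  (2 <= k)%N -> @compact M setT -> closed_calibration h alpha ->
  (forall i y v, chart_codom (atlas i) y ->
     wedge_form alpha (pullback_form u (vol_form g)) i y (castmx (esym mkn, erefl) v)
     = (Num.sqrt k%:R ^+ k)^-1 * norm_d h g u (chart_inv (atlas i) y) ^+ k * vol_form h i y v) ->
  critical_point h g u.
Proof.
case: n / mkn M h alpha u => M h alpha u k2 cM halpha sm e u_ e0 fam u0.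
have uE : u = u_ 0 by apply/funext => p; rewrite u0.
have cal : calibrated h g alpha e u_.
  apply: (smith_calibrated fam e0) => i y v cy.
  rewrite -uE; have smv := sm i y v cy; rewrite castmx_id in smv.
  exact: smv.
rewrite /k_energy /vol_measure; case: pselect => [hmu|_]; last first.
  (* For the default measure [mzero] the energy is zero at all times. *)
  apply: near_eq_is_derive (is_derive_cst (0 : R) (0 : R) (1 : R)).
  by apply: near_all => t; rewrite /Rintegral integral_measure_zero mulr0.
have := svalP (cid hmu); set mu := sval _ => hmu'.
have mu_fin := vol_measure_fin e0 fam cM hmu'.
have dI := is_derive_energy_integral h g k2 e0 fam cM mu_fin.
have [int1 int0] := integral_energy_rate_cst1 k2 cM halpha e0 fam cal hmu'.
have k0 : (0 < k)%N by exact: ltnW.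
have c0 : @energy_cst R k != 0.
  by rewrite invr_neq0 // expf_neq0 // gt_eqF // sqrtr_gt0 ltr0n.
(* For the cut-off 1 the rate is the energy constant times the derivative of the density; the
   constant is nonzero and can be divided out. *)
have E : \int[mu]_(p in setT) 'D_1 (fun t : R => norm_d h g (u_ t) p ^+ k) 0 = 0.
  apply: etrans (mulr0 (@energy_cst R k)^-1).
  rewrite -[X in _ = _ * X]int0 -RintegralZl //; apply: eq_Rintegral => p _.
  have dF : derivable (fun t : R => norm_d h g (u_ t) p ^+ k) 0 1.
    have [d d0 dP] := dens_uniform h g k2 e0 fam cM.
    by have [] := dP 0 p; rewrite ?normr0.
  have -> : energy_rate h g u_ (fun=> 1) p
      = @energy_cst R k * 'D_1 (fun t : R => norm_d h g (u_ t) p ^+ k) 0.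
    rewrite /energy_rate.
    have HZ := is_deriveZ (@energy_cst R k) (derivableP dF).
    apply: etrans (derive_val (is_derive := HZ)).
    have -> // : graph_energy h g u_ (fun=> 1) p
        = @energy_cst R k \*: (fun t : R => norm_d h g (u_ t) p ^+ k).
    apply/funext => t; rewrite /graph_energy.
    by under [in LHS]eq_fun do rewrite mulr1.
  by rewrite mulrA mulVf // mul1r.
rewrite E in dI; have := is_deriveZ (@energy_cst R k) dI.
by rewrite scaler0.
Qed.

Theorem theorem4p14 (R : realType) (n k : nat) (hk : (2 <= k)%N)
    (hkn : (k <= n)%N)
    (M : oriented_manifold R n) (L : oriented_manifold R k)
    (h : riem_metric M) (g : riem_metric L)
    (hM : @compact M setT)
    (alpha : diff_form M (n - k)) (halpha : closed_calibration h alpha)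
    (u : M -> L) (hu : smith_submersion hkn h g alpha u) :
  critical_point h g u.
Proof. by have [_ _ sm] := hu; exact: smith_critical_point sm. Qed.
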